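(* Let $\mathcal{L}$ be a real line arrangement in $\mathbb{CP}^2$ consisting of $n\ge 1$ lines, and choose the line at infinity (not in $\mathcal{L}$) such that all the lines of $\mathcal{L}$ intersect in $\mathbb{C}^2$, i.e. all intersection points of lines of $\mathcal{L}$ lie in $\mathbb{C}^2$. Assume that $\mathcal{L}$ has exactly $k$ multiple intersection points $p_1,\dots,p_k$, with multiplicities $m_1,\dots,m_k$ respectively. Assume also that for every equivalence class of the relation $\sim$ on the multiple points, all the multiple points of that class are collinear, i.e. there is a line of $\mathcal{L}$ on which all the multiple points of that class lie. Then $$\pi_1(\mathbb{CP}^2-\mathcal{L},u_0)\cong\bigoplus_{i=1}^k\mathbb{F}^{m_i-1}\oplus\mathbb{Z}^{\,n-1-\sum_{i=1}^k(m_i-1)} .$$ Moreover, the number of infinite cyclic groups $n-1-\sum_{i=1}^k(m_i-1)$ is the sum of two numbers: the number of equivalence classes of $\sim$ minus $1$, and the number of lines of $\mathcal{L}$ which have only simple intersection points.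
   Context: A real line arrangement is a finite union of distinct projective lines in $\mathbb{CP}^2$, each of which can be defined by a linear equation with real coefficients; $\mathcal{L}$ denotes both the set of lines and their union. A simple point is a point where exactly two lines of the arrangement meet; a multiple point is a point where more than two lines meet; the multiplicity of a point is the number of lines of the arrangement passing through it. The relation $\sim$ on the set of multiple points is defined by: $p\sim q$ if $p$ is connected to $q$ by a path whose vertices are multiple points, i.e. there is a finite sequence of multiple points from $p$ to $q$ (possibly the empty path, when $p=q$) in which any two consecutive points lie on a common line of $\mathcal{L}$; it is an equivalence relation. $\mathbb{F}^k$ denotes the free group on $k$ generators, $\oplus$ denotes the direct product of groups, and $u_0$ is a base point. *)

(* Defs.v *)
From HB Require Import structures.
From mathcomp Require Import all_boot all_order all_algebra finmap generic_quotient complex.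
From mathcomp Require Import ring lra.
From mathcomp Require Import all_classical all_reals topology normedtype homotopy.
Set Implicit Arguments.
Unset Strict Implicit.
Unset Printing Implicit Defensive.
Import Order.TTheory GRing.Theory Num.Theory.
Import numFieldNormedType.Exports.
Local Open Scope classical_set_scope.
Local Open Scope quotient_scope.
Local Open Scope ring_scope.

Definition group_isomorphic (G H : groupType) : Prop :=
  exists f : {multiplicative G -> H}, bijective f.

(* The free group on T: words in signed letters modulo cancellation of
   adjacent inverse letters; (x, true) stands for x and (x, false) for x^-1. *)
Section FreeGroup.
Variable T : choiceType.
Implicit Types u v w : seq (T * bool).

Inductive word_cong : seq (T * bool) -> seq (T * bool) -> Prop :=
| word_cancel u v x e :
    word_cong (u ++ (x, e) :: (x, ~~ e) :: v) (u ++ v)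
| word_refl u : word_cong u u
| word_sym u v : word_cong u v -> word_cong v u
| word_trans v u w : word_cong u v -> word_cong v w -> word_cong u w.

Definition word_congb u v : bool := `[< word_cong u v >].

Lemma word_congb_equiv : equiv_class_of word_congb.
Proof.
split=> [u|u v|v u w]; first exact/asboolP/word_refl.
  by apply/asboolP/asboolP; exact: word_sym.
by move=> /asboolP uv /asboolP vw; apply/asboolP/(word_trans uv vw).
Qed.

Canonical word_equiv := EquivRelPack word_congb_equiv.

Definition free_group : Type := {eq_quot word_equiv}.
HB.instance Definition _ := Choice.on free_group.

Definition word_class u : free_group := \pi_{eq_quot word_equiv} u.
Definition word_repr (x : free_group) : seq (T * bool) :=
  repr (x : {eq_quot word_equiv}).

Lemma word_reprK x : word_class (word_repr x) = x.
Proof. exact: reprK. Qed.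

Lemma word_classP u v : word_class u = word_class v <-> word_cong u v.
Proof.
by split=> [/eqmodP/asboolP //|uv]; apply/eqmodP/asboolP.
Qed.

Lemma word_repr_class u : word_cong (word_repr (word_class u)) u.
Proof. by apply/word_classP; rewrite word_reprK. Qed.

Lemma word_cong_catl w u v : word_cong u v -> word_cong (w ++ u) (w ++ v).
Proof.
elim=> {u v} [u v x e|u|u v _|u v t _ uv _ vt]; last exact: word_trans uv vt.
- by rewrite !catA; exact: word_cancel.
- exact: word_refl.
- exact: word_sym.
Qed.

Lemma word_cong_catr w u v : word_cong u v -> word_cong (u ++ w) (v ++ w).
Proof.
elim=> {u v} [u v x e|u|u v _|u v t _ uv _ vt]; last exact: word_trans uv vt.
- by rewrite -!catA; exact: word_cancel.
- exact: word_refl.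
- exact: word_sym.
Qed.

Lemma word_cong_cat u u' v v' :
  word_cong u u' -> word_cong v v' -> word_cong (u ++ v) (u' ++ v').
Proof.
move=> uu' vv'; apply: (word_trans (word_cong_catr v uu')).
exact: word_cong_catl.
Qed.

Definition word_inv u := rev [seq (a.1, ~~ a.2) | a <- u].

Lemma word_invK : involutive word_inv.
Proof.
move=> u; rewrite /word_inv map_rev revK -map_comp -[RHS]map_id.
by apply: eq_map => -[x e] /=; rewrite negbK.
Qed.

Lemma word_inv_cat u v : word_inv (u ++ v) = word_inv v ++ word_inv u.
Proof. by rewrite /word_inv map_cat rev_cat. Qed.

Lemma word_cong_inv u v : word_cong u v -> word_cong (word_inv u) (word_inv v).
Proof.
elim=> {u v} [u v x e|u|u v _|u v t _ uv _ vt]; last exact: word_trans uv vt.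
- rewrite !word_inv_cat /word_inv /= !rev_cons negbK !cat_rcons.
  exact: word_cancel.
- exact: word_refl.
- exact: word_sym.
Qed.

Lemma word_mulV u : word_cong (u ++ word_inv u) [::].
Proof.
elim/last_ind: u => [|u [x e] IHu]; first exact: word_refl.
rewrite /word_inv map_rcons rev_rcons cat_rcons /=.
exact: word_trans (word_cancel _ _ _ _) IHu.
Qed.

Definition free_mul (x y : free_group) := word_class (word_repr x ++ word_repr y).
Definition free_one : free_group := word_class [::].
Definition free_inv (x : free_group) := word_class (word_inv (word_repr x)).

Lemma free_mulE u v :
  free_mul (word_class u) (word_class v) = word_class (u ++ v).
Proof. by apply/word_classP/word_cong_cat; exact: word_repr_class. Qed.

Lemma free_invE u : free_inv (word_class u) = word_class (word_inv u).
Proof. by apply/word_classP/word_cong_inv; exact: word_repr_class. Qed.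

Lemma free_mulA : associative free_mul.
Proof.
move=> x y z; rewrite -[x]word_reprK -[y]word_reprK -[z]word_reprK.
by rewrite !free_mulE catA.
Qed.

Lemma free_mul1 : left_id free_one free_mul.
Proof. by move=> x; rewrite -[x]word_reprK free_mulE. Qed.

Lemma free_mulx1 : right_id free_one free_mul.
Proof. by move=> x; rewrite -[x]word_reprK free_mulE cats0. Qed.

Lemma free_mulVx : left_inverse free_one free_inv free_mul.
Proof.
move=> x; rewrite -[x]word_reprK free_invE free_mulE; apply/word_classP.
by rewrite -{2}[word_repr x]word_invK; exact: word_mulV.
Qed.

Lemma free_mulxV : right_inverse free_one free_inv free_mul.
Proof.
move=> x; rewrite -[x]word_reprK free_invE free_mulE; apply/word_classP.
exact: word_mulV.
Qed.

HB.instance Definition _ := isGroup.Build free_group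
  free_mulA free_mul1 free_mulx1 free_mulVx free_mulxV.

End FreeGroup.

(* The library's group structure on {ffun I -> G} is for a constant G only. *)
Section DirectProduct.
Variables (I : finType) (G : I -> groupType).

Definition direct_prod : Type := {dffun forall i : I, G i}.
HB.instance Definition _ := Choice.on direct_prod.
Implicit Types f g : direct_prod.

Definition dprod_mul f g : direct_prod := [ffun i => (f i * g i)%g].
Definition dprod_one : direct_prod := [ffun i => 1%g].
Definition dprod_inv f : direct_prod := [ffun i => ((f i)^-1)%g].

Lemma dprod_mulA : associative dprod_mul.
Proof. by move=> f g h; apply/ffunP => i; rewrite !ffunE mulgA. Qed.

Lemma dprod_mul1 : left_id dprod_one dprod_mul.
Proof. by move=> f; apply/ffunP => i; rewrite !ffunE mul1g. Qed.

Lemma dprod_mulx1 : right_id dprod_one dprod_mul.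
Proof. by move=> f; apply/ffunP => i; rewrite !ffunE mulg1. Qed.

Lemma dprod_mulVx : left_inverse dprod_one dprod_inv dprod_mul.
Proof. by move=> f; apply/ffunP => i; rewrite !ffunE mulVg. Qed.

Lemma dprod_mulxV : right_inverse dprod_one dprod_inv dprod_mul.
Proof. by move=> f; apply/ffunP => i; rewrite !ffunE mulgV. Qed.

HB.instance Definition _ := isGroup.Build direct_prod
  dprod_mulA dprod_mul1 dprod_mulx1 dprod_mulVx dprod_mulxV.
End DirectProduct.

Section UnitInterval.
Variable R : realType.

Definition unit_interval : Type := set_type (`[0%R, 1%R]%classic : set R).
HB.instance Definition _ := Topological.on unit_interval.

Definition time (s : unit_interval) : R := set_val s.

Lemma clamp_subproof (t : R) :
  Num.max 0 (Num.min 1 t) \in (`[0%R, 1%R]%classic : set R).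
Proof.
apply/mem_set; rewrite /= in_itv /= le_max lexx /=.
by rewrite ge_max ler01 ge_min lexx.
Qed.

(* The retraction of R onto the unit interval. *)
Definition clamp (t : R) : unit_interval := SigSub (clamp_subproof t).

Lemma timeP s : 0 <= time s <= 1.
Proof. by have /= := set_valP s; rewrite in_itv. Qed.

Lemma time_clamp t : time (clamp t) = Num.max 0 (Num.min 1 t).
Proof. by []. Qed.

Lemma clampK t : 0 <= t <= 1 -> time (clamp t) = t.
Proof. by case/andP => t0 t1; rewrite time_clamp min_r // max_r. Qed.

Lemma time_inj : injective time.
Proof. by move=> s t st; exact: val_inj. Qed.

Lemma timeK : cancel time clamp.
Proof. by move=> s; apply: time_inj; rewrite clampK // timeP. Qed.

Lemma zero_one_subproof : clamp 0 != clamp 1.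
Proof.
apply/eqP => /(congr1 time); rewrite !clampK ?lexx ?ler01 //.
by move/eqP; rewrite eq_sym oner_eq0.
Qed.

HB.instance Definition _ := isBiPointed.Build unit_interval zero_one_subproof.

Lemma zeroE : zero = clamp 0. Proof. by []. Qed.
Lemma oneE : one = clamp 1. Proof. by []. Qed.
Lemma time0 : time zero = 0. Proof. by rewrite zeroE clampK // lexx ler01. Qed.
Lemma time1 : time one = 1. Proof. by rewrite oneE clampK // lexx ler01. Qed.

Lemma continuous_time : continuous time.
Proof. exact: initial_continuous. Qed.

Lemma continuous_clamp : continuous clamp.
Proof.
apply: continuous_comp_initial => t; apply: continuous_max.
  exact: cst_continuous.
by apply: continuous_min; [exact: cst_continuous|exact: cvg_id].
Qed.

Lemma continuous_paste (Z X : topologicalType) (c : Z -> R) (a : R)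
    (f g : Z -> X) :
  continuous c -> continuous f -> continuous g ->
  (forall z, c z = a -> f z = g z) ->
  continuous (fun z => if c z <= a then f z else g z).
Proof.
move=> cc cf cg fg; apply/continuous_subspace_setT.
have -> : setT = [set z | c z <= a] `|` [set z | a <= c z].
  by apply/seteqP; split=> // z _ /=; apply/orP; exact: le_total.
apply: withinU_continuous.
- exact: (continuous_closedP c).1 cc _ (@closed_le R a).
- exact: (continuous_closedP c).1 cc _ (@closed_ge R a).
- apply: (subspace_eq_continuous _ (continuous_subspaceT cf)).
  by move=> z; rewrite inE /from_subspace => /= ->.
- apply: (subspace_eq_continuous _ (continuous_subspaceT cg)).
  move=> z; rewrite inE /from_subspace => /= az; case: ifPn => // za.
  by rewrite fg //; apply/le_anti; rewrite az za.
Qed.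

End UnitInterval.

Section FundamentalGroup.
Variables (R : realType) (X : topologicalType) (x : X).
Local Notation I := (unit_interval R).
Local Notation loop := {path I from x to x in X}.
Local Notation half := (2^-1 : R).
Implicit Types f g h : loop.

Lemma continuous_loop f : continuous f. Proof. exact: cts_fun. Qed.

(* Homotopy relative to the endpoints; the second coordinate is the
   deformation parameter. *)
Definition homotopic f g : Prop :=
  exists H : I * I -> X,
    [/\ continuous H,
        forall s, H (s, zero) = f s,
        forall s, H (s, one) = g s &
        forall t, H (zero, t) = x /\ H (one, t) = x].

(* Loops reparametrised by maps with the same endpoints are homotopic, by
   linear interpolation of the parameter. *)
Lemma homotopic_reparam (p : I -> X) (a b : I -> R) f g :
  continuous p -> continuous a -> continuous b ->
  (forall s, f s = p (clamp (a s))) -> (forall s, g s = p (clamp (b s))) ->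
  a zero = b zero -> a one = b one -> homotopic f g.
Proof.
move=> cp ca cb fE gE ab0 ab1.
exists (fun st => p (clamp (a st.1 + time st.2 * (b st.1 - a st.1)))); split.
- move=> st; apply: continuous_comp; last exact: cp.
  apply: continuous_comp; last exact: continuous_clamp.
  have c1 (k : I -> R) : continuous k -> {for st, continuous (k \o fst)}.
    by move=> ck; apply: continuous_comp; [exact: cvg_fst|exact: ck].
  have c2 (k : I -> R) : continuous k -> {for st, continuous (k \o snd)}.
    by move=> ck; apply: continuous_comp; [exact: cvg_snd|exact: ck].
  apply: continuousD; first exact: c1.
  apply: continuousM; first exact: (c2 _ (@continuous_time R)).
  by apply: continuousB; exact: c1.
- by move=> s; rewrite /= time0 mul0r addr0 fE.
- by move=> s; rewrite /= time1 mul1r addrC subrK gE.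
- move=> t; rewrite /= ab0 ab1 !subrr !mulr0 !addr0.
  by rewrite -!gE path_zero path_one.
Qed.

Lemma homotopic_refl f : homotopic f f.
Proof.
apply: (@homotopic_reparam f (@time R) (@time R)) => //.
- exact: continuous_loop.
- exact: continuous_time.
- exact: continuous_time.
- by move=> s; rewrite timeK.
- by move=> s; rewrite timeK.
Qed.

Lemma continuous_pair (Z : topologicalType) (u v : Z -> I) :
  continuous u -> continuous v -> continuous (fun z => (u z, v z)).
Proof. by move=> cu cv z; exact: (cvg_pair (cu z) (cv z)). Qed.

Lemma continuous_affine (Z : topologicalType) (k : Z -> I) (b c : R) :
  continuous k -> continuous (fun z => clamp (b * time (k z) + c)).
Proof.
move=> ck z; apply: (@continuous_comp _ _ _ (fun z => b * time (k z) + c)).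
  apply: continuousD; last exact: cst_continuous.
  apply: continuousM; first exact: cst_continuous.
  by apply: continuous_comp; [exact: ck|exact: continuous_time].
exact: continuous_clamp.
Qed.

Lemma homotopic_sym f g : homotopic f g -> homotopic g f.
Proof.
move=> [H [cH H0 H1 Hx]].
exists (fun st => H (st.1, clamp (-1 * time st.2 + 1))); split.
- move=> st; apply: continuous_comp; last exact: cH.
  apply: continuous_pair => {}st; first exact: cvg_fst.
  by apply: continuous_affine => {}st; exact: cvg_snd.
- by move=> s; rewrite /= time0 mulr0 add0r H1.
- by move=> s; rewrite /= time1 mulr1 addNr H0.
- by move=> t; exact: Hx.
Qed.

Lemma homotopic_trans g f h :
  homotopic f g -> homotopic g h -> homotopic f h.
Proof.
move=> [H [cH H0 H1 Hx]] [K [cK K0 K1 Kx]].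
exists (fun st => if time st.2 <= half then H (st.1, clamp (2 * time st.2 + 0))
                  else K (st.1, clamp (2 * time st.2 + -1))); split.
- apply: (@continuous_paste R _ _ (fun st => time st.2)).
  + move=> st; apply: continuous_comp; last exact: continuous_time.
    exact: cvg_snd.
  + move=> st; apply: continuous_comp; last exact: cH.
    apply: continuous_pair => {}st; first exact: cvg_fst.
    by apply: continuous_affine => {}st; exact: cvg_snd.
  + move=> st; apply: continuous_comp; last exact: cK.
    apply: continuous_pair => {}st; first exact: cvg_fst.
    by apply: continuous_affine => {}st; exact: cvg_snd.
  + move=> [s t] /= ->; rewrite mulfV ?pnatr_eq0// addr0 subrr.
    by rewrite H1 K0.
- by move=> s; rewrite /= time0 mulr0 addr0 invr_ge0 ler0n H0.
- move=> s; rewrite /= time1 mulr1 ifF.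
    by rewrite (_ : 2 + -1 = 1) ?K1 //; ring.
  by apply/negbTE; rewrite -ltNge; lra.
- by move=> t; rewrite /=; case: ifP => _; [exact: Hx|exact: Kx].
Qed.

Definition loop_mul_fun f g (s : I) : X :=
  if time s <= half then f (clamp (2 * time s)) else g (clamp (2 * time s - 1)).

Lemma continuous_loop_affine f (b c : R) :
  continuous (fun s : I => f (clamp (b * time s + c))).
Proof.
have ca : continuous (fun s : I => clamp (b * time s + c)).
  by apply: (continuous_affine (k := idfun)) => s; exact: cvg_id.
by move=> s; exact: (continuous_comp (ca s) (@continuous_loop f _)).
Qed.

Lemma loop_mul_cts f g : continuous (loop_mul_fun f g).
Proof.
apply: continuous_paste.
- exact: continuous_time.
- under eq_fun do rewrite -[2 * _]addr0.
  exact: continuous_loop_affine.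
- exact: continuous_loop_affine.
- move=> s ->; rewrite mulfV ?pnatr_eq0// subrr.
  by rewrite -zeroE -oneE path_zero path_one.
Qed.

Lemma loop_mul_zero f g : loop_mul_fun f g zero = x.
Proof.
by rewrite /loop_mul_fun time0 invr_ge0 ler0n mulr0 -zeroE path_zero.
Qed.

Lemma loop_mul_one f g : loop_mul_fun f g one = x.
Proof.
rewrite /loop_mul_fun time1 ifF; last by apply/negbTE; rewrite -ltNge; lra.
by rewrite (_ : 2 * 1 - 1 = 1) -?oneE ?path_one //; ring.
Qed.

Definition loop_mul f g : loop :=
  mk_path (@loop_mul_cts f g) (loop_mul_zero f g) (loop_mul_one f g).

Definition loop_one : loop := cst x.

Definition loop_inv_fun f (s : I) : X := f (clamp (1 - time s)).

Lemma loop_inv_cts f : continuous (loop_inv_fun f).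
Proof.
rewrite /loop_inv_fun; under eq_fun do rewrite addrC -mulN1r.
exact: continuous_loop_affine.
Qed.

Lemma loop_inv_zero f : loop_inv_fun f zero = x.
Proof. by rewrite /loop_inv_fun time0 subr0 -oneE path_one. Qed.

Lemma loop_inv_one f : loop_inv_fun f one = x.
Proof. by rewrite /loop_inv_fun time1 subrr -zeroE path_zero. Qed.

Definition loop_inv f : loop :=
  mk_path (@loop_inv_cts f) (loop_inv_zero f) (loop_inv_one f).


Lemma loop_mulE f g s : loop_mul f g s =
  if time s <= half then f (clamp (2 * time s)) else g (clamp (2 * time s - 1)).
Proof. by []. Qed.

Lemma loop_invE f s : loop_inv f s = f (clamp (1 - time s)).
Proof. by []. Qed.

Lemma loop_oneE f s : loop_one s = f (clamp 0).
Proof. by rewrite -zeroE path_zero. Qed.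

Lemma loop_mul_homotopic f f' g g' :
  homotopic f f' -> homotopic g g' ->
  homotopic (loop_mul f g) (loop_mul f' g').
Proof.
move=> [F [cF F0 F1 Fx]] [G [cG G0 G1 Gx]].
exists (fun st => if time st.1 <= half then F (clamp (2 * time st.1 + 0), st.2)
                  else G (clamp (2 * time st.1 + -1), st.2)); split.
- apply: (@continuous_paste R _ _ (fun st => time st.1)).
  + move=> st; apply: continuous_comp; last exact: continuous_time.
    exact: cvg_fst.
  + move=> st; apply: continuous_comp; last exact: cF.
    apply: continuous_pair => {}st; last exact: cvg_snd.
    by apply: continuous_affine => {}st; exact: cvg_fst.
  + move=> st; apply: continuous_comp; last exact: cG.
    apply: continuous_pair => {}st; last exact: cvg_snd.
    by apply: continuous_affine => {}st; exact: cvg_fst.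
  + move=> [s t] /= ->; rewrite mulfV ?pnatr_eq0// addr0 subrr.
    by rewrite (Fx t).2 (Gx t).1.
- by move=> s; rewrite loop_mulE /= addr0 F0 G0.
- by move=> s; rewrite loop_mulE /= addr0 F1 G1.
- move=> t; rewrite /= time0 time1 mulr0 mulr1 addr0 invr_ge0 ler0n.
  rewrite -zeroE (Fx t).1 ifF; last by apply/negbTE; rewrite -ltNge; lra.
  by rewrite (_ : 2 + -1 = 1) -?oneE ?(Gx t).2 //; ring.
Qed.

Lemma loop_inv_homotopic f g :
  homotopic f g -> homotopic (loop_inv f) (loop_inv g).
Proof.
move=> [H [cH H0 H1 Hx]].
exists (fun st => H (clamp (-1 * time st.1 + 1), st.2)); split.
- move=> st; apply: continuous_comp; last exact: cH.
  apply: continuous_pair => {}st; last exact: cvg_snd.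
  by apply: continuous_affine => {}st; exact: cvg_fst.
- by move=> s; rewrite loop_invE /= mulN1r addrC H0.
- by move=> s; rewrite loop_invE /= mulN1r addrC H1.
- move=> t; rewrite /= time0 time1 mulr0 mulr1 add0r addNr -zeroE -oneE.
  by split; [exact: (Hx t).2|exact: (Hx t).1].
Qed.

Lemma continuous_time_affine (b c : R) :
  continuous (fun s : I => b * time s + c).
Proof.
move=> s.
suff : {for s, continuous (fun s : I => b * time s + c)} by [].
apply: continuousD; last exact: cst_continuous.
by apply: continuousM; [exact: cst_continuous|exact: continuous_time].
Qed.

Lemma loop_mulA f g h :
  homotopic (loop_mul (loop_mul f g) h) (loop_mul f (loop_mul g h)).
Proof.
apply: (@homotopic_reparam (loop_mul f (loop_mul g h))
  ((fun s => 2 * time s + 0) \min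
   ((fun s => 1 * time s + 4^-1) \min (fun s => half * time s + half)))
  (fun s => 1 * time s + 0)).
- exact: continuous_loop.
- move=> s; apply: continuous_min; first exact: continuous_time_affine.
  by apply: continuous_min; exact: continuous_time_affine.
- exact: continuous_time_affine.
- move=> s /=; have := timeP s; set t := time s => /andP[t0 t1].
  have [t2|t2] := leP t half; last first.
    rewrite (_ : Num.min _ _ = half * t + half); last first.
      by rewrite !min_r; lra.
    rewrite !loop_mulE -/t [t <= _]leNgt t2 /= clampK; last by lra.
    rewrite ifF; last by apply/negbTE; rewrite -ltNge; lra.
    rewrite clampK; last by lra.
    rewrite ifF; last by apply/negbTE; rewrite -ltNge; lra.
    by congr (h (clamp _)); lra.
  have [t4|t4] := leP t 4^-1.
    rewrite (_ : Num.min _ _ = 2 * t + 0); last first.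
      by rewrite min_l // le_min; lra.
    rewrite !loop_mulE -/t t2 (@clampK _ (2 * t)); last by lra.
    rewrite (@clampK _ (2 * t + 0)); last by lra.
    rewrite ifT; last by lra.
    by rewrite ifT; [congr (f (clamp _)); lra|lra].
  rewrite (_ : Num.min _ _ = 1 * t + 4^-1); last first.
    by rewrite (@min_l _ _ (1 * t + 4^-1)) ?min_r; lra.
  rewrite !loop_mulE -/t t2 (@clampK _ (2 * t)); last by lra.
  rewrite (@clampK _ (1 * t + 4^-1)); last by lra.
  rewrite ifF; last by apply/negbTE; rewrite -ltNge; lra.
  rewrite ifF; last by apply/negbTE; rewrite -ltNge; lra.
  rewrite clampK; last by lra.
  by rewrite ifT; [congr (g (clamp _)); lra|lra].
- by move=> s; rewrite mul1r addr0 timeK.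
- rewrite /= !time0 min_l; first by lra.
  by rewrite le_min; lra.
- by rewrite /= !time1 !min_r; lra.
Qed.

Lemma loop_mul1 f : homotopic (loop_mul loop_one f) f.
Proof.
apply: (@homotopic_reparam f ((fun s => 0 * time s + 0) \max
  (fun s => 2 * time s + -1)) (fun s => 1 * time s + 0)).
- exact: continuous_loop.
- by move=> s; apply: continuous_max; exact: continuous_time_affine.
- exact: continuous_time_affine.
- move=> s /=; rewrite loop_mulE (loop_oneE f); case: ifPn => [t2|].
    by rewrite max_l; [congr (f (clamp _)); lra|lra].
  by rewrite -ltNge => t2; rewrite max_r //; lra.
- by move=> s; rewrite mul1r addr0 timeK.
- by rewrite /= !time0 max_l; lra.
- by rewrite /= !time1 max_r; lra.
Qed.

Lemma loop_mulx1 f : homotopic (loop_mul f loop_one) f.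
Proof.
apply: (@homotopic_reparam f ((fun s => 2 * time s + 0) \min
  (fun s => 0 * time s + 1)) (fun s => 1 * time s + 0)).
- exact: continuous_loop.
- by move=> s; apply: continuous_min; exact: continuous_time_affine.
- exact: continuous_time_affine.
- move=> s /=; rewrite loop_mulE; case: ifPn => [t2|].
    by rewrite min_l; [congr (f (clamp _)); lra|lra].
  rewrite -ltNge => t2; rewrite min_r; last by lra.
  by rewrite mul0r add0r -oneE path_one.
- by move=> s; rewrite mul1r addr0 timeK.
- by rewrite /= !time0 min_l; lra.
- by rewrite /= !time1 min_r; lra.
Qed.

Lemma loop_mulxV f : homotopic (loop_mul f (loop_inv f)) loop_one.
Proof.
apply: (@homotopic_reparam f ((fun s => 2 * time s + 0) \min
  (fun s => (- 2) * time s + 2)) (fun s => 0 * time s + 0)).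
- exact: continuous_loop.
- by move=> s; apply: continuous_min; exact: continuous_time_affine.
- exact: continuous_time_affine.
- move=> s /=; have /andP[t0 t1] := timeP s.
  rewrite loop_mulE; case: ifPn => [t2|].
    by rewrite min_l; [congr (f (clamp _)); lra|lra].
  rewrite -ltNge => t2; rewrite min_r; last by lra.
  by rewrite loop_invE clampK; [congr (f (clamp _)); lra|lra].
- by move=> s; rewrite (loop_oneE f) mul0r addr0.
- by rewrite /= !time0 min_l; lra.
- by rewrite /= !time1 min_r; lra.
Qed.

Lemma loop_invK f : loop_inv (loop_inv f) = f.
Proof.
apply/path_eqP => s; have /andP[t0 t1] := timeP s.
rewrite !loop_invE clampK; last by lra.
by rewrite opprB addrC subrK timeK.
Qed.

Lemma loop_mulVx f : homotopic (loop_mul (loop_inv f) f) loop_one.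
Proof. by rewrite -{2}[f]loop_invK; exact: loop_mulxV. Qed.

Definition homotopicb f g : bool := `[< homotopic f g >].

Lemma homotopicb_equiv : equiv_class_of homotopicb.
Proof.
split=> [f|f g|g f h]; first exact/asboolP/homotopic_refl.
  by apply/asboolP/asboolP; exact: homotopic_sym.
by move=> /asboolP fg /asboolP gh; apply/asboolP/(homotopic_trans fg gh).
Qed.

Canonical homotopic_equiv := EquivRelPack homotopicb_equiv.

Definition pi1 : Type := {eq_quot homotopic_equiv}.
HB.instance Definition _ := Choice.on pi1.

Definition loop_class f : pi1 := \pi_{eq_quot homotopic_equiv} f.
Definition loop_repr (a : pi1) : loop := repr (a : {eq_quot homotopic_equiv}).

Lemma loop_reprK a : loop_class (loop_repr a) = a.
Proof. exact: reprK. Qed.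

Lemma loop_classP f g : loop_class f = loop_class g <-> homotopic f g.
Proof. by split=> [/eqmodP/asboolP //|fg]; apply/eqmodP/asboolP. Qed.

Lemma loop_repr_class f : homotopic (loop_repr (loop_class f)) f.
Proof. by apply/loop_classP; rewrite loop_reprK. Qed.

Definition pi1_mul (a b : pi1) := loop_class (loop_mul (loop_repr a) (loop_repr b)).
Definition pi1_one : pi1 := loop_class loop_one.
Definition pi1_inv (a : pi1) := loop_class (loop_inv (loop_repr a)).

Lemma pi1_mulE f g :
  pi1_mul (loop_class f) (loop_class g) = loop_class (loop_mul f g).
Proof. by apply/loop_classP/loop_mul_homotopic; exact: loop_repr_class. Qed.

Lemma pi1_invE f : pi1_inv (loop_class f) = loop_class (loop_inv f).
Proof. by apply/loop_classP/loop_inv_homotopic; exact: loop_repr_class. Qed.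

Lemma pi1_mulA : associative pi1_mul.
Proof.
move=> a b c; rewrite -[a]loop_reprK -[b]loop_reprK -[c]loop_reprK !pi1_mulE.
by apply/esym/loop_classP; exact: loop_mulA.
Qed.

Lemma pi1_mul1 : left_id pi1_one pi1_mul.
Proof.
move=> a; rewrite -[a]loop_reprK pi1_mulE; apply/loop_classP.
exact: loop_mul1.
Qed.

Lemma pi1_mulx1 : right_id pi1_one pi1_mul.
Proof.
move=> a; rewrite -[a]loop_reprK pi1_mulE; apply/loop_classP.
exact: loop_mulx1.
Qed.

Lemma pi1_mulVx : left_inverse pi1_one pi1_inv pi1_mul.
Proof.
move=> a; rewrite -[a]loop_reprK pi1_invE pi1_mulE; apply/loop_classP.
exact: loop_mulVx.
Qed.

Lemma pi1_mulxV : right_inverse pi1_one pi1_inv pi1_mul.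
Proof.
move=> a; rewrite -[a]loop_reprK pi1_invE pi1_mulE; apply/loop_classP.
exact: loop_mulxV.
Qed.

HB.instance Definition _ := isGroup.Build pi1
  pi1_mulA pi1_mul1 pi1_mulx1 pi1_mulVx pi1_mulxV.

End FundamentalGroup.

Section ProjectivePlane.
Variable R : realType.

(* Naming the numFieldType R[i] makes inference find its metric topology. *)
Definition Cplx : numFieldType := R[i]%C.

Definition nonzero_vec : Type := set_type [set v : 'rV[Cplx]_3 | v != 0].
HB.instance Definition _ := Topological.on nonzero_vec.

Definition coords (v : nonzero_vec) : 'rV[Cplx]_3 := set_val v.

Definition proportional (v w : nonzero_vec) : Prop :=
  exists2 c : Cplx, c != 0 & coords v = c *: coords w.

Definition proportionalb v w : bool := `[< proportional v w >].

Lemma proportionalb_equiv : equiv_class_of proportionalb.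
Proof.
split=> [v|v w|w v z].
- by apply/asboolP; exists 1; rewrite ?oner_neq0// scale1r.
- by apply/asboolP/asboolP => -[c c0 vw]; exists c^-1; rewrite ?invr_eq0// vw
    scalerA mulVf// scale1r.
- move=> /asboolP[c c0 vw] /asboolP[d d0 wz]; apply/asboolP; exists (c * d).
    by rewrite mulf_neq0.
  by rewrite vw wz scalerA.
Qed.

Canonical proportional_equiv := EquivRelPack proportionalb_equiv.

Definition CP2 : Type := quotient_topology {eq_quot proportional_equiv}.
HB.instance Definition _ := Topological.on CP2.

Definition proj_point (v : nonzero_vec) : CP2 :=
  \pi_{eq_quot proportional_equiv} v.

Definition proj_line (a : 'rV[Cplx]_3) : set CP2 :=
  [set proj_point v | v in [set v | \sum_(i < 3) a 0 i * coords v 0 i = 0]].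

Lemma proj_lineE a v :
  proj_line a (proj_point v) <-> \sum_(i < 3) a 0 i * coords v 0 i = 0.
Proof.
split=> [[w /= aw]|av]; last by exists v.
move=> /eqmodP/asboolP[c c0 wv]; move: aw; rewrite wv.
under eq_bigr do rewrite mxE mulrCA.
by rewrite -mulr_sumr => /eqP; rewrite mulf_eq0 (negbTE c0) => /eqP.
Qed.

Definition complex_line (l : set CP2) : Prop :=
  exists2 a : 'rV[Cplx]_3, a != 0 & l = proj_line a.

Definition real_line (l : set CP2) : Prop :=
  exists2 a : 'rV[R]_3, a != 0 & l = proj_line (map_mx (real_complex R) a).

End ProjectivePlane.

Section Arrangement.
Variables (R : realType) (L : {fset set (CP2 R)}).
Implicit Types (l : set (CP2 R)) (q : CP2 R).

Definition complement : set (CP2 R) := [set q | forall l, l \in L -> ~ l q].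

Definition multiplicity q : nat := #|` [fset l in L | `[< l q >]]%fset|.

Definition simple_point q : bool := multiplicity q == 2.

Definition multiple_point q : bool := (2 < multiplicity q)%N.

Definition on_common_line q1 q2 : bool :=
  `[< exists2 l, l \in L & l q1 /\ l q2 >].

Definition linked q1 q2 : Prop :=
  exists s : seq (CP2 R), [/\ all multiple_point (q1 :: s),
    path on_common_line q1 s & last q1 s = q2].

Definition linked_classes : set (set (CP2 R)) :=
  [set linked q | q in [set q | multiple_point q]].

(* Intersection points of L are those of multiplicity at least 2. *)
Definition simple_lines : {fset set (CP2 R)} :=
  [fset l in L | `[< forall q, l q -> (1 < multiplicity q)%N ->
                               simple_point q >]]%fset.

Lemma linked_refl q : multiple_point q -> linked q q.
Proof. by move=> mq; exists [::]; split => //=; rewrite mq. Qed.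

Lemma linked_sym q1 q2 : linked q1 q2 -> linked q2 q1.
Proof.
move=> [s [ms ps <-]]; exists (rev (belast q1 s)); split.
- by rewrite -rev_rcons all_rev -lastI.
- rewrite rev_path; apply: sub_path ps => a b /asboolP[l lL [la lb]].
  by apply/asboolP; exists l.
- by case: s {ms ps} => //= a s; rewrite rev_cons last_rcons.
Qed.

Lemma linked_trans q2 q1 q3 : linked q1 q2 -> linked q2 q3 -> linked q1 q3.
Proof.
move=> [s [ms ps <-]] [t [mt pt <-]]; exists (s ++ t); split.
- by move: mt; rewrite -cat_cons all_cat ms /= => /andP[].
- by rewrite cat_path ps.
- by rewrite last_cat.
Qed.

End Arrangement.

(* Main.v *)
(* Let [p] be a multiple point, [l0] the line carrying the multiple points of
   its class, and put [l0] at infinity.  The other lines through [p] become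
   parallel, [z = a] for finitely many real [a], and the remaining lines become
   graphs [w = c z + d] with real [c], [d].  A line through [p] other than [l0]
   contains no multiple point but [p], so over each [a] the graphs have distinct
   values.  Under this condition the fundamental group of the complement is
   F * G, with F free on the [a]'s and G the fundamental group of the complement
   of the graphs.  Indeed:
   - the projection to F is the holonomy of a cocycle that jumps on the pieces
     of the hyperplane [im z = 0] between consecutive [a]'s, and the projection
     to G is induced by the inclusion;
   - a flow in the direction of [im z], tangent to the graphs and not vanishing
     over the [a]'s, pushes the graphs' complement off the lines [z = a], which
     lifts G to the classes of the loops in the half-space [im z < 0];
   - the loops that go around [z = a] far above the graphs,
     [im w > lam * |im z|], lift F; the same flow shows that they commute with
     the loops in [im z < 0], and moving the crossings of the hyperplane
     [im z = 0] into that region shows that both kinds of loops generate.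
   Removing the lines through [p] other than [l0] keeps the hypothesis for the
   remaining multiple points, so every multiple point of multiplicity [m]
   contributes a direct factor that is free of rank [m - 1].  Once all points are simple, every
   line but one contributes a factor Z, and the complement of the last line is
   contractible. *)

(* The lines are real, so a point with [im1 <> 0] lies on exactly one real line [w = c z + d]. Hence
   each half [im1 < 0], [im1 > 0] of the complement is a half-plane times the plane of pairs
   [(c, d)] without the finite set [B], and only the gluing along the hyperplane [im1 = 0] carries
   information. The obstacle is to carry paths across that hyperplane without hitting a graph. The
   speed along [im1] of a field tangent to all graphs at once must vanish where two graphs of
   different slopes meet, and it can be made positive elsewhere; this is where the distinct values
   over each [a] are used. Open paths have to be compared as well as loops, so groups are handled
   through functors from paths to a group that obey one law on squares. Morphisms out of a
   fundamental group are values of such functors, and every subdivision argument is an instance of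
   one induction on intervals of [0, 1]. *)
Require Import Defs.
From HB Require Import structures.
From mathcomp Require Import all_boot all_order all_algebra finmap generic_quotient complex.
From mathcomp Require Import ring lra.
From mathcomp Require Import all_classical all_reals topology normedtype homotopy.
Set Implicit Arguments.
Unset Strict Implicit.
Unset Printing Implicit Defensive.
Import Order.TTheory GRing.Theory Num.Theory.
Import numFieldNormedType.Exports.
Local Open Scope classical_set_scope.
Local Open Scope quotient_scope.
Local Open Scope ring_scope.

(** * Paths and path classes *)

Section Continuity.
Variables (R : realType) (Z : topologicalType).

Lemma cts_comp (X Y : topologicalType) (f : Z -> X) (g : X -> Y) :
  continuous g -> continuous f -> continuous (fun z => g (f z)).
Proof. by move=> cg cf z; apply: continuous_comp; [exact: cf|exact: cg]. Qed.

Lemma cts_cst (X : topologicalType) (x : X) : continuous (fun _ : Z => x).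
Proof. exact: cst_continuous. Qed.

Lemma cts_id : continuous (fun z : Z => z).
Proof. by move=> z; exact: cvg_id. Qed.

Lemma cts_pair (X Y : topologicalType) (f : Z -> X) (g : Z -> Y) :
  continuous f -> continuous g -> continuous (fun z => (f z, g z)).
Proof. by move=> cf cg z; exact: (cvg_pair (cf z) (cg z)). Qed.

Lemma cts_fst (X Y : topologicalType) (f : Z -> X * Y) :
  continuous f -> continuous (fun z => (f z).1).
Proof. by apply: cts_comp => z; exact: cvg_fst. Qed.

Lemma cts_snd (X Y : topologicalType) (f : Z -> X * Y) :
  continuous f -> continuous (fun z => (f z).2).
Proof. by apply: cts_comp => z; exact: cvg_snd. Qed.

Implicit Types f g : Z -> R.

Lemma cts_add f g :
  continuous f -> continuous g -> continuous (fun z => f z + g z).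
Proof. by move=> cf cg z; apply: continuousD; [exact: cf|exact: cg]. Qed.

Lemma cts_mul f g :
  continuous f -> continuous g -> continuous (fun z => f z * g z).
Proof. by move=> cf cg z; apply: continuousM; [exact: cf|exact: cg]. Qed.

Lemma cts_opp f : continuous f -> continuous (fun z => - f z).
Proof. by move=> cf z; apply: continuousN; exact: cf. Qed.

Lemma cts_max f g :
  continuous f -> continuous g -> continuous (fun z => Num.max (f z) (g z)).
Proof. by move=> cf cg z; apply: continuous_max; [exact: cf|exact: cg]. Qed.

Lemma cts_min f g :
  continuous f -> continuous g -> continuous (fun z => Num.min (f z) (g z)).
Proof. by move=> cf cg z; apply: continuous_min; [exact: cf|exact: cg]. Qed.

Lemma cts_inv f :
  (forall z, f z != 0) -> continuous f -> continuous (fun z => (f z)^-1).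
Proof. by move=> f0 cf z; apply: (cvgV (f0 z) (cf z)). Qed.

Lemma cts_norm f : continuous f -> continuous (fun z => `|f z|).
Proof. by move=> cf z; apply: cvg_norm; exact: cf. Qed.

End Continuity.

Ltac cts_step := lazymatch goal with
  | |- continuous (fun _ => ?c) => apply: cts_cst
  | |- continuous (fun z => z) => apply: cts_id
  | |- continuous (@fst _ _) => move=> ?; exact: cvg_fst
  | |- continuous (@snd _ _) => move=> ?; exact: cvg_snd
  | |- continuous (fun z => (@?f z, @?g z)) => apply: (@cts_pair _ _ _ f g)
  | |- continuous (fun z => (@?f z).1) => apply: (@cts_fst _ _ _ f)
  | |- continuous (fun z => (@?f z).2) => apply: (@cts_snd _ _ _ f)
  | |- continuous (fun z => (@?f z + @?g z)%R) => apply: (@cts_add _ _ f g)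
  | |- continuous (fun z => (@?f z * @?g z)%R) => apply: (@cts_mul _ _ f g)
  | |- continuous (fun z => (- @?f z)%R) => apply: (@cts_opp _ _ f)
  | |- continuous (fun z => Num.max (@?f z) (@?g z)) => apply: (@cts_max _ _ f g)
  | |- continuous (fun z => Num.min (@?f z) (@?g z)) => apply: (@cts_min _ _ f g)
  | |- continuous (fun z => `| @?f z |%R) => apply: (@cts_norm _ _ f)
  | |- _ => first [ assumption
    | match goal with H : continuous ?g |- continuous (fun z => ?g (@?f z)) =>
        apply: (@cts_comp _ _ _ f g H) end ]
  end.
Ltac cts := repeat cts_step.

Section Paths.
Variables (R : realType) (X : topologicalType).
Implicit Types (f g h k l c : R -> X).

(** Paths are functions on all of [R], so that they can be reparametrised without a domain
    condition. A homotopy is continuous on the whole plane but is compared with the paths on the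
    unit square only. *)
Definition path_homotopic f g := exists H : R * R -> X,
  [/\ continuous H,
      forall s, 0 <= s <= 1 -> H (s, 0) = f s,
      forall s, 0 <= s <= 1 -> H (s, 1) = g s &
      forall t, 0 <= t <= 1 -> H (0, t) = f 0 /\ H (1, t) = f 1].

Definition concat f g (s : R) : X :=
  if s <= 2^-1 then f (2 * s) else g (2 * s - 1).

Lemma concat0 f g : concat f g 0 = f 0.
Proof. by rewrite /concat ifT ?mulr0//; lra. Qed.

Lemma concat1 f g : concat f g 1 = g 1.
Proof.
rewrite /concat ifF; last by apply/negbTE; rewrite -ltNge; lra.
by congr g; lra.
Qed.

Lemma cts_concat_family (F G : R * R -> X) :
  continuous F -> continuous G -> (forall t, F (1, t) = G (0, t)) ->
  continuous (fun st : R * R => if st.1 <= 2^-1 then F (2 * st.1, st.2)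
                        else G (2 * st.1 - 1, st.2)).
Proof.
move=> cF cG FG; apply: (@continuous_paste R _ _ (fun st : R * R => st.1)).
- by cts.
- by cts.
- by cts.
- by move=> [s t] /= ->; rewrite mulfV ?pnatr_eq0// subrr FG.
Qed.

Lemma cts_concat f g :
  continuous f -> continuous g -> f 1 = g 0 -> continuous (concat f g).
Proof.
move=> cf cg fg; apply: continuous_paste.
- by cts.
- by cts.
- by cts.
- by move=> s ->; rewrite mulfV ?pnatr_eq0// subrr.
Qed.

(* By linear interpolation in [R * R]. *)
Lemma path_homotopic_reparam (K : R * R -> X) (a b : R -> R * R) f g :
  continuous K -> continuous a -> continuous b -> a 0 = b 0 -> a 1 = b 1 ->
  (forall s, 0 <= s <= 1 -> f s = K (a s)) ->
  (forall s, 0 <= s <= 1 -> g s = K (b s)) -> path_homotopic f g.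
Proof.
move=> cK ca cb ab0 ab1 fE gE.
exists (fun st : R * R => K ((a st.1).1 + st.2 * ((b st.1).1 - (a st.1).1),
                     (a st.1).2 + st.2 * ((b st.1).2 - (a st.1).2))).
split.
- by cts.
- by move=> s s01; rewrite /= !mul0r !addr0 -surjective_pairing fE.
- move=> s s01; rewrite /= !mul1r gE//; congr K.
  by rewrite [RHS]surjective_pairing; congr pair; ring.
- move=> t t01; rewrite !fE ?lexx ?ler01//= -ab0 -ab1 !subrr !mulr0 !addr0.
  by rewrite -!surjective_pairing.
Qed.

Lemma path_homotopic_reparam1 (p : R -> X) (a b : R -> R) f g :
  continuous p -> continuous a -> continuous b -> a 0 = b 0 -> a 1 = b 1 ->
  (forall s, 0 <= s <= 1 -> f s = p (a s)) ->
  (forall s, 0 <= s <= 1 -> g s = p (b s)) -> path_homotopic f g.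
Proof.
move=> cp ca cb ab0 ab1 fE gE.
apply: (@path_homotopic_reparam (fun st : R * R => p st.1) (fun s => (a s, 0))
  (fun s => (b s, 0))) => //=; try by cts.
- by rewrite ab0.
- by rewrite ab1.
Qed.

End Paths.

(** Turns a nested concatenation of pieces of one path [p] into [p] composed with a nested
    concatenation of parameters; rebracketing is then a reparametrisation. *)
Lemma concat_factor (R : realType) (X Y : topologicalType) (p : Y -> X)
    (f g : R -> X) (a b : R -> Y) :
  (forall s, 0 <= s <= 1 -> f s = p (a s)) ->
  (forall s, 0 <= s <= 1 -> g s = p (b s)) ->
  forall s, 0 <= s <= 1 -> concat f g s = p (concat a b s).
Proof.
move=> fE gE s s01; rewrite /concat; case: ifPn => [s2|]; first by apply: fE; lra.
by rewrite -ltNge => s2; apply: gE; lra.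
Qed.

Section LoopClasses.
Variables (R : realType) (X : topologicalType) (x0 : X).
Local Notation G := (pi1 R x0).
Local Notation loop := {path (unit_interval R) from x0 to x0 in X}.
Implicit Types (f g h k l c : R -> X).

Definition is_loop f := [/\ continuous f, f 0 = x0 & f 1 = x0].

Lemma is_loop_path f : is_loop f ->
  { p : loop | forall s, p s = f (time s) }.
Proof.
move=> lf; apply: cid; case: lf => cf f0 f1.
have c : continuous (fun s : unit_interval R => f (time s)).
  by apply: cts_comp => //; exact: continuous_time.
have e0 : f (time zero) = x0 by rewrite time0.
have e1 : f (time one) = x0 by rewrite time1.
by exists (mk_path c e0 e1).
Qed.

Definition path_class f : G :=
  if pselect (is_loop f) is left lf then loop_class (sval (is_loop_path lf))
  else 1%g.

Lemma path_class_loop f (p : loop) : is_loop f ->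
  (forall s, p s = f (time s)) -> path_class f = loop_class p.
Proof.
move=> lf pE; rewrite /path_class; case: pselect => // lf'.
congr loop_class; apply/path_eqP => s.
by rewrite (svalP (is_loop_path lf')) pE.
Qed.

Lemma path_class_surj (v : G) : exists2 f, is_loop f & path_class f = v.
Proof.
have [pr vE] : exists p, loop_class p = v by exists (loop_repr v); exact: loop_reprK.
have lf : is_loop (fun s => pr (clamp s)).
  split.
  - by apply: cts_comp; [exact: continuous_loop|exact: continuous_clamp].
  - by rewrite -zeroE path_zero.
  - by rewrite -oneE path_one.
exists (fun s => pr (clamp s)) => //.
by rewrite (path_class_loop (p := pr)) // => s; rewrite timeK.
Qed.

Lemma path_class_homotopic f g : is_loop f -> is_loop g ->
  path_homotopic f g -> path_class f = path_class g.
Proof.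
move=> lf lg [H [cH H0 H1 He]].
have [p pE] := is_loop_path lf; have [q qE] := is_loop_path lg.
rewrite (path_class_loop lf pE) (path_class_loop lg qE).
apply/loop_classP; exists (fun st => H (time st.1, time st.2)); split.
- by have ct := @continuous_time R; cts.
- by move=> s; rewrite /= time0 H0 ?timeP ?pE.
- by move=> s; rewrite /= time1 H1 ?timeP ?qE.
- move=> t; rewrite /= time0 time1; have [-> ->] := He _ (timeP t).
  by case: lf.
Qed.

Lemma path_class_concat f g : is_loop f -> is_loop g ->
  (path_class f * path_class g)%g = path_class (concat f g).
Proof.
move=> lf lg; have [p pE] := is_loop_path lf; have [q qE] := is_loop_path lg.
rewrite (path_class_loop lf pE) (path_class_loop lg qE).
have lfg : is_loop (concat f g).
  case: lf lg => [cf f0 f1] [cg g0 g1]; split.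
  - by apply: cts_concat; rewrite // f1 g0.
  - by rewrite concat0.
  - by rewrite concat1.
rewrite (path_class_loop (p := loop_mul p q) lfg); first exact: pi1_mulE.
move=> s; rewrite loop_mulE /concat; have := timeP s; move: (time s) => t t01.
case: ifPn => [t2|]; first by rewrite pE clampK//; lra.
by rewrite -ltNge => t2; rewrite qE clampK//; lra.
Qed.

End LoopClasses.

Section PathFunctor.
Variables (R : realType) (X : topologicalType) (x0 : X).
Local Notation G := (pi1 R x0).
Implicit Types (f g h k l c : R -> X).

Definition reachable (x : X) := exists f, [/\ continuous f, f 0 = x0 & f 1 = x].

Lemma reachable_along k a b : continuous k -> reachable (k a) -> reachable (k b).
Proof.
move=> ck [f [cf f0 f1]]; exists (concat f (fun s => k (a + s * (b - a)))); split.
- apply: cts_concat => //; last by rewrite f1; congr k; ring.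
  by cts.
- by rewrite concat0.
- by rewrite concat1 mul1r addrC subrK.
Qed.

(** The case [x = x0] makes the chosen path at the base point constant, so that for a loop [based]
    only adds constant pieces. *)
Definition base_path (x : X) : R -> X :=
  if pselect (x = x0) then cst x0
  else if pselect (reachable x) is left p then sval (cid p) else cst x0.

Lemma base_path_base : base_path x0 = cst x0.
Proof. by rewrite /base_path; case: pselect. Qed.

Lemma base_pathP x : reachable x ->
  [/\ continuous (base_path x), base_path x 0 = x0 & base_path x 1 = x].
Proof.
move=> rx; rewrite /base_path; case: (pselect (x = x0)) => xE /=.
  by split=> //=; exact: cts_cst.
by case: (pselect (reachable x)) => // p /=; exact: svalP (cid p).
Qed.

Definition based k := concat (base_path (k 0))
  (concat k (fun s => base_path (k 1) (1 - s))).

Lemma is_loop_based k : continuous k -> reachable (k 0) -> is_loop x0 (based k).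
Proof.
move=> ck r0; have r1 := reachable_along 1 ck r0.
have [c0 c00 c01] := base_pathP r0; have [c1 c10 c11] := base_pathP r1.
split; last 2 first.
- by rewrite /based concat0.
- by rewrite /based !concat1 subrr.
have cr : continuous (fun s : R => base_path (k 1) (1 - s)) by cts.
apply: cts_concat => //; last by rewrite concat0.
by apply: cts_concat; rewrite //= subr0.
Qed.

Lemma based_mul k l : continuous k -> continuous l -> reachable (k 0) ->
  k 1 = l 0 ->
  (path_class x0 (based k) * path_class x0 (based l))%g =
  path_class x0 (based (concat k l)).
Proof.
move=> ck cl r0 kl; have r1 := reachable_along 1 ck r0.
have r2 : reachable (l 1) by apply: (@reachable_along l 0) => //; rewrite -kl.
have ckl := cts_concat ck cl kl.
have lk := is_loop_based ck r0.
have ll : is_loop x0 (based l) by apply: is_loop_based; rewrite -?kl.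
have lkl : is_loop x0 (based (concat k l)) by apply: is_loop_based; rewrite ?concat0.
rewrite path_class_concat//.
have [c0 c00 c01] := base_pathP r0; have [c1 c10 c11] := base_pathP r1.
have [c2 c20 c21] := base_pathP r2.
have lkl2 : is_loop x0 (concat (based k) (based l)).
  case: lk ll => [? ? bk1] [? bl0 ?]; split; rewrite ?concat0 ?concat1//.
  by apply: cts_concat; rewrite // bk1 bl0.
pose ret s := base_path (k 1) (1 - s).
pose stay (_ : R) := k 1.
pose c0' := base_path (k 0); pose c1' := base_path (k 1).
pose c2' s := base_path (l 1) (1 - s).
have cc2' : continuous c2' by rewrite /c2'; cts.
(* the excursion from [k 1] to the base point and back is shrunk *)
pose mid := concat (concat c0' (concat k stay)) (concat stay (concat l c2')).
have cm : continuous mid.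
  apply: cts_concat; rewrite ?concat0 ?concat1//; apply: cts_concat => //.
  - by apply: cts_concat => //; exact: cts_cst.
  - by rewrite concat0.
  - exact: cts_cst.
  - by apply: cts_concat; rewrite // /c2' subr0.
  - by rewrite concat0.
have lm : is_loop x0 mid.
  split=> //; rewrite /mid; first by rewrite !concat0.
  by rewrite !concat1 /c2' subrr.
have half1 : (1 <= 2^-1 :> R) = false by apply/negbTE; rewrite -ltNge; lra.
have two1 : 2 * 1 - 1 = 1 :> R by ring.
have H1 : path_homotopic (concat (based k) (based l)) mid.
  (* At stage [t] the excursion turns back at [c1' t]: [F3] runs from [k 1] to [c1' t] and [G1]
     returns from there. *)
  pose F3 (st : R * R) := c1' (1 - st.1 * (1 - st.2)).
  pose G1 (st : R * R) := c1' (1 - (1 - st.1) * (1 - st.2)).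
  have cF3 : continuous F3 by rewrite /F3; cts.
  have cG1 : continuous G1 by rewrite /G1; cts.
  pose F2 (st : R * R) := if st.1 <= 2^-1 then k (2 * st.1) else F3 (2 * st.1 - 1, st.2).
  have cF2 : continuous F2.
    apply: (@cts_concat_family _ _ (fun st => k st.1) F3) => //; first by cts.
    by move=> t; rewrite /F3 /= mul0r subr0.
  pose F1 (st : R * R) := if st.1 <= 2^-1 then c0' (2 * st.1) else F2 (2 * st.1 - 1, st.2).
  have cF1 : continuous F1.
    apply: (@cts_concat_family _ _ (fun st => c0' st.1) F2) => //; first by cts.
    by move=> t; rewrite /F2 /= mulr0 ifT//; lra.
  pose G2 (st : R * R) := if st.1 <= 2^-1 then l (2 * st.1) else c2' (2 * st.1 - 1).
  have cG2 : continuous G2.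
    apply: (@cts_concat_family _ _ (fun st => l st.1) (fun st => c2' st.1)); try by cts.
    by move=> t; rewrite /c2' /= subr0.
  pose G3 (st : R * R) := if st.1 <= 2^-1 then G1 (2 * st.1, st.2) else G2 (2 * st.1 - 1, st.2).
  have cG3 : continuous G3.
    apply: (@cts_concat_family _ _ G1 G2) => // t.
    rewrite /G1 /G2 /= mulr0 ifT; last by lra.
    by rewrite subrr mul0r subr0 /c1' c11.
  pose H (st : R * R) := if st.1 <= 2^-1 then F1 (2 * st.1, st.2) else G3 (2 * st.1 - 1, st.2).
  have cH : continuous H.
    apply: (@cts_concat_family _ _ F1 G3) => // t.
    rewrite /F1 /G3 /= mulr0 half1.
    rewrite ifT; last by lra.
    rewrite /F2 /= two1 half1.
    by rewrite /F3 /G1 /=; congr c1'; ring.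
  exists H; split=> //.
  - move=> s s01; rewrite /H /F1 /F2 /G3 /G2 /F3 /G1 /concat /based /concat /=.
    do ?case: ifP => // _; rewrite ?subr0 ?mulr1 //=.
    by rewrite /c1' kl; congr (base_path _ _); ring.
  - move=> s s01; rewrite /H /F1 /F2 /G3 /G2 /F3 /G1 /mid /concat /= ?subrr ?mulr0 ?subr0.
    by do ?case: ifP => // _; rewrite /stay /c1' c11.
  - move=> t t01; split.
      by rewrite concat0 /based concat0 /H /F1 /= mulr0 ifT ?mulr0 ?ifT //; lra.
    rewrite /based !concat1 /H /G3 /G2 /=.
    by rewrite half1 !(two1, half1).
rewrite (path_class_homotopic lkl2 lm H1); apply: path_class_homotopic => //.
(* both sides run through [p], which is c0, k, l, c2 on successive unit intervals *)
pose p s := if s <= 1 then c0' s else if s <= 2 then k (s - 1)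
            else if s <= 3 then l (s - 2) else c2' (s - 3).
have cp : continuous p.
  apply: continuous_paste; [exact: cts_id|by rewrite /c0'|idtac|]; last first.
    by move=> z ->; rewrite ifT ?subrr ?/c0' ?c01//; lra.
  apply: continuous_paste; [exact: cts_id|by cts|idtac|]; last first.
    move=> z ->; rewrite ifT; last by lra.
    by rewrite subrr -kl; congr k; ring.
  apply: continuous_paste; [exact: cts_id|by cts|by cts|].
  by move=> z ->; rewrite subrr /c2' subr0 c21; congr l; ring.
have p0 s : 0 <= s <= 1 -> c0' s = p s by move=> s01; rewrite /p ifT//; lra.
have p1 s : 0 <= s <= 1 -> k s = p (s + 1).
  move=> s01; rewrite /p; case: ifPn => [s1|].
    have -> : s = 0 by lra.
    by rewrite add0r /c0' c01.
  by rewrite ifT ?addrK//; lra.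
have p2 s : 0 <= s <= 1 -> l s = p (s + 2).
  move=> s01; rewrite /p ifF; last by apply/negbTE; rewrite -ltNge; lra.
  case: ifPn => [s1|].
    have -> : s = 0 by lra.
    by rewrite -kl; congr k; ring.
  by rewrite ifT ?addrK//; lra.
have p3 s : 0 <= s <= 1 -> c2' s = p (s + 3).
  move=> s01; rewrite /p ifF; last by apply/negbTE; rewrite -ltNge; lra.
  rewrite ifF; last by apply/negbTE; rewrite -ltNge; lra.
  case: ifPn => [s1|]; last by rewrite addrK.
  have -> : s = 0 by lra.
  by rewrite /c2' subr0 c21; congr l; ring.
have ps s : 0 <= s <= 1 -> stay s = p (2 : R).
  move=> s01; rewrite /stay kl (p2 0) ?add0r//; lra.
have mE := concat_factor (concat_factor p0 (concat_factor p1 ps))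
             (concat_factor ps (concat_factor p2 p3)).
have klE := concat_factor p0 (concat_factor (concat_factor p1 p2) p3).
rewrite /based concat0 concat1.
apply: (path_homotopic_reparam1 cp _ _ _ _ mE klE);
  rewrite ?concat0 ?concat1//.
- apply: cts_concat; last by rewrite ?concat0 ?concat1.
    apply: cts_concat; [by cts| |by rewrite concat0 add0r].
    by apply: cts_concat; [by cts|by cts|ring].
  apply: cts_concat; [by cts| |by rewrite concat0 add0r].
  by apply: cts_concat; [by cts|by cts|ring].
- apply: cts_concat; [by cts| |by rewrite !concat0 add0r].
  apply: cts_concat; [|by cts|by rewrite concat1; ring].
  by apply: cts_concat; [by cts|by cts|ring].
Qed.

End PathFunctor.

(** * Path functors *)

Section BasedClass.
Variables (R : realType) (X : topologicalType) (x0 : X).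
Local Notation G := (pi1 R x0).
Implicit Types (f g h k l c : R -> X).

(** Extends the class of a loop to open paths by closing them up with the base paths of their ends.
    Paths outside the path component of [x0] get 1, which keeps multiplicativity. *)
Definition based_class k : G :=
  if pselect (reachable R x0 (k 0)) then path_class x0 (based x0 k) else 1%g.

Lemma based_class_mul k l : continuous k -> continuous l -> k 1 = l 0 ->
  (based_class k * based_class l)%g = based_class (concat k l).
Proof.
move=> ck cl kl; rewrite /based_class concat0.
case: (pselect (reachable R x0 (k 0))) => r0; case: (pselect (reachable R x0 (l 0))) => r1.
- exact: based_mul.
- by case: r1; rewrite -kl; exact: reachable_along r0.
- by case: r0; apply: (@reachable_along _ _ _ k 1) => //; rewrite kl.
- by rewrite mul1g.
Qed.

Lemma based_class_homotopic k l : continuous k -> continuous l ->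
  path_homotopic k l -> based_class k = based_class l.
Proof.
move=> ck cl [H [cH H0 H1 He]].
have i0 : 0 <= (0 : R) <= 1 by lra.
have i1 : 0 <= (1 : R) <= 1 by lra.
have e0 : k 0 = l 0 by rewrite -(H1 _ i0) (He _ i1).1.
have e1 : k 1 = l 1 by rewrite -(H1 _ i1) (He _ i1).2.
rewrite /based_class -e0; case: pselect => // r0.
have r1 := reachable_along 1 ck r0.
have lk := is_loop_based ck r0.
have ll : is_loop x0 (based x0 l) by apply: is_loop_based; rewrite -?e0.
apply: path_class_homotopic => //; rewrite /based -e0 -e1.
have [c0 c00 c01] := base_pathP r0; have [c1 c10 c11] := base_pathP r1.
(* [He] controls the ends of [H] for [t] in [0, 1] only, whereas the pasting lemma needs matching
   ends for every real [t]. *)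
pose cl1 (t : R) := Num.max 0 (Num.min 1 t).
have ccl : continuous cl1 by rewrite /cl1; cts.
have cl01 t : 0 <= cl1 t <= 1.
  by rewrite /cl1 le_max lexx /= ge_max ler01 ge_min lexx.
have clE t : 0 <= t <= 1 -> cl1 t = t.
  by move=> /andP[t0 t1]; rewrite /cl1 min_r // max_r.
pose H' (st : R * R) := H (st.1, cl1 st.2).
have cH' : continuous H' by rewrite /H'; cts.
pose G2 (st : R * R) := base_path x0 (k 1) (1 - st.1).
pose F1 (st : R * R) := base_path x0 (k 0) st.1.
pose G1 (st : R * R) := if st.1 <= 2^-1 then H' (2 * st.1, st.2) else G2 (2 * st.1 - 1, st.2).
have cG1 : continuous G1.
  apply: (@cts_concat_family _ _ H' G2) => //; first by rewrite /G2; cts.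
  by move=> t; rewrite /G2 /H' /= subr0 (He _ (cl01 t)).2 c11.
exists (fun st : R * R => if st.1 <= 2^-1 then F1 (2 * st.1, st.2) else G1 (2 * st.1 - 1, st.2)).
split.
- apply: (@cts_concat_family _ _ F1 G1) => //; first by rewrite /F1; cts.
  move=> t; rewrite /G1 /F1 /= mulr0 ifT; last by lra.
  by rewrite /H' /= (He _ (cl01 t)).1.
- move=> s s01; rewrite /concat /F1 /G1 /H' /= clE ?lexx ?ler01//.
  case: ifPn => //; rewrite -ltNge => s2; case: ifPn => // s4.
  by rewrite H0//; lra.
- move=> s s01; rewrite /concat /F1 /G1 /H' /= clE ?lexx ?ler01//.
  case: ifPn => //; rewrite -ltNge => s2; case: ifPn => // s4.
  by rewrite H1//; lra.
- move=> t t01; rewrite concat0 !concat1 /= /F1 /G1 /G2 /H' /=; split.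
    by rewrite mulr0 ifT//; lra.
  have half1 : (1 <= 2^-1 :> R) = false by apply/negbTE; rewrite -ltNge; lra.
  have two1 : 2 * 1 - 1 = 1 :> R by ring.
  by rewrite half1 !(two1, half1).
Qed.

(** The two ways around the square are paths in the convex parameter plane with common ends, so
    linear interpolation there joins them. *)
Lemma based_class_square (K : R * R -> X) : continuous K ->
  (based_class (fun s => K (s, 0%R)) * based_class (fun t => K (1%R, t)))%g =
  (based_class (fun t => K (0%R, t)) * based_class (fun s => K (s, 1%R)))%g.
Proof.
move=> cK; have c0 (t : R) : continuous (fun s : R => K (s, t)) by cts.
have c1 (s : R) : continuous (fun t : R => K (s, t)) by cts.
rewrite !based_class_mul//; apply: based_class_homotopic.
- exact: cts_concat.
- exact: cts_concat.
apply: (@path_homotopic_reparam _ _ K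
  (concat (fun s : R => (s, 0)) (fun t : R => (1, t)))
  (concat (fun t : R => (0, t)) (fun s : R => (s, 1)))) => //.
- by apply: cts_concat => //; cts.
- by apply: cts_concat => //; cts.
- by rewrite !concat0.
- by rewrite !concat1.
- exact: concat_factor.
- exact: concat_factor.
Qed.

Lemma based_class_loop k : is_loop x0 k -> based_class k = path_class x0 k.
Proof.
move=> lk; have [ck k0 k1] := lk.
have r0 : reachable R x0 (k 0).
  by rewrite k0; exists (cst x0); split=> //; exact: cts_cst.
rewrite /based_class; case: pselect => //= _.
apply: path_class_homotopic => //; first exact: is_loop_based.
rewrite /based k0 k1 base_path_base.
pose p (s : R) := k (Num.max 0 (Num.min 1 s)).
have cp : continuous p by rewrite /p; cts.
have pk s : 0 <= s <= 1 -> k s = p s.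
  by move=> /andP[? ?]; rewrite /p min_r ?max_r.
have p0 (s : R) : 0 <= s <= 1 -> cst x0 s = p 0.
  by move=> s01; rewrite -pk ?k0 //; lra.
have p1 (s : R) : 0 <= s <= 1 -> cst x0 (1 - s) = p 1.
  by move=> s01; rewrite -pk ?k1 //; lra.
have E := concat_factor p0 (concat_factor pk p1).
apply: (path_homotopic_reparam1 (b := fun s : R => s) cp _ _ _ _ E pk);
  rewrite ?concat0 ?concat1 ?concat0 //; last by cts.
apply: cts_concat; [by cts| |by rewrite concat0].
by apply: cts_concat; cts.
Qed.

(** A constant path equals its concatenation with itself, so its class is idempotent. *)
Lemma based_class_cst k : (forall s, k s = k 0) -> based_class k = 1%g.
Proof.
move=> kE; have kc : k = cst (k 0) by exact/funext.
have ck : continuous k by rewrite kc; exact: cts_cst.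
have e : concat k k = k by apply/funext => s; rewrite /concat; case: ifP; rewrite !kE.
by apply: (mulgI (based_class k)); rewrite mulg1 based_class_mul ?e.
Qed.

End BasedClass.

Section PathFunctors.
Variables (R : realType) (E : topologicalType) (A : set E).
Implicit Types (k l : R -> E) (K : R * R -> E).

(* The square law gives both multiplicativity and homotopy invariance, by
   squares with one or two constant sides. *)
Definition path_functor (H : groupType) (F : (R -> E) -> H) :=
  [/\ forall K, continuous K ->
        (forall s t, 0 <= s <= 1 -> 0 <= t <= 1 -> A (K (s, t))) ->
        (F (fun s => K (s, 0%R)) * F (fun t => K (1%R, t)) =
         F (fun t => K (0%R, t)) * F (fun s => K (s, 1%R)))%g,
      forall e, A e -> F (cst e) = 1%g &
      forall k l, (forall s, 0 <= s <= 1 -> k s = l s) -> F k = F l].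

Definition path_in k := continuous k /\ forall s, 0 <= s <= 1 -> A (k s).

Lemma path_in_concat k l : path_in k -> path_in l -> k 1 = l 0 -> path_in (concat k l).
Proof.
move=> [ck Ak] [cl Al] kl; split; first exact: cts_concat.
move=> t t01; rewrite /concat; case: ifPn => t2; first by apply: Ak; lra.
by apply: Al; move: t2; rewrite -ltNge; lra.
Qed.

Lemma path_in_rev k : path_in k -> path_in (fun t => k (1 - t)).
Proof. by move=> [ck Ak]; split=> [|t t01]; [cts|apply: Ak; lra]. Qed.

Variables (H : groupType) (F : (R -> E) -> H) (pF : path_functor F).

Lemma functor_square K (b r l t : R -> E) : continuous K ->
  (forall s t, 0 <= s <= 1 -> 0 <= t <= 1 -> A (K (s, t))) ->
  (forall s, 0 <= s <= 1 -> K (s, 0) = b s) ->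
  (forall s, 0 <= s <= 1 -> K (1, s) = r s) ->
  (forall s, 0 <= s <= 1 -> K (0, s) = l s) ->
  (forall s, 0 <= s <= 1 -> K (s, 1) = t s) ->
  (F b * F r = F l * F t)%g.
Proof.
case: pF => sq _ loc cK AK bE rE lE tE.
by rewrite -(loc _ _ bE) -(loc _ _ rE) -(loc _ _ lE) -(loc _ _ tE) sq.
Qed.

Lemma functor_cst k e : A e -> (forall s, 0 <= s <= 1 -> k s = e) -> F k = 1%g.
Proof. by case: pF => _ cstF loc Ae /(loc k (cst e)) ->; exact: cstF. Qed.

Lemma functor_ext k l : (forall s, 0 <= s <= 1 -> k s = l s) -> F k = F l.
Proof. by case: pF => _ _; apply. Qed.

Lemma functor_homotopic K k l : continuous K ->
  (forall s t, 0 <= s <= 1 -> 0 <= t <= 1 -> A (K (s, t))) ->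
  (forall s, 0 <= s <= 1 -> K (s, 0) = k s) ->
  (forall s, 0 <= s <= 1 -> K (s, 1) = l s) ->
  (forall t, 0 <= t <= 1 -> K (0, t) = k 0 /\ K (1, t) = k 1) -> F k = F l.
Proof.
move=> cK AK k0 l1 e01; have i0 : 0 <= (0 : R) <= 1 by lra.
have i1 : 0 <= (1 : R) <= 1 by lra.
have := @functor_square K k (cst (k 1)) (cst (k 0)) l cK AK k0.
rewrite (@functor_cst (cst (k 1)) (k 1)) ?(@functor_cst (cst (k 0)) (k 0)) //.
- rewrite mulg1 mul1g; apply => // s s01; by have [] := e01 _ s01.
- by rewrite -k0 //; exact: AK.
- by rewrite -k0 //; exact: AK.
Qed.

(** In the square [m (s (1 + t) / 2)] the bottom is [k], the right side is [l], the left side is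
    constant and the top is [m] itself. *)
Lemma functor_concat k l : path_in k -> path_in l -> k 1 = l 0 ->
  F (concat k l) = (F k * F l)%g.
Proof.
move=> [ck Ak] [cl Al] kl; pose m := concat k l.
have [cm Am] : path_in m by exact: path_in_concat.
have := @functor_square (fun st : R * R => m (st.1 * (1 + st.2) * 2^-1)) k l (cst (m 0)) m.
rewrite (@functor_cst (cst (m 0)) (m 0)) ?mul1g //; last by apply: Am; lra.
move=> -> //.
- by cts.
- by move=> s t s01 t01 /=; apply: Am; nra.
- move=> s s01 /=; rewrite /m /concat ifT; last by lra.
  by congr k; lra.
- move=> s s01; rewrite /m /concat /= mul1r; case: ifPn => s2.
    have -> : s = 0 by lra.
    by rewrite -kl; congr k; lra.
  by congr l; lra.
- by move=> s s01 /=; rewrite !mul0r.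
- by move=> s s01 /=; congr m; lra.
Qed.

(** In the square [k (s (1 - t))] the bottom is [k], the right side its reverse, and the two other
    sides are constant. *)
Lemma functor_rev k : path_in k -> F (fun s => k (1 - s)) = (F k)^-1%g.
Proof.
move=> [ck Ak]; apply: (mulgI (F k)); rewrite mulgV.
rewrite (@functor_square (fun st : R * R => k (st.1 * (1 - st.2))) k (fun s => k (1 - s))
  (cst (k 0)) (cst (k 0))).
- by rewrite (@functor_cst (cst (k 0)) (k 0)) ?mul1g //; apply: Ak; lra.
- by cts.
- by move=> s t s01 t01 /=; apply: Ak; nra.
- by move=> s _ /=; rewrite subr0 mulr1.
- by move=> s _ /=; rewrite mul1r.
- by move=> s _ /=; rewrite mul0r.
- by move=> s _ /=; rewrite subrr mulr0.
Qed.

End PathFunctors.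

Section Clamp.
Variable R : realType.
Definition clamp01 (s : R) : R := Num.max 0 (Num.min 1 s).
Lemma clamp01P s : 0 <= clamp01 s <= 1.
Proof. by rewrite /clamp01 le_max lexx /= ge_max ler01 ge_min lexx. Qed.
Lemma clamp01K s : 0 <= s <= 1 -> clamp01 s = s.
Proof. by move=> /andP[? ?]; rewrite /clamp01 min_r ?max_r. Qed.
Lemma cts_clamp01 : continuous clamp01. Proof. by rewrite /clamp01; cts. Qed.
End Clamp.

Section Pi1Functor.
Variables (R : realType) (E : topologicalType) (A : set E) (u : A).
Local Notation G := (pi1 R u).
Implicit Types (k l : R -> E) (K : R * R -> E).

Definition lift_to (e : E) : A := insubd u e.

Lemma val_lift_to e : A e -> set_val (lift_to e) = e.
Proof. by move=> Ae; rewrite /lift_to /insubd insubT //; exact/mem_set. Qed.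

Lemma cts_lift_to (Z : topologicalType) (f : Z -> E) : continuous f ->
  (forall z, A (f z)) -> continuous (fun z => lift_to (f z)).
Proof.
move=> cf Af; apply: continuous_comp_initial.
rewrite (_ : _ \o _ = f) //; apply/funext => z /=; exact: val_lift_to.
Qed.

Lemma lift_toK (x : A) : lift_to (set_val x) = x.
Proof. by apply: val_inj; exact/val_lift_to/set_valP. Qed.

(** The path [k] is only known to stay in [A] over [0, 1]; the clamp makes its lift to the subspace
    continuous on [R]. *)
Definition path_pi1 k : G := based_class u (fun s => lift_to (k (clamp01 s))).

Lemma path_pi1_functor : path_functor A path_pi1.
Proof.
split.
- move=> K cK AK; pose K' (st : R * R) := lift_to (K (clamp01 st.1, clamp01 st.2)).
  have cK' : continuous K'.
    apply: cts_lift_to => [|st]; last by apply: AK; exact: clamp01P.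
    by have cc := @cts_clamp01 R; cts.
  have := based_class_square u cK'; rewrite /K' /= !clamp01K ?lexx ?ler01 //.
- by move=> e Ae; rewrite /path_pi1 based_class_cst.
- move=> k l kl; rewrite /path_pi1; congr based_class; apply/funext => s.
  by rewrite kl// clamp01P.
Qed.

Definition loop_in k := [/\ path_in A k, k 0 = set_val u & k 1 = set_val u].

Lemma is_loop_lift k : loop_in k -> is_loop u (fun s => lift_to (k (clamp01 s))).
Proof.
move=> [[ck Ak] k0 k1]; have cc := @cts_clamp01 R; split.
- by apply: cts_lift_to => [|s]; [cts|apply: Ak; exact: clamp01P].
- by rewrite clamp01K ?lexx ?ler01 // k0 lift_toK.
- by rewrite clamp01K ?lexx ?ler01 // k1 lift_toK.
Qed.

Lemma path_pi1_surj (v : G) : exists2 k, loop_in k & path_pi1 k = v.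
Proof.
have [f lf fv] := path_class_surj v; have [cf f0 f1] := lf.
exists (fun s => set_val (f (clamp01 s))).
  have cc := @cts_clamp01 R; have cv := @initial_continuous A E set_val.
  split; [split|by rewrite clamp01K ?lexx ?ler01 // f0|by rewrite clamp01K ?lexx ?ler01 // f1].
    by cts.
  by move=> s _; exact: set_valP.
rewrite -fv /path_pi1; set g := (fun s => _).
have gE s : 0 <= s <= 1 -> g s = f s.
  by move=> s01; rewrite /g lift_toK !clamp01K // clamp01K.
have lg : is_loop u g.
  split; rewrite ?gE ?lexx ?ler01 //.
  rewrite (_ : g = fun s => f (clamp01 (clamp01 s))); last first.
    by apply/funext => s; rewrite /g lift_toK.
  by have cc := @cts_clamp01 R; cts.
rewrite based_class_loop //.
have [p pE] := is_loop_path lf; rewrite (path_class_loop lf pE).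
by apply: path_class_loop => // s; rewrite pE gE// timeP.
Qed.

Lemma functor_path_class (H : groupType) (F : (R -> E) -> H) k l :
  path_functor A F -> loop_in k -> loop_in l ->
  path_pi1 k = path_pi1 l -> F k = F l.
Proof.
move=> pF ik il; have lk := is_loop_lift ik; have ll := is_loop_lift il.
rewrite /path_pi1 !based_class_loop //.
have [p pE] := is_loop_path lk; have [q qE] := is_loop_path ll.
rewrite (path_class_loop lk pE) (path_class_loop ll qE).
move=> /loop_classP[M [cM M0 M1 Me]].
have cv := @initial_continuous A E set_val; have cc := @continuous_clamp R.
have [[ck Ak] k0 k1] := ik; have [[cl Al] l0 l1] := il.
apply: (functor_homotopic (K := fun st : R * R => set_val (M (clamp st.1, clamp st.2))) pF).
- by cts.
- by move=> s t _ _ /=; exact: set_valP.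
- move=> s s01 /=; rewrite -zeroE M0 pE val_lift_to ?clampK ?clamp01K//; exact: Ak.
- move=> s s01 /=; rewrite -oneE M1 qE val_lift_to ?clampK ?clamp01K//; exact: Al.
- by move=> t t01 /=; rewrite -zeroE -oneE !(Me _).1 !(Me _).2 k0 k1.
Qed.

(** A homotopy of loops is a square with two constant sides, so [F] depends on the class only and
    can be evaluated on chosen representatives. Every morphism between fundamental groups of models
    below is obtained in this way. *)
Lemma pi1_universal (H : groupType) (F : (R -> E) -> H) : path_functor A F ->
  { f : G -> H | (forall v w, f (v * w)%g = (f v * f w)%g) &
                 forall k, loop_in k -> f (path_pi1 k) = F k }.
Proof.
move=> pF; pose r v := sval (cid2 (path_pi1_surj v)).
have rl v : loop_in (r v) by rewrite /r; case: cid2.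
have rE v : path_pi1 (r v) = v by rewrite /r; case: cid2.
exists (fun v => F (r v)).
  move=> v w; have [pv v0 v1] := rl v; have [pw w0 w1] := rl w.
  have vw : r v 1 = r w 0 by rewrite v1 w0.
  rewrite -(functor_concat pF pv pw vw); apply: functor_path_class => //.
    split; rewrite ?concat0 ?concat1 //; case: pv pw => [cv Av] [cw Aw].
    split; first exact: cts_concat.
    move=> s s01; rewrite /concat; case: ifPn => s2; first by apply: Av; lra.
    by apply: Aw; move: s2; rewrite -ltNge; lra.
  by rewrite (functor_concat path_pi1_functor) // !rE.
by move=> k lk; apply: functor_path_class.
Qed.

End Pi1Functor.

(** * Holonomy of a cocycle *)

Section Cousin.
Variable R : realType.

Lemma near_real (t : R) (P : R -> Prop) : (\forall x \near t, P x) ->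
  exists2 e, 0 < e & forall x, `|x - t| < e -> P x.
Proof.
move=> /nbhs_ballP[e /= e0 H]; exists e => // x xt; apply: H.
by rewrite /ball /= distrC.
Qed.

Lemma near_real2 (p : R * R) (P : R * R -> Prop) : (\forall x \near p, P x) ->
  exists2 e, 0 < e & forall x, `|x.1 - p.1| < e -> `|x.2 - p.2| < e -> P x.
Proof.
move=> /nbhs_ballP[e /= e0 H]; exists e => // x x1 x2; apply: H.
by split; rewrite /ball /= distrC.
Qed.

(** Compactness of [0, 1] as an induction on intervals: the supremum of the [t] with [Q 0 t] is
    attained, and it could be passed if it were below 1. It stands in for cutting a path or a square
    into small pieces. *)
Lemma cousin (Q : R -> R -> Prop) :
  (forall a b c, 0 <= a -> a <= b -> b <= c -> c <= 1 -> Q a b -> Q b c -> Q a c) ->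
  (forall t, 0 <= t <= 1 -> exists2 e, 0 < e & forall a b, 0 <= a -> b <= 1 ->
     t - e < a -> a <= t -> t <= b -> b < t + e -> Q a b) ->
  Q 0 1.
Proof.
move=> Qtrans Qloc; pose S := [set t : R | 0 <= t <= 1 /\ Q 0 t].
have S0 : S 0.
  split; first by lra.
  by have [|e e0] := Qloc 0; [lra|apply; lra].
have hS : has_sup S.
  split; first by exists 0.
  by exists 1 => t [t01 _]; lra.
have T0 : 0 <= sup S by apply: sup_upper_bound.
have T1 : sup S <= 1 by apply: ge_sup => [|t [t01 _]]; [exists 0|lra].
have [|e e0 He] := Qloc (sup S); first by rewrite T0.
have [t [t01 Qt] tT] := sup_adherent e0 hS.
have tS : t <= sup S by apply: sup_upper_bound.
pose v := Num.min 1 (sup S + e / 2).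
have v1 : v <= 1 by rewrite ge_min lexx.
have vT : sup S <= v by rewrite le_min T1 /=; lra.
have ve : v < sup S + e by rewrite gt_min; apply/orP; right; lra.
have /andP[t0 _] := t01.
have Qv : Q 0 v by apply: (Qtrans 0 t v) => //; [exact: le_trans vT|exact: He].
have vS : v <= sup S.
  by apply: sup_upper_bound => //; split=> //; rewrite (le_trans T0 vT).
suff v1' : v = 1 by rewrite -v1'.
by move: vS; rewrite /v; have [?|?] := leP 1 (sup S + e / 2) => // ?; lra.
Qed.

End Cousin.

(* A cocycle on a two-set open cover: [sec i] is a section over [V i], and the
   sections differ by a locally constant factor.  Its holonomy is a path
   functor. *)
Section Holonomy.
Variables (R : realType) (E : topologicalType) (A : set E) (H : groupType).
Variables (V : bool -> set E) (sec : bool -> E -> H).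
Hypothesis V_open : forall i, open (V i).
Hypothesis V_cover : forall e, A e -> exists i, V i e.
Hypothesis sec_trans : forall e i j, V i e -> V j e ->
  \forall e' \near e, (sec i e' * (sec j e')^-1 = sec i e * (sec j e)^-1)%g.

(** Lifts of [c] to the covering with group [H] glued from the cocycle: in each chart [h] is locally
    a constant left multiple of [sec i]. The condition is relative to [S], since the rectangles on
    which it is used are not open. *)
Definition parallel (Z : topologicalType) (c : Z -> E) (S : set Z) (h : Z -> H) :=
  forall P, S P -> forall i, V i (c P) ->
    \forall P' \near P, S P' ->
      (h P' * (sec i (c P'))^-1 = h P * (sec i (c P))^-1)%g.

Lemma parallel_sec (Z : topologicalType) (c : Z -> E) (S : set Z) i :
  continuous c -> (forall P, S P -> V i (c P)) -> parallel c S (fun P => sec i (c P)).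
Proof.
move=> cc SV P SP j Vj.
have n : \forall P' \near P, (sec i (c P') * (sec j (c P'))^-1 =
    sec i (c P) * (sec j (c P))^-1)%g.
  exact: (cc P _ (sec_trans (SV P SP) Vj)).
by apply: filterS n => P' ->.
Qed.

(** Two parallel functions differ locally by a constant left factor; by [cousin] along [p] this
    factor is the same at both ends and cancels. *)
Lemma parallel_unique (Z : topologicalType) (c : Z -> E) (S : set Z) h h'
    (p : R -> Z) :
  (forall P, S P -> A (c P)) -> parallel c S h -> parallel c S h' ->
  continuous p -> (forall s, 0 <= s <= 1 -> S (p s)) ->
  ((h (p 0%R))^-1 * h (p 1%R) = (h' (p 0%R))^-1 * h' (p 1%R))%g.
Proof.
move=> SA ph ph' cp Sp; suff : (h (p 0%R) * (h' (p 0%R))^-1 = h (p 1%R) * (h' (p 1%R))^-1)%g.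
  move=> e; apply: (mulgI (h (p 0%R))); apply: (mulIg ((h' (p 1%R))^-1)%g).
  by rewrite !mulgA mulgV mul1g -e mulgK.
apply: (cousin (Q := fun a b => (h (p a) * (h' (p a))^-1 = h (p b) * (h' (p b))^-1)%g)).
  by move=> a b d _ _ _ _ -> ->.
move=> t t01; have St := Sp _ t01; have [i Vi] := V_cover (SA _ St).
have [e e0 He] := near_real (cp t _ (filterI (ph _ St i Vi) (ph' _ St i Vi))).
exists e => // a b a0 b1 ta at' tb bt.
have loc x : 0 <= x <= 1 -> `|x - t| < e ->
    (h (p x) * (h' (p x))^-1 = h (p t) * (h' (p t))^-1)%g.
  move=> x01 /He[] /(_ (Sp _ x01)) h1 /(_ (Sp _ x01)) h2.
  have -> : (h (p x) = h (p t) * (sec i (c (p t)))^-1 * sec i (c (p x)))%g.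
    by rewrite -h1 mulgVK.
  have -> : (h' (p x) = h' (p t) * (sec i (c (p t)))^-1 * sec i (c (p x)))%g.
    by rewrite -h2 mulgVK.
  by rewrite !invgM !mulgA mulgK invgK mulgVK.
by rewrite !loc //; rewrite ?ltr_norml; lra.
Qed.

(** A constant factor makes the two functions agree at [P0]. The wall [phi = b] is convex inside
    [S], so by uniqueness along segments they then agree on the whole wall. *)
Lemma parallel_glue (c : R * R -> E) (S : set (R * R)) (phi : R * R -> R) b P0 h1 h2 :
  continuous c -> (forall P, S P -> A (c P)) -> continuous phi ->
  (forall P Q s, S P -> S Q -> phi P = b -> phi Q = b -> 0 <= s <= 1 ->
     let M := (P.1 + s * (Q.1 - P.1), P.2 + s * (Q.2 - P.2)) in
     S M /\ phi M = b) ->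
  S P0 -> phi P0 = b ->
  parallel c (S `&` [set P | phi P <= b]) h1 ->
  parallel c (S `&` [set P | b <= phi P]) h2 ->
  exists h, parallel c S h.
Proof.
move=> cc SA cphi conv SP0 phiP0 p1 p2; pose k := (h1 P0 * (h2 P0)^-1)%g.
have kE P : S P -> phi P = b -> h1 P = (k * h2 P)%g.
  move=> SP phiP; pose I := S `&` [set P | phi P = b].
  have p1' : parallel c I h1.
    move=> Q [SQ phiQ] i Vi; have := p1 Q; rewrite /= phiQ lexx => /(_ (conj SQ isT) i Vi).
    by apply: filterS => Q' + [SQ' phiQ']; rewrite phiQ'; apply.
  have p2' : parallel c I h2.
    move=> Q [SQ phiQ] i Vi; have := p2 Q; rewrite /= phiQ lexx => /(_ (conj SQ isT) i Vi).
    by apply: filterS => Q' + [SQ' phiQ']; rewrite phiQ'; apply.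
  have := parallel_unique (p := fun s : R => (P0.1 + s * (P.1 - P0.1), P0.2 + s * (P.2 - P0.2)))
    _ p1' p2'.
  rewrite !mul0r !addr0 !mul1r !(addrC _ (_ - _)) !subrK -!surjective_pairing.
  move=> e; rewrite /k -mulgA -e ?mulgA ?mulgV ?mul1g //.
  - by move=> Q [SQ _]; exact: SA.
  - by cts.
  - by move=> s s01; exact: (conv P0 P s).
exists (fun P => if phi P <= b then h1 P else k * h2 P)%g => P SP i Vi.
have [lt|gt|eq] := ltgtP (phi P) b.
- have near_lt : \forall P' \near P, phi P' < b.
    exact: (cphi P _ (lt_nbhsl lt)).
  have := p1 P (conj SP (ltW lt)) i Vi; apply: filter_app; apply: filterS near_lt.
  by move=> P' lt' + SP'; rewrite (ltW lt'); apply; split=> //=; exact: ltW.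
- have near_gt : \forall P' \near P, b < phi P'.
    exact: (cphi P _ (lt_nbhsr gt)).
  have := p2 P (conj SP (ltW gt)) i Vi; apply: filter_app; apply: filterS near_gt.
  move=> P' gt' + SP'; rewrite leNgt gt' /= -!mulgA => ->//.
  by split=> //=; exact: ltW.
- have := p1 P; rewrite /= eq lexx => /(_ (conj SP isT) i Vi) n1.
  have := p2 P; rewrite /= eq lexx => /(_ (conj SP isT) i Vi) n2.
  apply: filterS (filterI n1 n2) => P' [/= h1E h2E] SP'; case: ifPn => [le|].
    exact: h1E.
  rewrite -ltNge => gt; rewrite -mulgA h2E; last by split=> //; exact: ltW.
  by rewrite mulgA -kE.
Qed.

(** The induction [cousin] is used in both directions: small rectangles are glued to a strip around
    each height [t], and strips are glued to the square. *)
Lemma parallel_exists (K : R * R -> E) : continuous K ->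
  (forall s t, 0 <= s <= 1 -> 0 <= t <= 1 -> A (K (s, t))) ->
  exists h, parallel K [set P | 0 <= P.1 <= 1 /\ 0 <= P.2 <= 1] h.
Proof.
move=> cK AK; pose rect (a b c d : R) := [set P : R * R | a <= P.1 <= b /\ c <= P.2 <= d].
have sub S S' h : S' `<=` S -> parallel K S h -> parallel K S' h.
  by move=> SS ph P /SS SP i Vi; apply: filterS (ph P SP i Vi) => P' + /SS; apply.
pose Q2 (c d : R) := exists h, parallel K (rect 0 1 c d) h.
apply: (cousin (Q := Q2)).
  move=> a b c a0 ab bc c1 [h1 p1] [h2 p2].
  apply: (@parallel_glue K (rect 0 1 a c) snd b (0, b) h1 h2 cK).
  - by move=> [x y] [/= x01 yac]; apply: AK; lra.
  - by move=> z; exact: cvg_snd.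
  - move=> [x y] [x' y'] s [/= x01 yac] [/= x'01 y'ac] /= -> -> s01.
    by rewrite /rect /=; split; [split; nra|ring].
  - by rewrite /rect /=; lra.
  - by [].
  - by apply: sub p1 => -[x y] [[/= x01 yac] yb]; rewrite /rect /=; lra.
  - by apply: sub p2 => -[x y] [[/= x01 yac] yb]; rewrite /rect /=; lra.
move=> t t01.
(* The height [e] of the strip may depend on the piece [a, b]; two pieces are glued over the smaller
   of their heights. *)
pose Q1 (a b : R) := exists2 e, 0 < e & forall c d, 0 <= c -> d <= 1 ->
  t - e < c -> c <= t -> t <= d -> d < t + e ->
  exists h, parallel K (rect a b c d) h.
apply: (cousin (Q := Q1)).
  move=> a b c a0 ab bc c1 [e1 e10 H1] [e2 e20 H2].
  exists (Num.min e1 e2); first by rewrite lt_min e10.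
  move=> d f d0 f1 td dt tf ft.
  have m1 : Num.min e1 e2 <= e1 by rewrite ge_min lexx.
  have m2 : Num.min e1 e2 <= e2 by rewrite ge_min lexx orbT.
  have [h1 p1] : exists h, parallel K (rect a b d f) h by apply: H1; lra.
  have [h2 p2] : exists h, parallel K (rect b c d f) h by apply: H2; lra.
  apply: (@parallel_glue K (rect a c d f) fst b (b, t) h1 h2 cK).
  - by move=> [x y] [/= x01 yac]; apply: AK; lra.
  - by move=> z; exact: cvg_fst.
  - move=> [x y] [x' y'] s [/= x01 yac] [/= x'01 y'ac] /= -> -> s01.
    by rewrite /rect /=; split; [split; nra|ring].
  - by rewrite /rect /=; lra.
  - by [].
  - by apply: sub p1 => -[x y] [[/= x01 yac] yb]; rewrite /rect /=; lra.
  - by apply: sub p2 => -[x y] [[/= x01 yac] yb]; rewrite /rect /=; lra.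
move=> s s01; have [i Vi] := V_cover (AK _ _ s01 t01).
have nV : \forall P \near (s, t), V i (K P).
  exact: (cK (s, t) _ (open_nbhs_nbhs (conj (V_open i) Vi))).
have [e e0 He] := near_real2 nV.
exists e => // a b a0 b1 sa as' sb bs; exists e => // c d c0 d1 tc ct td dt.
exists (fun P => sec i (K P)); apply: parallel_sec => // -[x y] [/= x01 y01].
by apply: He; rewrite /= ltr_norml; lra.
Qed.

Definition parallel_along (k : R -> E) h := parallel k [set t | 0 <= t <= 1] h.

Definition holonomy (k : R -> E) : H :=
  if pselect (exists h, parallel_along k h) is left p
  then let h := sval (cid p) in ((h 0%R)^-1 * h 1%R)%g else 1%g.

Lemma holonomyE k h : path_in A k -> parallel_along k h ->
  holonomy k = ((h 0%R)^-1 * h 1%R)%g.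
Proof.
move=> [ck Ak] ph; rewrite /holonomy; case: pselect => [p /=|[]]; last by exists h.
apply: (parallel_unique (p := fun t => t) Ak (svalP (cid p)) ph) => //.
by cts.
Qed.

Lemma parallel_comp (Z Z' : topologicalType) (c : Z -> E) S h (S' : set Z') (f : Z' -> Z) :
  continuous f -> (forall z, S' z -> S (f z)) -> parallel c S h ->
  parallel (fun z => c (f z)) S' (fun z => h (f z)).
Proof.
move=> cf SS ph z S'z i Vi.
have n : \forall z' \near z, S (f z') ->
    (h (f z') * (sec i (c (f z')))^-1 = h (f z) * (sec i (c (f z)))^-1)%g.
  exact: (cf z _ (ph _ (SS _ S'z) i Vi)).
by apply: filterS n => z' + S'z'; apply; exact: SS.
Qed.

Lemma holonomy_functor : path_functor A holonomy.
Proof.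
split.
- move=> K cK AK; have [h ph] := parallel_exists cK AK.
  have hE (p : R -> R * R) : continuous p ->
      (forall s, 0 <= s <= 1 -> 0 <= (p s).1 <= 1 /\ 0 <= (p s).2 <= 1) ->
      holonomy (fun s => K (p s)) = ((h (p 0%R))^-1 * h (p 1%R))%g.
    move=> cp p01; apply: (@holonomyE _ (fun s => h (p s))).
      split=> [|s s01]; first by cts.
      by rewrite [p s]surjective_pairing; apply: AK; have [] := p01 _ s01.
    exact: (parallel_comp cp p01 ph).
  rewrite (hE (fun s : R => (s, 0))) ?(hE (fun s : R => (1, s)))
    ?(hE (fun s : R => (0, s))) ?(hE (fun s : R => (s, 1))).
    by rewrite !mulgA !mulgK.
  - by cts.
  - by move=> s s01 /=; lra.
  - by cts.
  - by move=> s s01 /=; lra.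
  - by cts.
  - by move=> s s01 /=; lra.
  - by cts.
  - by move=> s s01 /=; lra.
- move=> e Ae; rewrite (@holonomyE _ (fun _ => 1%g)); first by rewrite mulg1 invg1.
    by split=> //; exact: cts_cst.
  by move=> P _ i _; near=> P'.
- move=> k l kl; suff e : parallel_along k = parallel_along l.
    by rewrite /holonomy e.
  have tr k1 k2 h : (forall s, 0 <= s <= 1 -> k1 s = k2 s) ->
      parallel_along k1 h -> parallel_along k2 h.
    move=> k12 p P SP i; rewrite -k12// => Vi; apply: filterS (p P SP i Vi).
    by move=> P' + SP' => /(_ SP'); rewrite -k12.
  by apply/funext => h; apply/propext; split; apply: tr => // s s01; rewrite kl.
Unshelve. all: by end_near. Qed.

Lemma holonomy_sec k i : path_in A k -> (forall s, 0 <= s <= 1 -> V i (k s)) ->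
  holonomy k = ((sec i (k 0%R))^-1 * sec i (k 1%R))%g.
Proof.
move=> Ak Vk; rewrite (@holonomyE k (fun s => sec i (k s))) //.
by apply: parallel_sec => //; case: Ak.
Qed.

End Holonomy.

(** * The affine model *)

Section Space4.
Variable R : realType.

Definition R4 : Type := R * R * R * R.
HB.instance Definition _ := Topological.on R4.
Definition re1 (e : R4) : R := e.1.1.1.
Definition im1 (e : R4) : R := e.1.1.2.
Definition re2 (e : R4) : R := e.1.2.
Definition im2 (e : R4) : R := e.2.
Definition mk4 (x y p q : R) : R4 := (x, y, p, q).

Lemma mk4_eta e : mk4 (re1 e) (im1 e) (re2 e) (im2 e) = e.
Proof. by case: e => [[[]]]. Qed.

Lemma mk4E x y p q : (re1 (mk4 x y p q) = x) * (im1 (mk4 x y p q) = y) *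
  (re2 (mk4 x y p q) = p) * (im2 (mk4 x y p q) = q).
Proof. by []. Qed.

Section Continuity4.
Variable Z : topologicalType.
Lemma cts_mk4 (x y p q : Z -> R) : continuous x -> continuous y -> continuous p ->
  continuous q -> continuous (fun z => mk4 (x z) (y z) (p z) (q z)).
Proof.
by move=> cx cy cp cq; apply: (@cts_pair Z (R * R * R)%type R); cts.
Qed.
Lemma cts_re1 (f : Z -> R4) : continuous f -> continuous (fun z => re1 (f z)).
Proof. by move=> cf; rewrite /re1; do ?apply: cts_fst. Qed.
Lemma cts_im1 (f : Z -> R4) : continuous f -> continuous (fun z => im1 (f z)).
Proof. by move=> cf; rewrite /im1; apply: cts_snd; do ?apply: cts_fst. Qed.
Lemma cts_re2 (f : Z -> R4) : continuous f -> continuous (fun z => re2 (f z)).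
Proof. by move=> cf; rewrite /re2; apply: cts_snd; apply: cts_fst. Qed.
Lemma cts_im2 (f : Z -> R4) : continuous f -> continuous (fun z => im2 (f z)).
Proof. by move=> cf; rewrite /im2; apply: cts_snd. Qed.
End Continuity4.
End Space4.

Ltac cts4_step := lazymatch goal with
  | |- continuous (fun _ => ?c) => apply: cts_cst
  | |- continuous (fun z => mk4 _ _ _ _) => apply: cts_mk4
  | |- continuous (fun z => re1 (@?f z)) => apply: (@cts_re1 _ _ f)
  | |- continuous (fun z => im1 (@?f z)) => apply: (@cts_im1 _ _ f)
  | |- continuous (fun z => re2 (@?f z)) => apply: (@cts_re2 _ _ f)
  | |- continuous (fun z => im2 (@?f z)) => apply: (@cts_im2 _ _ f)
  | |- _ => cts_step
  end.
Ltac cts4 := repeat cts4_step.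

Section Model.
Variable R : realType.
Local Notation E := (R4 R).
Implicit Types (a x y t : R) (e : E) (cd : R * R) (k l : R -> E).

Lemma seq_upper_bound (s : seq R) : exists t, forall x, x \in s -> x < t.
Proof.
elim: s => [|x s [t IH]]; first by exists 0.
exists (Num.max (x + 1) (t + 1)) => z; rewrite inE lt_max => /orP[/eqP->|/IH zt].
  by apply/orP; left; lra.
by apply/orP; right; lra.
Qed.

Lemma seq_lower_bound (s : seq R) : exists t, forall x, x \in s -> t < x.
Proof.
have [t H] := seq_upper_bound [seq - x | x <- s]; exists (- t) => x xs.
by have := H (- x) (map_f _ xs); lra.
Qed.

Definition value cd x := cd.1 * x + cd.2.

(* [z = re1 + i im1], [w = re2 + i im2]; the removed lines are [z = a] and
   [w = c z + d]. *)
Definition model (s : seq R) (B : seq (R * R)) : set E :=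
  [set e | (forall a, a \in s -> ~ (re1 e = a /\ im1 e = 0)) /\
           (forall cd, cd \in B -> ~ (re2 e = value cd (re1 e) /\ im2 e = cd.1 * im1 e))].

Lemma model_sub s B : model s B `<=` model [::] B.
Proof. by move=> e [_ eB]. Qed.

Definition distinct_at (B : seq (R * R)) x :=
  forall cd cd', cd \in B -> cd' \in B -> value cd x = value cd' x -> cd = cd'.

Lemma cts_prod (Z : topologicalType) (I : eqType) (r : seq I) (f : I -> Z -> R) :
  (forall i, continuous (f i)) -> continuous (fun z => \prod_(i <- r) f i z).
Proof.
move=> cf; elim: r => [|i r IH].
  by rewrite (_ : (fun z => _) = cst 1); [exact: cts_cst|apply/funext => z; rewrite big_nil].
rewrite (_ : (fun z => _) = fun z => f i z * \prod_(i <- r) f i z).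
  by apply: cts_mul.
by apply/funext => z; rewrite big_cons.
Qed.

(** Newton interpolation in the height, one line at a time. It cannot be done with [eta] equal to 1,
    since where two graphs of different slopes meet [rho] would need two values. *)
Lemma interpolation (B : seq (R * R)) : exists (eta : R -> R) (rho : R * R -> R),
  [/\ continuous eta, continuous rho,
      forall x cd, cd \in B -> rho (x, value cd x) = eta x * cd.1,
      forall x, 0 <= eta x & forall x, distinct_at B x -> 0 < eta x].
Proof.
suff [eta [rho [ceta crho rhoE eta0]]] : exists (eta : R -> R) (rho : R * R -> R),
    [/\ continuous eta, continuous rho,
      forall x cd, cd \in B -> rho (x, value cd x) = eta x * cd.1 &
      forall x, distinct_at B x -> eta x != 0].
  (* Multiplying both functions by [eta] keeps the tangency and makes the first one a square. *)
  exists (fun x => eta x * eta x), (fun xp => eta xp.1 * rho xp); split.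
  - by cts.
  - by cts.
  - by move=> x cd Bcd /=; rewrite rhoE// mulrA.
  - by move=> x; rewrite -expr2 sqr_ge0.
  - by move=> x /eta0 ex; rewrite -expr2 exprn_even_gt0.
elim: B => [|cd0 B [eta [rho [ceta crho rhoE eta0]]]].
  exists (fun=> 1), (fun=> 0); split=> //; try by cts.
  by move=> x _; rewrite oner_eq0.
(* For a repeated line the factor [v] below would vanish identically. *)
have [cd0B|cd0B] := boolP (cd0 \in B).
  exists eta, rho; split=> //.
    by move=> x cd; rewrite inE => /orP[/eqP->|]; apply: rhoE.
  move=> x sep; apply: eta0 => cd cd' Bcd Bcd'; apply: sep; rewrite inE ?Bcd ?Bcd' orbT //.
pose v x := \prod_(cd <- B) (value cd0 x - value cd x).
have cv : continuous v by apply: cts_prod => cd; rewrite /value; cts.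
pose r (xp : R * R) := \prod_(cd <- B) (xp.2 - value cd xp.1).
have cr : continuous r by apply: cts_prod => cd; rewrite /value; cts.
(* The product [r] vanishes on the old graphs and equals [v x] on the new one, so the second term
   corrects the value there alone; the factor [v] avoids dividing by it. *)
exists (fun x => v x * eta x), (fun xp => v xp.1 * rho xp +
  (eta xp.1 * cd0.1 - rho (xp.1, value cd0 xp.1)) * r xp); split.
- by cts.
- by rewrite /value; cts.
- move=> x cd; rewrite inE => /orP[/eqP->|Bcd] /=.
    by rewrite -[r _]/(v x); ring.
  rewrite rhoE // (_ : r _ = 0) ?mulr0 ?addr0 ?mulrA //.
  by rewrite /r (big_rem cd) //= subrr mul0r.
- move=> x sep; rewrite mulf_neq0 //; last first.
    by apply: eta0 => cd cd' Bcd Bcd'; apply: sep; rewrite inE ?Bcd ?Bcd' orbT.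
  rewrite /v prodf_seq_neq0; apply/allP => cd Bcd /=.
  apply: contra cd0B; rewrite subr_eq0 => /eqP e0.
  by rewrite (sep cd0 cd) ?inE ?eqxx ?Bcd ?orbT.
Qed.

(* Points off the real hyperplane [im1 = 0] are parametrised by [z] and the
   unique real line [w = c z + d] through them. *)
Definition on_line x y cd : E := mk4 x y (value cd x) (cd.1 * y).
Definition slope e : R := im2 e * (im1 e)^-1.
Definition line_of e : R * R := (slope e, re2 e - re1 e * slope e).

Lemma on_line_of e : im1 e != 0 -> on_line (re1 e) (im1 e) (line_of e) = e.
Proof.
move=> y0; rewrite -[RHS]mk4_eta /on_line /value /line_of /slope /=.
by congr mk4; field.
Qed.

Lemma line_of_on_line x y cd : y != 0 -> line_of (on_line x y cd) = cd.
Proof.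
by case: cd => c d y0; rewrite /on_line /line_of /slope /value /mk4 /re1 /im1 /re2 /im2 /=; congr pair; field.
Qed.

Lemma model_on_line s B x y cd : y != 0 -> model s B (on_line x y cd) <-> cd \notin B.
Proof.
move=> y0; split=> [[_ H]|cdB].
  by apply/negP => /H; rewrite /on_line /mk4 /re1 /im1 /re2 /im2 /=; case.
split=> [a _ [_ /eqP]|cd' Bcd']; first by rewrite (negbTE y0).
rewrite /on_line /mk4 /re1 /im1 /re2 /im2 /= => -[e1 /(mulIf y0) e2].
move: cdB; have -> : cd = cd'; last by rewrite Bcd'.
case: cd e1 e2 => c d; case: cd' {Bcd'} => c' d'; rewrite /value /= => e1 e2.
by rewrite e2 in e1 *; congr pair; lra.
Qed.

(** The arcs [P + s v + t s (1 - s) v'], with [v'] the vector [v] turned by a right angle, are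
    disjoint for different [t] except at their ends. So each point of [B] other than an end excludes
    at most one [t]; [sb] and [tb] recover [s] and [t] from a point. *)
Lemma avoid_finite (B : seq (R * R)) (P Q : R * R) : P \notin B -> Q \notin B ->
  exists k : R -> R * R, [/\ continuous k, k 0 = P, k 1 = Q &
    forall s, 0 <= s <= 1 -> k s \notin B].
Proof.
move=> PB QB; have [PQ|PQ] := eqVneq P Q.
  by exists (fun=> P); split=> //; exact: cts_cst.
pose v1 := Q.1 - P.1; pose v2 := Q.2 - P.2; pose n := v1 ^+ 2 + v2 ^+ 2.
have n0 : n != 0.
  rewrite paddr_eq0 ?sqr_ge0 // !sqrf_eq0 !subr_eq0.
  by apply: contra PQ => /andP[/eqP e1 /eqP e2]; rewrite [P]surjective_pairing [Q]surjective_pairing e1 e2.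
pose sb (S : R * R) := ((S.1 - P.1) * v1 + (S.2 - P.2) * v2) / n.
pose tb (S : R * R) := (- (S.1 - P.1) * v2 + (S.2 - P.2) * v1) / (n * (sb S * (1 - sb S))).
have [t tB] := seq_upper_bound [seq tb T | T <- B].
exists (fun s => (P.1 + s * v1 + t * (s * (1 - s)) * - v2, P.2 + s * v2 + t * (s * (1 - s)) * v1)).
split.
- by cts.
- by rewrite !mul0r !mulr0 !mul0r !addr0 -surjective_pairing.
- by rewrite subrr !mulr0 !mul0r !addr0 !mul1r /v1 /v2 !(addrC _ (_ - _)) !subrK -surjective_pairing.
- move=> s s01; apply/negP => kB; have := tB _ (map_f tb kB); apply/negP; rewrite -leNgt.
  set T := (_, _) in kB *.
  have sbE : sb T = s.
    by rewrite /sb /T /=; apply: (mulIf n0); rewrite mulfVK // /n; ring.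
  have ss0 : s * (1 - s) != 0.
    rewrite mulf_neq0 //; apply/eqP.
      move=> s0; move: kB; rewrite /T s0 !mul0r !mulr0 !mul0r !addr0 -surjective_pairing.
      by rewrite (negbTE PB).
    move=> /eqP; rewrite subr_eq0 => /eqP s1; move: kB; rewrite /T -s1.
    rewrite subrr !mulr0 !mul0r !addr0 !mul1r /v1 /v2 !(addrC _ (_ - _)) !subrK -surjective_pairing.
    by rewrite (negbTE QB).
  rewrite le_eqVlt; apply/orP; left; apply/eqP; rewrite /tb sbE /T /=.
  have d0 : n * (s * (1 - s)) != 0 by rewrite mulf_neq0.
  by apply: (mulIf d0); rewrite mulfVK // /n; ring.
Qed.

End Model.

Section Convex.
Variable R : realType.
Local Notation E := (R4 R).
Implicit Types (e : E) (C A : set E) (k l : R -> E).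

Definition seg e e' (t : R) : E :=
  mk4 (re1 e + t * (re1 e' - re1 e)) (im1 e + t * (im1 e' - im1 e))
      (re2 e + t * (re2 e' - re2 e)) (im2 e + t * (im2 e' - im2 e)).

Lemma seg0 e e' : seg e e' 0 = e.
Proof. by rewrite /seg !mul0r !addr0 mk4_eta. Qed.

Lemma seg1 e e' : seg e e' 1 = e'.
Proof. by rewrite /seg !mul1r !(addrC _ (_ - _)) !subrK mk4_eta. Qed.

Lemma cts_seg (Z : topologicalType) (f g : Z -> E) (t : Z -> R) : continuous f ->
  continuous g -> continuous t -> continuous (fun z => seg (f z) (g z) (t z)).
Proof. by move=> cf cg ct; rewrite /seg; cts4. Qed.

Definition convex_set C := forall e e' t, C e -> C e' -> 0 <= t <= 1 -> C (seg e e' t).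

Lemma path_in_seg C e e' : convex_set C -> C e -> C e' -> path_in C (seg e e').
Proof.
by move=> cC Ce Ce'; split=> [|t t01]; [apply: cts_seg; cts|exact: cC].
Qed.

Lemma path_in_sub A A' k : A `<=` A' -> path_in A k -> path_in A' k.
Proof. by move=> AA [ck Ak]; split=> // s /Ak /AA. Qed.

Lemma functor_convex (A : set E) (H : groupType) (F : (R -> E) -> H) C k l :
  path_functor A F -> convex_set C -> C `<=` A -> path_in C k -> path_in C l ->
  k 0 = l 0 -> k 1 = l 1 -> F k = F l.
Proof.
move=> pF cC CA [ck Ck] [cl Cl] k0 k1.
apply: (functor_homotopic (K := fun st : R * R => seg (k st.1) (l st.1) st.2) pF).
- by apply: cts_seg; cts.
- by move=> s t s01 t01; apply: CA; apply: cC => //; [exact: Ck|exact: Cl].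
- by move=> s _ /=; rewrite seg0.
- by move=> s _ /=; rewrite seg1.
- by move=> t _ /=; rewrite -k0 -k1 /seg !subrr !mulr0 !addr0 !mk4_eta.
Qed.

Lemma functor_seg_trans (A : set E) (H : groupType) (F : (R -> E) -> H) C e1 e2 e3 :
  path_functor A F -> convex_set C -> C `<=` A -> C e1 -> C e2 -> C e3 ->
  (F (seg e1 e2) * F (seg e2 e3) = F (seg e1 e3))%g.
Proof.
move=> pF cC CA C1 C2 C3; have s12 := path_in_seg cC C1 C2.
have s23 := path_in_seg cC C2 C3; have s13 := path_in_seg cC C1 C3.
have e12 : seg e1 e2 1 = seg e2 e3 0 by rewrite seg0 seg1.
rewrite -(functor_concat pF (path_in_sub CA s12) (path_in_sub CA s23) e12).
apply: (functor_convex pF cC CA); rewrite ?concat0 ?concat1 ?seg0 ?seg1 //.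
case: s12 s23 => [c12 i12] [c23 i23]; split; first exact: cts_concat.
move=> s s01; rewrite /concat; case: ifPn => s2; first by apply: i12; lra.
by apply: i23; move: s2; rewrite -ltNge; lra.
Qed.

Lemma functor_seg_refl (A : set E) (H : groupType) (F : (R -> E) -> H) e :
  path_functor A F -> A e -> F (seg e e) = 1%g.
Proof.
move=> pF Ae; apply: (functor_cst pF Ae) => s _.
by rewrite /seg !subrr !mulr0 !addr0 mk4_eta.
Qed.

Definition box e (r : R) : set E := [set e' | [/\ `|re1 e' - re1 e| < r,
  `|im1 e' - im1 e| < r, `|re2 e' - re2 e| < r & `|im2 e' - im2 e| < r]].

Lemma lerp_lt (x y r t : R) : 0 <= t <= 1 -> x < r -> y < r -> x + t * (y - x) < r.
Proof. by move=> t01 xr yr; have [xy|yx] := leP x y; nra. Qed.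

Lemma lerp_gt (x y r t : R) : 0 <= t <= 1 -> r < x -> r < y -> r < x + t * (y - x).
Proof. by move=> t01 xr yr; have [xy|yx] := leP x y; nra. Qed.

Lemma norm_seg_lt (x y z r t : R) : 0 <= t <= 1 -> `|x - z| < r -> `|y - z| < r ->
  `|x + t * (y - x) - z| < r.
Proof.
rewrite !ltr_norml !ltrBlDr !ltrBrDr => t01 /andP[x1 x2] /andP[y1 y2].
by rewrite lerp_lt ?lerp_gt.
Qed.

Lemma convex_box e r : convex_set (box e r).
Proof.
move=> e1 e2 t [a1 a2 a3 a4] [b1 b2 b3 b4] t01; split; exact: norm_seg_lt.
Qed.

Lemma box_center e r : 0 < r -> box e r e.
Proof. by move=> r0; split; rewrite subrr normr0. Qed.

Lemma near_box e (P : E -> Prop) : (\forall e' \near e, P e') ->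
  exists2 r, 0 < r & box e r `<=` P.
Proof.
move=> n; have : nbhs (e : R * R * R * R) P by [].
move=> /nbhs_ballP[r /= r0 H]; exists r => // e' [h1 h2 h3 h4]; apply: H.
by split; [split; [split|]|]; rewrite /ball /= distrC.
Qed.

Lemma box_near e r : 0 < r -> \forall e' \near e, box e r e'.
Proof.
move=> r0; pose f e' := Num.max (Num.max `|re1 e' - re1 e| `|im1 e' - im1 e|)
  (Num.max `|re2 e' - re2 e| `|im2 e' - im2 e|).
have cf : continuous f by rewrite /f; cts4.
have fr : f e < r by rewrite /f !subrr !normr0 !maxxx.
have n : \forall e' \near e, f e' < r by exact: (cf e _ (lt_nbhsl fr)).
by apply: filterS n => e'; rewrite /f !gt_max => /andP[/andP[? ?] /andP[? ?]].
Qed.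

Lemma near_neq0 (f : E -> R) e : continuous f -> f e != 0 -> \forall e' \near e, f e' != 0.
Proof.
move=> cf; rewrite neq_lt => /orP[fe|fe].
  have n : \forall e' \near e, f e' < 0 by exact: (cf e _ (lt_nbhsl fe)).
  by apply: filterS n => e' /lt_eqF ->.
have n : \forall e' \near e, 0 < f e' by exact: (cf e _ (lt_nbhsr fe)).
by apply: filterS n => e' /gt_eqF ->.
Qed.

Lemma near_all (T : eqType) (r : seq T) (P : T -> E -> Prop) e :
  (forall a, a \in r -> \forall e' \near e, P a e') ->
  \forall e' \near e, forall a, a \in r -> P a e'.
Proof.
elim: r => [|a r IH] Pr; first by near=> e'.
have n1 := Pr a (mem_head _ _).
have n2 : \forall e' \near e, forall a, a \in r -> P a e'.
  by apply: IH => b br; apply: Pr; rewrite inE br orbT.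
by apply: filterS (filterI n1 n2) => e' [h1 h2] b; rewrite inE => /orP[/eqP->|/h2].
Unshelve. all: by end_near. Qed.

Lemma model_open s B e : model s B e -> \forall e' \near e, model s B e'.
Proof.
(* Lying off a line is the nonvanishing of one continuous function, a sum of two squares. *)
have sq (x y : R) : ~ (x = 0 /\ y = 0) <-> x * x + y * y != 0.
  rewrite -!expr2 paddr_eq0 ?sqr_ge0 // !sqrf_eq0; split=> [H|].
    by apply/negP => /andP[/eqP ? /eqP ?]; exact: H.
  by move=> + [x0 y0]; rewrite x0 y0 eqxx.
move=> [es eB]; apply: filterI; apply: near_all.
  move=> a /es ea; pose f e := (re1 e - a) * (re1 e - a) + im1 e * im1 e.
  have cf : continuous f by rewrite /f; cts4.
  have fe : f e != 0 by apply/sq => -[/subr0_eq ? ?]; apply: ea.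
  have n := near_neq0 cf fe.
  apply: filterS n => e' /sq H [xa y0]; apply: H.
  by rewrite xa subrr.
move=> cd /eB ecd.
pose f e := (re2 e - value cd (re1 e)) * (re2 e - value cd (re1 e)) +
  (im2 e - cd.1 * im1 e) * (im2 e - cd.1 * im1 e).
have cf : continuous f by rewrite /f /value; cts4.
have fe : f e != 0.
  by apply/sq => -[/subr0_eq ? /subr0_eq ?]; apply: ecd.
have n := near_neq0 cf fe.
apply: filterS n => e' /sq H [e1 e2].
by apply: H; rewrite e1 e2 !subrr.
Qed.

End Convex.

(** * Generators of the fundamental group of the model *)

Section Flow.
Variables (R : realType) (B : seq (R * R)).
Variables (eta : R -> R) (rho : R * R -> R).
Hypotheses (ceta : continuous eta) (crho : continuous rho).
Hypothesis rhoE : forall x cd, cd \in B -> rho (x, value cd x) = eta x * cd.1.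
Local Notation E := (R4 R).
Implicit Types (e : E) (t : R).

(* The flow of a vector field pointing along [im1] and [im2] that is tangent to
   every line [w = c z + d] of the model. *)
Definition flow t e : E := mk4 (re1 e) (im1 e + t * eta (re1 e)) (re2 e)
  (im2 e + t * rho (re1 e, re2 e)).

Lemma cts_flow (Z : topologicalType) (f : Z -> E) (t : Z -> R) : continuous f ->
  continuous t -> continuous (fun z => flow (t z) (f z)).
Proof. by move=> cf ct; rewrite /flow; cts4. Qed.

Lemma flow0 e : flow 0 e = e.
Proof. by rewrite /flow !mul0r !addr0 mk4_eta. Qed.

(** The flow keeps [re1] and [re2], and where [re2] is the height of a graph it also keeps
    [im2 - c * im1]. So no point is moved onto a graph, and only the lines [z = a] have to be
    checked. *)
Lemma flow_model s t e : model [::] B e ->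
  (forall a, a \in s -> re1 e = a -> im1 e + t * eta a != 0) -> model s B (flow t e).
Proof.
move=> [_ eB] es; rewrite /flow; split=> [a ys|cd Bcd]; rewrite !mk4E => -[e1 e2].
  by move: (es a ys e1); rewrite -e1 e2 eqxx.
by apply: (eB cd Bcd); split=> //; move: e2; rewrite e1 rhoE // => e2; lra.
Qed.

End Flow.

Section LowerHalf.
Variables (R : realType) (s : seq R) (B : seq (R * R)) (u : model s B).
Hypothesis u_lower : im1 (set_val u) < 0.
Local Notation E := (R4 R).
Local Notation M := (model s B).
Local Notation G := (pi1 R u).
Local Notation tau := (path_pi1 u).
Local Notation ptau := (path_pi1_functor R u).
Implicit Types (e : E) (k : R -> E).

Definition lower : set E := [set e | M e /\ im1 e < 0].
Definition upper : set E := [set e | M e /\ 0 < im1 e].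

Lemma lower_base : lower (set_val u).
Proof. by split=> //; exact: set_valP. Qed.

(** In the coordinates [re1], [im1], [line_of] the set [lower] is a half-plane times the complement
    of a finite set: the first factor is crossed by a segment, the second by an arc that avoids
    [B]. *)
Lemma lower_connected e e' : lower e -> lower e' ->
  exists k, [/\ path_in lower k, k 0 = e & k 1 = e'].
Proof.
move=> [Me ye] [Me' ye']; have ye0 := lt_eqF ye; have ye0' := lt_eqF ye'.
have le : line_of e \notin B.
  by apply/(@model_on_line _ s _ (re1 e) (im1 e)); rewrite ?ye0 ?on_line_of ?ye0.
have le' : line_of e' \notin B.
  by apply/(@model_on_line _ s _ (re1 e') (im1 e')); rewrite ?ye0' ?on_line_of ?ye0'.
have [c [cc c0 c1 cB]] := avoid_finite le le'.
exists (fun t => on_line (re1 e + t * (re1 e' - re1 e)) (im1 e + t * (im1 e' - im1 e)) (c t)).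
split; last 2 first.
- by rewrite c0 !mul0r !addr0 on_line_of ?ye0.
- by rewrite c1 !mul1r !(addrC _ (_ - _)) !subrK on_line_of ?ye0'.
split; first by rewrite /on_line /value; cts4.
move=> t t01; have yt : im1 e + t * (im1 e' - im1 e) < 0 by exact: lerp_lt.
by split; [apply/model_on_line; [rewrite lt_eqF|exact: cB]|].
Qed.

Definition lower_class (v : G) :=
  exists k, [/\ path_in lower k, k 0 = set_val u, k 1 = set_val u & tau k = v].

Lemma lower_sub : lower `<=` M. Proof. by move=> e []. Qed.
Lemma upper_sub : upper `<=` M. Proof. by move=> e []. Qed.



Lemma lower_class1 : lower_class 1%g.
Proof.
exists (cst (set_val u)); split=> //; first by split=> [|t _]; [exact: cts_cst|exact: lower_base].
by apply: (functor_cst ptau (e := set_val u)) => //; exact: set_valP.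
Qed.

Lemma lower_classM v w : lower_class v -> lower_class w -> lower_class (v * w)%g.
Proof.
move=> [k [ik k0 k1 <-]] [l [il l0 l1 <-]]; exists (concat k l).
have kl : k 1 = l 0 by rewrite k1 l0.
split; rewrite ?concat0 ?concat1 //; first exact: path_in_concat.
by apply: functor_concat => //; [exact: ptau|exact: path_in_sub lower_sub _|exact: path_in_sub lower_sub _].
Qed.

Lemma lower_classV v : lower_class v -> lower_class (v^-1)%g.
Proof.
move=> [k [ik k0 k1 <-]]; exists (fun t => k (1 - t)); split.
- exact: path_in_rev.
- by rewrite subr0.
- by rewrite subrr.
- by apply: functor_rev; [exact: ptau|exact: path_in_sub lower_sub _].
Qed.

(** Reference classes: an open path becomes comparable with elements of [G] once it is multiplied by
    the reference classes of its ends. *)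
Definition lower_to e : G :=
  if pselect (lower e) is left le then tau (sval (cid (lower_connected lower_base le)))
  else 1%g.

Lemma lower_toP e : lower e -> exists k,
  [/\ path_in lower k, k 0 = set_val u, k 1 = e & lower_to e = tau k].
Proof.
move=> le; rewrite /lower_to; case: pselect => // le' /=.
by case: cid => k [ik k0 k1] /=; exists k.
Qed.

Lemma lower_path k : path_in lower k ->
  lower_class (lower_to (k 0) * tau k * (lower_to (k 1%R))^-1)%g.
Proof.
move=> ik; have [ck Lk] := ik.
have L0 : lower (k 0) by apply: Lk; lra.
have L1 : lower (k 1) by apply: Lk; lra.
have [k0 [i0 k00 k01 ->]] := lower_toP L0.
have [k1 [i1 k10 k11 ->]] := lower_toP L1.
have ir := path_in_rev i1.
have sub := path_in_sub lower_sub.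
have e1 : concat k0 k 1 = k1 (1 - 0) by rewrite concat1 subr0 k11.
have i0k : path_in lower (concat k0 k) by exact: path_in_concat.
exists (concat (concat k0 k) (fun t => k1 (1 - t))); split.
- exact: path_in_concat.
- by rewrite !concat0.
- by rewrite concat1 subrr.
- rewrite (functor_concat ptau) ?(functor_concat ptau) ?(functor_rev ptau) //; exact: sub.
Qed.

End LowerHalf.

(** * Crossing the hyperplane [im1 = 0] *)

Section Generation.
Variables (R : realType) (s : seq R) (B : seq (R * R)) (u : model s B).
Hypothesis u_lower : im1 (set_val u) < 0.
Variables (eta : R -> R) (rho : R * R -> R).
Hypotheses (ceta : continuous eta) (crho : continuous rho).
Hypothesis rhoE : forall x cd, cd \in B -> rho (x, value cd x) = eta x * cd.1.
Variable x0 : R.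
Hypotheses (eta_x0 : 0 < eta x0) (x0_min : forall a, a \in s -> x0 < a).
Local Notation E := (R4 R).
Local Notation M := (model s B).
Local Notation G := (pi1 R u).
Local Notation tau := (path_pi1 u).
Local Notation ptau := (path_pi1_functor R u).
Local Notation lower := (lower s B).
Local Notation upper := (upper s B).
Local Notation lower_to := (lower_to u_lower).
Local Notation flow := (flow eta rho).
Implicit Types (e : E) (k : R -> E).

(** Moves a point within its own real line until [z = x0 + i], from where the flow can take it
    down. *)
Definition slide e t : E := on_line (re1 e + t * (x0 - re1 e))
  (im1 e + t * (1 - im1 e)) (line_of e).

Lemma slide0 e : im1 e != 0 -> slide e 0 = e.
Proof. by move=> y0; rewrite /slide !mul0r !addr0 on_line_of. Qed.

Lemma slide_upper e t : upper e -> 0 <= t <= 1 -> upper (slide e t).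
Proof.
move=> [Me ye] t01; have yt : 0 < im1 e + t * (1 - im1 e) by exact: lerp_gt.
have ye0 := gt_eqF ye.
split=> //; apply/model_on_line; first by rewrite gt_eqF.
by apply/(@model_on_line _ s _ (re1 e) (im1 e)); rewrite ?ye0 ?on_line_of ?ye0.
Qed.

Lemma cts_slide (Z : topologicalType) (f : Z -> E) (t : Z -> R) : continuous f ->
  continuous t -> (forall z, im1 (f z) != 0) -> continuous (fun z => slide (f z) (t z)).
Proof.
move=> cf ct f0; have ci : continuous (fun z => (im1 (f z))^-1).
  by apply: cts_inv => //; exact: cts_im1.
by rewrite /slide /on_line /value /line_of /slope /=; cts4.
Qed.

(** The factor [2 / eta x0] makes a point over [x0] go from [im1 = 1] to [im1 = -1] in unit time; as
    [x0] is to the left of [s], it meets no line [z = a]. *)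
Definition fall e t : E := flow (- (2 * t / eta x0)) e.
Definition landing e : E := fall (slide e 1) 1.

Lemma re1_slide e : re1 (slide e 1) = x0.
Proof. by rewrite /slide /on_line mk4E mul1r addrC subrK. Qed.

Lemma im1_slide e : im1 (slide e 1) = 1.
Proof. by rewrite /slide /on_line mk4E mul1r addrC subrK. Qed.

Lemma fall_model e t : M e -> re1 e = x0 -> M (fall e t).
Proof.
move=> Me ex; apply: flow_model => //; first exact: model_sub Me.
by move=> a /x0_min + ea; rewrite -ea ex ltxx.
Qed.

Lemma fall0 e : fall e 0 = e.
Proof. by rewrite /fall mulr0 mul0r oppr0 flow0. Qed.

Lemma im1_fall e t : re1 e = x0 -> im1 (fall e t) = im1 e - 2 * t.
Proof.
by move=> ex; rewrite /fall /flow mk4E ex; field; rewrite gt_eqF.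
Qed.

Lemma landing_lower e : upper e -> lower (landing e).
Proof.
move=> Ue; have [Me ye] := @slide_upper e 1 Ue ltac:(lra).
split; first by apply: fall_model; rewrite ?re1_slide.
by rewrite im1_fall ?re1_slide ?im1_slide //; lra.
Qed.

(** The reference path to an upper point: through [lower] to its landing point, then back along the
    fall and the slide. *)
Definition upper_to e : G :=
  (lower_to (landing e) * (tau (slide e) * tau (fall (slide e 1%R)))^-1)%g.

(** Slide and fall sweep out two squares that carry [k] to a path in [lower]; their vertical sides
    cancel against the reference classes. *)
Lemma upper_path k : path_in upper k ->
  lower_class (upper_to (k 0%R) * tau k * (upper_to (k 1%R))^-1)%g.
Proof.
(* The slide is continuous only where [im1] does not vanish, which is known for [k] on [0, 1] but is
   needed on all of [R]. *)
move=> [ck Uk]; pose k' t := k (clamp01 t).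
have k'E t : 0 <= t <= 1 -> k' t = k t by move=> t01; rewrite /k' clamp01K.
have Uk' t : upper (k' t) by apply/Uk/clamp01P.
have ck' : continuous k' by have cc := @cts_clamp01 R; rewrite /k'; cts.
have k'0 t : im1 (k' t) != 0 by case: (Uk' t) => _ ?; rewrite gt_eqF.
have -> : tau k = tau k' by apply: (functor_ext ptau) => t t01; rewrite k'E.
rewrite -!k'E; [|lra|lra].
pose k1 t := slide (k' t) 1; pose k2 t := landing (k' t).
have ck1 : continuous k1 by apply: cts_slide; cts.
have ck2 : continuous k2 by rewrite /k2 /landing /fall; apply: cts_flow => //; cts.
have sq1 : (tau k' * tau (slide (k' 1%R)) = tau (slide (k' 0%R)) * tau k1)%g.
  apply: (functor_square (K := fun st : R * R => slide (k' st.1) st.2) ptau) => //.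
  - by apply: cts_slide => //; cts.
  - by move=> t t' t01 t'01 /=; apply: upper_sub; exact: slide_upper.
  - by move=> t _ /=; rewrite slide0.
have sq2 : (tau k1 * tau (fall (slide (k' 1%R) 1%R)) = tau (fall (slide (k' 0%R) 1%R)) * tau k2)%g.
  apply: (functor_square (K := fun st : R * R => fall (slide (k' st.1) 1) st.2) ptau) => //.
  - rewrite /fall; apply: cts_flow; cts; last by apply: cts_slide => //; cts.
  - move=> t t' t01 t'01 /=; apply: fall_model; rewrite ?re1_slide //.
    by apply: upper_sub; apply: slide_upper => //; lra.
  - by move=> t _ /=; rewrite fall0.
have ik2 : path_in lower k2 by split; [exact: ck2|move=> t _; exact: landing_lower].
suff -> : (upper_to (k' 0%R) * tau k' * (upper_to (k' 1%R))^-1)%g =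
  (lower_to (k2 0%R) * tau k2 * (lower_to (k2 1%R))^-1)%g by exact: lower_path.
rewrite /upper_to.
have e1 : tau k' = (tau (slide (k' 0%R)) * tau k1 * (tau (slide (k' 1%R)))^-1)%g by rewrite -sq1 mulgK.
have e2 : tau k1 = (tau (fall (slide (k' 0%R) 1%R)) * tau k2 * (tau (fall (slide (k' 1%R) 1%R)))^-1)%g.
  by rewrite -sq2 mulgK.
rewrite e1 e2 {e1 e2 sq1 sq2}.
move: (tau (slide _)) (tau (slide _)) (tau (fall _)) (tau (fall _)) => t0 t1 f0 f1.
by rewrite !invgM !invgK !mulgA !(mulgVK, mulgK).
Qed.

(* A subgroup containing the lower classes is everything as soon as it lets
   paths cross the hyperplane [im1 = 0]. *)
Variable S : G -> Prop.
Hypotheses (SM : forall v w, S v -> S w -> S (v * w)%g)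
           (SV : forall v, S v -> S (v^-1)%g)
           (Slow : forall v, lower_class v -> S v).

Definition crosses (C : set E) := exists e e',
  [/\ C e, C e', im1 e < 0, 0 < im1 e' & S (lower_to e * tau (seg e e') * (upper_to e')^-1)%g].

Lemma convex_lower C : convex_set C -> convex_set (C `&` [set e : E | im1 e < 0]).
Proof. by move=> cC e e' t [Ce ye] [Ce' ye'] t01; split; [exact: cC|exact: lerp_lt]. Qed.

Lemma convex_upper C : convex_set C -> convex_set (C `&` [set e : E | 0 < im1 e]).
Proof. by move=> cC e e' t [Ce ye] [Ce' ye'] t01; split; [exact: cC|exact: lerp_gt]. Qed.

(** Two crossings in the convex set [C] differ by a segment in [lower] and one in [upper], both
    harmless for [S]. *)
Lemma crosses_all C : convex_set C -> C `<=` M -> crosses C -> forall e e',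
  C e -> C e' -> im1 e < 0 -> 0 < im1 e' ->
  S (lower_to e * tau (seg e e') * (upper_to e')^-1)%g.
Proof.
move=> cC CM [f [f' [Cf Cf' yf yf' Sf]]] e e' Ce Ce' ye ye'.
have l1 : path_in lower (seg e f).
  apply: path_in_sub (path_in_seg (convex_lower cC) _ _) => //.
  by move=> x [/CM].
have l2 : path_in upper (seg f' e').
  apply: path_in_sub (path_in_seg (convex_upper cC) _ _) => //.
  by move=> x [/CM].
have S1 := Slow (lower_path u_lower l1); have S2 := Slow (upper_path l2).
have <- := functor_seg_trans ptau cC CM Ce Cf Ce'.
have <- := functor_seg_trans ptau cC CM Cf Cf' Ce'.
have := SM S1 (SM Sf S2); rewrite !seg0 !seg1.
by move: (lower_to f) (upper_to f') => lf uf; rewrite !mulgA !mulgVK.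
Qed.

(** Passes the crossing property on from [C] to any set that meets it on both sides of the
    hyperplane; this is how it spreads through the complement. *)
Lemma crosses_inter C C' e e' : convex_set C -> C `<=` M -> crosses C ->
  C e -> C e' -> im1 e < 0 -> 0 < im1 e' -> C' e -> C' e' -> crosses C'.
Proof.
by move=> cC CM crC Ce Ce' ye ye' C'e C'e'; exists e, e'; split=> //; exact: crosses_all crC _ _ _ _ _ _.
Qed.

(* Below and above the line arrangement: [|im2|] dominates every [c * im1]. *)
Variable lam : R.
Hypothesis lamP : forall cd, cd \in B -> `|cd.1| <= lam.

Definition above (x1 x2 : R) : set E :=
  [set e | x1 <= re1 e <= x2 /\ lam * `|im1 e| < im2 e].

Definition below (x : R) : set E :=
  [set e | re1 e = x /\ im2 e < - (lam * `|im1 e|)].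

Lemma lerp_norm_lt (y y' q q' t : R) : 0 <= t <= 1 -> 0 <= lam ->
  lam * `|y| < q -> lam * `|y'| < q' -> lam * `|y + t * (y' - y)| < q + t * (q' - q).
Proof.
move=> t01 l0 h h'.
have : `|y + t * (y' - y)| <= (1 - t) * `|y| + t * `|y'|.
  rewrite (_ : y + _ = (1 - t) * y + t * y'); last by ring.
  by rewrite (le_trans (ler_normD _ _)) // !normrM (@ger0_norm _ (1 - t)) ?(@ger0_norm _ t) //; lra.
move=> /(ler_wpM2l l0) /le_lt_trans; apply.
rewrite (_ : lam * _ = lam * `|y| + t * (lam * `|y'| - lam * `|y|)); last by ring.
have [t0|t0] := eqVneq t 0; first by rewrite t0 !mul0r !addr0.
have tp : 0 < t by rewrite lt_neqAle eq_sym t0; lra.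
nra.
Qed.

Lemma convex_above x1 x2 : 0 <= lam -> convex_set (above x1 x2).
Proof.
move=> l0 e e' t [xe he] [xe' he'] t01; rewrite /seg; split; rewrite !mk4E.
  by apply/andP; split; nra.
exact: lerp_norm_lt.
Qed.

Lemma convex_below x : 0 <= lam -> convex_set (below x).
Proof.
move=> l0 e e' t [xe he] [xe' he'] t01; rewrite /seg; split; rewrite !mk4E.
  by rewrite xe xe'; ring.
have h : lam * `|im1 e| < - im2 e by rewrite ltrNr.
have h' : lam * `|im1 e'| < - im2 e' by rewrite ltrNr.
have := lerp_norm_lt t01 l0 h h'; lra.
Qed.

Lemma off_lines e : lam * `|im1 e| < `|im2 e| -> forall cd, cd \in B ->
  ~ (re2 e = value cd (re1 e) /\ im2 e = cd.1 * im1 e).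
Proof.
move=> h cd /lamP cdl [_ e2]; move: h; rewrite e2 normrM; apply/negP; rewrite -leNgt.
by rewrite ler_wpM2r.
Qed.

Lemma above_model x1 x2 : (forall a, a \in s -> ~ (x1 <= a <= x2)) -> above x1 x2 `<=` M.
Proof.
move=> sx e [xe he]; split; first by move=> a /sx + [ea _]; rewrite -ea.
by apply: off_lines; apply: (lt_le_trans he); exact: ler_norm.
Qed.

Lemma below_model x : x \notin s -> below x `<=` M.
Proof.
move=> sx e [xe he]; split; first by move=> a sa [ea _]; move: sx; rewrite -xe ea sa.
by apply: off_lines; have := ler_norm (- im2 e); rewrite normrN; lra.
Qed.

Hypothesis lam0 : 0 <= lam.

Definition crosses_at x := crosses (above x x).

(** The part above the arrangement over an interval free of points of [s] is convex, so one crossing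
    in it serves both ends. *)
Lemma crosses_at_strip x1 x2 : (forall a, a \in s -> ~ (Num.min x1 x2 <= a <= Num.max x1 x2)) ->
  crosses_at x1 -> crosses_at x2.
Proof.
move=> sx [e [e' [[xe he] [xe' he'] ye ye' Se]]].
set x := Num.min x1 x2 in sx; set x' := Num.max x1 x2 in sx.
have cC := @convex_above x x' lam0; have CM := above_model sx.
have xx1 : x <= x1 <= x' by rewrite ge_min lexx le_max lexx.
have xx2 : x <= x2 <= x' by rewrite ge_min lexx orbT le_max lexx orbT.
have cr : crosses (above x x').
  by exists e, e'; split=> //; split=> //; [have -> : re1 e = x1 by lra|have -> : re1 e' = x1 by lra].
have i2 y : `|y| = 1 -> above x x' (mk4 x2 y 0 (lam + 1)) /\ above x2 x2 (mk4 x2 y 0 (lam + 1)).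
  by move=> y1; split; split; rewrite !mk4E ?lexx ?y1 ?xx2 //; lra.
have [a1 a2] := i2 (-1) ltac:(by rewrite normrN1).
have [b1 b2] := i2 1 (normr1 _).
by apply: (crosses_inter cC CM cr a1 b1) => //; rewrite mk4E; lra.
Qed.

(* Along the vertical flow at [x0], the definition of [upper_to] makes the
   crossing trivial. *)
Lemma crosses_at_base : crosses_at x0.
Proof.
have sx : forall a, a \in s -> ~ (x0 <= a <= x0) by move=> a /x0_min; lra.
have cC := @convex_above x0 x0 lam0; have CM := above_model sx.
(* During the fall [im1] stays in [-1, 1] and [im2] changes by at most the absolute value here, so
   with this height the fall stays above the arrangement. *)
pose q := lam + `|2 / eta x0 * rho (x0, 0)| + 1.
pose e := mk4 x0 1 0 q.
have e1 : above x0 x0 e by split; rewrite !mk4E ?lexx ?normr1 //; rewrite /q; have := normr_ge0 (2 / eta x0 * rho (x0, 0)); lra.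
have Ue : upper e by split; [exact: CM|rewrite mk4E; lra].
(* The point [e] already has [z = x0 + i], so [upper_to e] consists of the landing class and the
   reversed fall only. *)
have slE t : slide e t = e.
  rewrite /slide /on_line /value /line_of /slope !mk4E /= /e invr1 !subrr !mulr0 !addr0 !mulr1.
  by congr mk4; ring.
have fa t : 0 <= t <= 1 -> above x0 x0 (fall e t).
  move=> t01; rewrite /fall /flow; split; rewrite !mk4E ?lexx //.
  have -> : 1 + - (2 * t / eta x0) * eta x0 = 1 - 2 * t by field; rewrite gt_eqF.
  have h1 : lam * `|1 - 2 * t| <= lam by rewrite ler_piMr // ler_norml; lra.
  apply: (le_lt_trans h1); rewrite /q (_ : - _ * _ = - (t * (2 / eta x0 * rho (x0, 0)))); last by ring.
  have h2 : t * (2 / eta x0 * rho (x0, 0)) <= `|2 / eta x0 * rho (x0, 0)|.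
    apply: (le_trans (ler_norm _)); rewrite normrM ler_piMl // ger0_norm; lra.
  by lra.
have dE : landing e = fall e 1 by rewrite /landing slE.
exists (landing e), e; split=> //.
- by rewrite dE; apply: fa; lra.
- by have [] := landing_lower Ue.
have -> : tau (seg (landing e) e) = (tau (fall e))^-1%g.
  have pf : path_in (above x0 x0) (fall e).
    by split; [rewrite /fall; apply: cts_flow; cts|exact: fa].
  rewrite -(functor_rev ptau); last exact: path_in_sub pf.
  apply: (functor_convex ptau cC CM); rewrite ?seg0 ?seg1 ?subr0 ?subrr ?fall0 ?dE //.
    by apply: path_in_seg => //; apply: fa; lra.
  exact: path_in_rev.
rewrite /upper_to slE (_ : tau (slide e) = 1%g); last first.
  by apply: (functor_cst ptau (e := e)); [exact: CM|move=> t _; exact: slE].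
rewrite mul1g !invgM !invgK mulgA mulgVK mulgV; apply: Slow; exact: lower_class1.
Qed.

End Generation.

Section SubPath.
Variables (R : realType) (E : topologicalType) (A : set E) (H : groupType).
Variables (F : (R -> E) -> H) (pF : path_functor A F).

Definition subpath (k : R -> E) (a b t : R) : E := k (a + t * (b - a)).

Lemma functor_subpath k a b c : path_in A k -> 0 <= a -> a <= b -> b <= c -> c <= 1 ->
  F (subpath k a c) = (F (subpath k a b) * F (subpath k b c))%g.
Proof.
move=> [ck Ak] a0 ab bc c1.
rewrite (functor_square (K := fun st : R * R => k (a + st.1 * ((b - a) + st.2 * (c - b))))
  (l := cst (k a)) (t := subpath k a c) pF).
- by rewrite (@functor_cst _ _ _ _ _ pF (cst (k a)) (k a)) ?mul1g //; apply: Ak; lra.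
- by cts.
- move=> s t s01 t01 /=; apply: Ak.
  have : 0 <= (b - a) + t * (c - b) <= c - a by nra.
  by move: (b - a + _) => d d01; nra.
- by move=> s _ /=; rewrite mul0r addr0.
- by move=> s _ /=; rewrite /subpath; congr k; ring.
- by move=> s _ /=; rewrite mul0r addr0.
- by move=> s _ /=; rewrite /subpath; congr k; ring.
Qed.

End SubPath.

Section GenerationEnd.
Variables (R : realType) (s : seq R) (B : seq (R * R)) (u : model s B).
Hypothesis u_lower : im1 (set_val u) < 0.
Variables (eta : R -> R) (rho : R * R -> R).
Hypotheses (ceta : continuous eta) (crho : continuous rho).
Hypothesis rhoE : forall x cd, cd \in B -> rho (x, value cd x) = eta x * cd.1.
Variable x0 : R.
Hypotheses (eta_x0 : 0 < eta x0) (x0_min : forall a, a \in s -> x0 < a).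
Local Notation E := (R4 R).
Local Notation M := (model s B).
Local Notation G := (pi1 R u).
Local Notation tau := (path_pi1 u).
Local Notation ptau := (path_pi1_functor R u).
Local Notation lower := (lower s B).
Local Notation upper := (upper s B).
Local Notation lower_to := (lower_to u_lower).
Local Notation upper_to := (upper_to u_lower eta rho x0).
Implicit Types (e : E) (k : R -> E).
Variable S : G -> Prop.
Hypotheses (SM : forall v w, S v -> S w -> S (v * w)%g)
           (SV : forall v, S v -> S (v^-1)%g)
           (Slow : forall v, lower_class v -> S v).
Variable lam : R.
Hypothesis lamP : forall cd, cd \in B -> `|cd.1| <= lam.
Hypothesis lam0 : 0 <= lam.
Local Notation crosses := (crosses u_lower eta rho x0 S).
Hypothesis cross : forall x, x \notin s -> crosses (above lam x x).

(** The points at [im1 = d] and [im1 = - d], raised by [r / 2] in [im2], are in the box and also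
    above the arrangement, because [d (lam + 1) = r / 2]. *)
Lemma crosses_box_ge0 e (r : R) : M e -> im1 e = 0 -> 0 <= im2 e -> 0 < r ->
  box e r `<=` M -> crosses (box e r).
Proof.
move=> Me y0 q0 r0 bM; have xs : re1 e \notin s.
  by apply/negP => xs; case: Me => /(_ _ xs) + _; apply.
have l0 := lam0; pose d := r / 2 / (lam + 1).
have d0 : 0 < d by rewrite /d; apply: divr_gt0; lra.
have dE : d * lam + d = r / 2 by rewrite /d; field; rewrite gt_eqF //; lra.
have dl : 0 <= d * lam by rewrite mulr_ge0 // ltW.
have pt y : `|y| = d -> let e' := mk4 (re1 e) y (re2 e) (im2 e + r / 2) in
    above lam (re1 e) (re1 e) e' /\ box e r e'.
  move=> yd e'; rewrite /e'; split.
    by split; rewrite !mk4E ?lexx // yd; lra.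
  split; rewrite !mk4E ?subrr ?normr0 // ?y0 ?subr0 ?yd //; first by lra.
  by rewrite (addrC (im2 e)) addrK ger0_norm; lra.
have yd : `|d| = d by rewrite ger0_norm // ltW.
have yd' : `|- d| = d by rewrite normrN.
have [a1 b1] := pt _ yd; have [a2 b2] := pt _ yd'.
have aM : above lam (re1 e) (re1 e) `<=` M.
  apply: above_model => // a sa xa; have ax : re1 e = a by lra.
  by move: xs; rewrite ax sa.
apply: (crosses_inter ceta crho rhoE eta_x0 x0_min SM Slow
  (@convex_above _ _ _ _ lam0) aM (cross xs) a2 a1) => //; rewrite mk4E //; lra.
Qed.

(** A point of the hyperplane with [im2 = 0] and [re2 = p] beyond all graphs has a clear box, and
    this box reaches both above and below the arrangement. *)
Lemma crosses_below x : x \notin s -> crosses (below lam x).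
Proof.
move=> xs; have [p pB] := seq_upper_bound [seq value cd x | cd <- B].
pose e := mk4 x 0 p 0.
have Me : M e.
  split=> [a sa|cd Bcd]; rewrite /e !mk4E => -[e1 e2].
    by move: xs; rewrite e1 sa.
  by have := pB _ (map_f (fun cd => value cd x) Bcd); rewrite -e1 ltxx.
have [r r0 bM] := near_box (model_open Me).
have cr : crosses (box e r) by apply: crosses_box_ge0 => //; rewrite mk4E.
have l0 := lam0; pose d := r / 2 / (lam + 1).
have d0 : 0 < d by rewrite /d; apply: divr_gt0; lra.
have dE : d * lam + d = r / 2 by rewrite /d; field; rewrite gt_eqF //; lra.
have dl : 0 <= d * lam by rewrite mulr_ge0 // ltW.
have pt y : `|y| = d -> let e' := mk4 x y p (- (r / 2)) in below lam x e' /\ box e r e'.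
  move=> yd e'; rewrite /e'; split; first by split; rewrite !mk4E // yd; lra.
  split; rewrite /e !mk4E ?subrr ?normr0 // subr0 ?yd ?normrN ?ger0_norm; lra.
have yd : `|d| = d by rewrite ger0_norm // ltW.
have yd' : `|- d| = d by rewrite normrN.
have [a1 b1] := pt _ yd; have [a2 b2] := pt _ yd'.
apply: (crosses_inter ceta crho rhoE eta_x0 x0_min SM Slow
  (@convex_box _ e r) bM cr b2 b1) => //; rewrite mk4E //; lra.
Qed.

Lemma crosses_box e (r : R) : M e -> im1 e = 0 -> 0 < r -> box e r `<=` M -> crosses (box e r).
Proof.
move=> Me y0 r0 bM; have [q0|q0] := leP 0 (im2 e); first exact: crosses_box_ge0.
have xs : re1 e \notin s.
  by apply/negP => xs; case: Me => /(_ _ xs) + _; apply.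
have l0 := lam0; pose d := r / 2 / (lam + 1).
have d0 : 0 < d by rewrite /d; apply: divr_gt0; lra.
have dE : d * lam + d = r / 2 by rewrite /d; field; rewrite gt_eqF //; lra.
have dl : 0 <= d * lam by rewrite mulr_ge0 // ltW.
have pt y : `|y| = d -> let e' := mk4 (re1 e) y (re2 e) (im2 e - r / 2) in
    below lam (re1 e) e' /\ box e r e'.
  move=> yd e'; rewrite /e'; split; first by split; rewrite !mk4E // yd; lra.
  split; rewrite !mk4E ?subrr ?normr0 // ?y0 ?subr0 ?yd //; first by lra.
  by rewrite (addrC (im2 e)) addrK normrN ger0_norm; lra.
have yd : `|d| = d by rewrite ger0_norm // ltW.
have yd' : `|- d| = d by rewrite normrN.
have [a1 b1] := pt _ yd; have [a2 b2] := pt _ yd'.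
have cC := convex_below (x := re1 e) lam0.
apply: (crosses_inter ceta crho rhoE eta_x0 x0_min SM Slow
  cC (below_model lamP xs) (crosses_below xs) a2 a1) => //; rewrite mk4E //; lra.
Qed.

Definition lowered e (r : R) : E := mk4 (re1 e) (im1 e - r) (re2 e) (im2 e).

Lemma hyperplane_radius e : exists r : R, 0 < r /\ (M e -> box e r `<=` M).
Proof.
have [Me|nMe] := pselect (M e); last by exists 1; split=> //; lra.
by have [r r0 bM] := near_box (model_open Me); exists r.
Qed.

Definition clear_radius e := sval (cid (hyperplane_radius e)).

Lemma clear_radius_gt0 e : 0 < clear_radius e.
Proof. by rewrite /clear_radius; case: cid => r []. Qed.

Lemma clear_radius_box e : M e -> box e (clear_radius e) `<=` M.
Proof. by rewrite /clear_radius; case: cid => r []. Qed.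

Lemma lowered_box e (r d : R) : 0 <= d -> d < r -> box e r (lowered e d).
Proof.
move=> d0 dr; rewrite /lowered; split; rewrite !mk4E ?subrr ?normr0 //; try lra.
by rewrite addrC addKr normrN ger0_norm.
Qed.

(** Reference classes for the whole complement; a point of the hyperplane is reached from below,
    inside its own clear box. *)
Definition class_to e : G :=
  if im1 e < 0 then lower_to e else if 0 < im1 e then upper_to e
  else (lower_to (lowered e (clear_radius e / 2)) * tau (seg (lowered e (clear_radius e / 2)) e))%g.

Definition joins e v e' := S (class_to e * v * (class_to e')^-1)%g.

Lemma joins_trans e1 e2 e3 v w : joins e1 v e2 -> joins e2 w e3 -> joins e1 (v * w)%g e3.
Proof.
move=> h1 h2; have := SM h1 h2; rewrite /joins.
move: (class_to e1) (class_to e2) (class_to e3) => c1 c2 c3.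
by rewrite !mulgA mulgVK.
Qed.

Lemma joins_sym e1 e2 v : joins e1 v e2 -> joins e2 (v^-1)%g e1.
Proof.
move=> /SV; rewrite /joins; move: (class_to e1) (class_to e2) => c1 c2.
by rewrite !invgM invgK !mulgA.
Qed.

Lemma joins_lower k : path_in lower k -> joins (k 0) (tau k) (k 1).
Proof.
move=> ik; have [ck Lk] := ik; rewrite /joins /class_to.
have [_ ->] : lower (k 0) by apply: Lk; lra.
have [_ ->] : lower (k 1) by apply: Lk; lra.
by apply: Slow; exact: lower_path.
Qed.

Lemma joins_upper k : path_in upper k -> joins (k 0) (tau k) (k 1).
Proof.
move=> ik; have [ck Lk] := ik; rewrite /joins /class_to.
have [_ y0] : upper (k 0) by apply: Lk; lra.
have [_ y1] : upper (k 1) by apply: Lk; lra.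
rewrite !ltNge !(ltW y0) !(ltW y1) /= !leNgt y0 y1 /=.
by apply: Slow; exact: upper_path.
Qed.

Lemma joins_lower_seg e e' : path_in lower (seg e e') -> joins e (tau (seg e e')) e'.
Proof. by move=> /joins_lower; rewrite seg0 seg1. Qed.

Lemma class_to_lower e : im1 e < 0 -> class_to e = lower_to e.
Proof. by rewrite /class_to => ->. Qed.

Lemma class_to_hyperplane e : im1 e = 0 -> class_to e =
  (lower_to (lowered e (clear_radius e / 2)) * tau (seg (lowered e (clear_radius e / 2)) e))%g.
Proof. by rewrite /class_to => ->; rewrite ltxx. Qed.

Lemma convex_box_lower e r : convex_set (box e r `&` [set e' : E | im1 e' < 0]).
Proof. exact/convex_lower/convex_box. Qed.

Lemma box_lower e r : box e r `<=` M -> box e r `&` [set e' : E | im1 e' < 0] `<=` lower.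
Proof. by move=> bM e' [/bM]. Qed.

Lemma joins_box e (r : R) m : M e -> im1 e = 0 -> 0 < r -> box e r `<=` M -> box e r m ->
  joins m (tau (seg m (lowered e (r / 2)))) (lowered e (r / 2)).
Proof.
move=> Me y0 r0 bM bm; set b := lowered e (r / 2).
have bb : box e r b by apply: lowered_box; lra.
have yb : im1 b < 0 by rewrite /b /lowered mk4E; lra.
have [ym|ym|ym] := ltgtP (im1 m) 0.
- apply: joins_lower_seg; apply: path_in_sub (box_lower bM) _.
  by apply: path_in_seg => //; exact: convex_box_lower.
- rewrite /joins /class_to !ltNge (ltW ym) /= !leNgt ym yb /=.
  have := SV (crosses_all ceta crho rhoE eta_x0 x0_min SM Slow
    (@convex_box _ e r) bM (crosses_box Me y0 r0 bM) bb bm yb ym).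
  have <- : ((tau (seg b m))^-1 = tau (seg m b))%g.
    apply: (mulgI (tau (seg b m))); rewrite mulgV.
    rewrite (functor_seg_trans ptau (@convex_box _ e r) bM bb bm bb).
    by rewrite (functor_seg_refl ptau) //; exact: bM.
  by move: (lower_to b) (upper_to m) => lb um; rewrite !invgM !invgK !mulgA.
- pose h := clear_radius m / 2; pose m' := lowered m h.
  have Mm := bM _ bm; have h0 : 0 < h by rewrite divr_gt0 // clear_radius_gt0.
  have hr : h < clear_radius m by have := clear_radius_gt0 m; rewrite /h; lra.
  (* The reference path of [m] uses the box of [m], the conclusion the box of [e]; for this [d] the
     point [lowered m d] lies in both. *)
  have [d d0 [dh bd]] : exists2 d, 0 < d & d <= h /\ box e r (lowered m d).
    have [b1 b2 b3 b4] := bm; move: b2; rewrite ym y0 subrr normr0 => _.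
    exists (Num.min h (r / 2)); first by rewrite lt_min h0; lra.
    have md : 0 < Num.min h (r / 2) by rewrite lt_min h0; lra.
    have mr : Num.min h (r / 2) <= r / 2 by rewrite ge_min lexx orbT.
    split; first by rewrite ge_min lexx.
    by rewrite /lowered; split; rewrite !mk4E // ym y0 subr0 sub0r normrN gtr0_norm //; lra.
  pose m2 := lowered m d.
  have rM := clear_radius_box Mm.
  have c1 : box m (clear_radius m) m' by apply: lowered_box => //; exact: ltW.
  have c2 : box m (clear_radius m) m2 by apply: lowered_box; lra.
  have c3 : box m (clear_radius m) m by apply: box_center; exact: clear_radius_gt0.
  have E1 : tau (seg m' m) = (tau (seg m' m2) * tau (seg m2 m))%g.
    exact/esym/(functor_seg_trans ptau (@convex_box _ m (clear_radius m)) rM c1 c2 c3).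
  have E2 : tau (seg m2 b) = (tau (seg m2 m) * tau (seg m b))%g.
    exact/esym/(functor_seg_trans ptau (@convex_box _ e r) bM bd bm bb).
  have y1 : im1 m' < 0 by rewrite /m' /lowered mk4E; lra.
  have y2 : im1 m2 < 0 by rewrite /m2 /lowered mk4E; lra.
  have p1 : path_in lower (seg m' m2).
    by apply: path_in_sub (box_lower rM) _; apply: path_in_seg => //; exact: convex_box_lower.
  have p2 : path_in lower (seg m2 b).
    by apply: path_in_sub (box_lower bM) _; apply: path_in_seg => //; exact: convex_box_lower.
  have := joins_trans (joins_lower_seg p1) (joins_lower_seg p2).
  rewrite /joins (class_to_hyperplane ym) (class_to_lower y1) (class_to_lower yb).
  rewrite -/h -/m' E1 E2.
  move: (lower_to b) (lower_to m') (tau (seg m' m2)) (tau (seg m2 m)) (tau (seg m b)).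
  by move=> lb lm t1 t2 t3; rewrite !mulgA.
Qed.

Lemma joins_local k t : path_in M k -> 0 <= t <= 1 -> exists2 d, 0 < d &
  forall a b, 0 <= a -> b <= 1 -> t - d < a -> a <= t -> t <= b -> b < t + d ->
  joins (k a) (tau (subpath k a b)) (k b).
Proof.
move=> ik t01; have [ck Mk] := ik.
have sub P a b d : (forall t', `|t' - t| < d -> P (k t')) -> 0 <= a -> b <= 1 ->
    t - d < a -> a <= t -> t <= b -> b < t + d -> path_in (M `&` P) (subpath k a b).
  move=> Pd a0 b1 ta at' tb bt; split; first by rewrite /subpath; cts.
  have ab : a <= b by lra.
  move=> t' t'01; have abt : a <= a + t' * (b - a) <= b by nra.
  split; first by apply: Mk; lra.
  by apply: Pd; rewrite ltr_norml; lra.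
have s0 a b : subpath k a b 0 = k a by rewrite /subpath mul0r addr0.
have s1 a b : subpath k a b 1 = k b by rewrite /subpath mul1r addrC subrK.
have ci : continuous (fun t => im1 (k t)) by cts4.
have [y|y|y] := ltgtP (im1 (k t)) 0.
- have n : \forall t' \near t, im1 (k t') < 0 by exact: (ci t _ (lt_nbhsl y)).
  have [d d0 H] := near_real n; exists d => // a b a0 b1 ta at' tb bt.
  by rewrite -(s0 a b) -(s1 a b); apply: joins_lower; apply: (sub _ a b d).
- have n : \forall t' \near t, 0 < im1 (k t') by exact: (ci t _ (lt_nbhsr y)).
  have [d d0 H] := near_real n; exists d => // a b a0 b1 ta at' tb bt.
  by rewrite -(s0 a b) -(s1 a b); apply: joins_upper; apply: (sub _ a b d).
have Mt := Mk _ t01; have r0 := clear_radius_gt0 (k t); have bM := clear_radius_box Mt.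
have n : \forall t' \near t, box (k t) (clear_radius (k t)) (k t').
  exact: (ck t _ (box_near _ r0)).
have [d d0 H] := near_real n; exists d => // a b a0 b1 ta at' tb bt.
have [cs bs] := sub _ a b d H a0 b1 ta at' tb bt.
have ba : box (k t) (clear_radius (k t)) (k a) by apply: H; rewrite ltr_norml; lra.
have bb : box (k t) (clear_radius (k t)) (k b) by apply: H; rewrite ltr_norml; lra.
have bc : box (k t) (clear_radius (k t)) (lowered (k t) (clear_radius (k t) / 2)) by apply: lowered_box; lra.
have ja := joins_box Mt y r0 bM ba; have jb := joins_sym (joins_box Mt y r0 bM bb).
have := joins_trans ja jb.
have cC := @convex_box _ (k t) (clear_radius (k t)).
suff -> : tau (subpath k a b) = (tau (seg (k a) (lowered (k t) (clear_radius (k t) / 2))) *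
   (tau (seg (k b) (lowered (k t) (clear_radius (k t) / 2))))^-1)%g by [].
have -> : tau (subpath k a b) = tau (seg (k a) (k b)).
  apply: (functor_convex ptau cC bM); rewrite ?s0 ?s1 ?seg0 ?seg1 //.
    by split=> // t' /bs[].
  exact: path_in_seg.
by rewrite -(functor_seg_trans ptau cC bM ba bb bc) mulgK.
Qed.

(** Short pieces of a loop stay in one half or in a clear box, where [S] is known to absorb them,
    and [cousin] composes the pieces. *)
Theorem generation v : S v.
Proof.
have [k [ik k0 k1] <-] := path_pi1_surj v.
have : joins (k 0) (tau (subpath k 0 1)) (k 1).
  apply: (cousin (Q := fun a b => joins (k a) (tau (subpath k a b)) (k b))).
    move=> a b c a0 ab bc c1 h1 h2; rewrite (functor_subpath ptau ik a0 ab bc c1).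
    exact: joins_trans h1 h2.
  by move=> t t01; exact: joins_local.
have -> : tau (subpath k 0 1) = tau k.
  by apply: (functor_ext ptau) => t _; rewrite /subpath subr0 mulr1 add0r.
rewrite /joins k0 k1 /class_to u_lower => h.
(* The reference class at the base point need not be 1, but it comes from a loop in [lower] and so
   can be cancelled inside [S]. *)
have lu : lower_class (lower_to (set_val u)).
  have [l [il l0 l1 ->]] := lower_toP u_lower (lower_base u_lower).
  by exists l.
have := SM (SM (SV (Slow lu)) h) (Slow lu); move: (lower_to _) => w.
by rewrite !mulgA mulVg mul1g mulgVK.
Qed.

End GenerationEnd.

(** * Loops around the lines [z = a] *)

Section LoopsAroundLines.
Variables (R : realType) (s : seq R) (B : seq (R * R)) (u : model s B).
Hypothesis u_lower : im1 (set_val u) < 0.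
Variables (eta : R -> R) (rho : R * R -> R).
Hypotheses (ceta : continuous eta) (crho : continuous rho).
Hypothesis rhoE : forall x cd, cd \in B -> rho (x, value cd x) = eta x * cd.1.
Local Notation E := (R4 R).
Local Notation M := (model s B).
Local Notation G := (pi1 R u).
Local Notation tau := (path_pi1 u).
Local Notation ptau := (path_pi1_functor R u).
Local Notation lower := (lower s B).
Local Notation upper := (upper s B).
Local Notation flow := (flow eta rho).
Implicit Types (e : E) (k : R -> E).
Variable lam : R.
Hypothesis lamP : forall cd, cd \in B -> `|cd.1| <= lam.
Hypothesis lam0 : 0 <= lam.

Lemma isolated (a : R) : exists2 r, 0 < r &
  forall a', a' \in s -> `|a' - a| < r -> a' = a.
Proof.
elim: s => [|b t [r r0 IH]]; first by exists 1.
have [->|ba] := eqVneq b a.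
  by exists r => // a'; rewrite inE => /orP[/eqP->|/IH].
exists (Num.min r `|b - a|); first by rewrite lt_min r0 normr_gt0 subr_eq0.
move=> a'; rewrite inE lt_min => /orP[/eqP->|a't] /andP[h1 h2]; last exact: IH.
by move: h2; rewrite ltxx.
Qed.

(** The surface swept out from the line [cd] by the flow, with parameters [x] and [t]. Loops around
    [z = a] are drawn on it, and varying [cd] outside [B] moves the whole surface. *)
Definition around (cd : R * R) (x t : R) : E := flow t (on_line x (-1) cd).

Lemma aroundE cd x t : around cd x t = mk4 x (-1 + t * eta x) (value cd x)
  (- cd.1 + t * rho (x, value cd x)).
Proof. by rewrite /around /flow /on_line !mk4E mulrN1. Qed.

Lemma cts_around (Z : topologicalType) (cd : Z -> R * R) (x t : Z -> R) :
  continuous cd -> continuous x -> continuous t ->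
  continuous (fun z => around (cd z) (x z) (t z)).
Proof.
by move=> c1 c2 c3; rewrite /around /on_line /value; apply: cts_flow => //; cts4.
Qed.

Lemma around_model cd x t : cd \notin B ->
  (forall a, a \in s -> x = a -> -1 + t * eta a != 0) -> M (around cd x t).
Proof.
move=> cdB xs; apply: (@flow_model _ _ _ _ rhoE); last by rewrite /on_line !mk4E.
by apply/model_on_line => //; rewrite oppr_eq0 oner_eq0.
Qed.

(* The loop [n] is moved into one fibre, and the fibre is carried along the
   path [(x, t)] by the flow. *)
Lemma around_commute (x t : R -> R) (d : R -> R * R) : continuous x -> continuous t ->
  continuous d -> d 1 = d 0 -> (forall r, 0 <= r <= 1 -> d r \notin B) ->
  (forall r a, 0 <= r <= 1 -> a \in s -> x r = a -> -1 + t r * eta a != 0) ->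
  (tau (fun r => around (d r) (x 0%R) (t 0%R)) * tau (fun r => around (d 0%R) (x r) (t r)) =
   tau (fun r => around (d 0%R) (x r) (t r)) * tau (fun r => around (d r) (x 1%R) (t 1%R)))%g.
Proof.
move=> cx ct cd d1 dB xs.
apply: (functor_square (K := fun rs : R * R => around (d rs.1) (x rs.2) (t rs.2)) ptau).
- by apply: cts_around; cts.
- move=> r r' r01 r'01 /=; apply: around_model; first exact: dB.
  by move=> a sa; exact: xs.
- by [].
- by move=> r _ /=; rewrite d1.
- by [].
- by [].
Qed.

(** Contracting the half-plane factor of [lower] to [x - i] leaves a loop of real lines outside
    [B]. *)
Lemma lower_fiber n cd (x : R) : path_in lower n -> n 0 = on_line x (-1) cd ->
  n 1 = on_line x (-1) cd -> exists d : R -> R * R,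
  [/\ continuous d, d 0 = cd, d 1 = cd, forall r, d r \notin B &
      tau n = tau (fun r => around (d r) x 0)].
Proof.
move=> [cn Ln] n0 n1; pose n' r := n (clamp01 r).
have n'E r : 0 <= r <= 1 -> n' r = n r by move=> r01; rewrite /n' clamp01K.
have Ln' r : lower (n' r) by apply/Ln/clamp01P.
have cn' : continuous n' by have cc := @cts_clamp01 R; rewrite /n'; cts.
have n'0 r : im1 (n' r) != 0 by case: (Ln' r) => _ ?; rewrite lt_eqF.
have -> : tau n = tau n' by apply: (functor_ext ptau) => r r01; rewrite n'E.
have m1 : -1 != 0 :> R by rewrite oppr_eq0 oner_eq0.
have cl : continuous (fun r => line_of (n' r)).
  have ci : continuous (fun z => (im1 (n' z))^-1).
    by apply: cts_inv => //; exact: cts_im1.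
  by rewrite /line_of /slope; cts4.
have lB r : line_of (n' r) \notin B.
  apply/(@model_on_line _ s _ (re1 (n' r)) (im1 (n' r))) => //.
  by rewrite on_line_of //; case: (Ln' r).
have [e0 e1] : n' 0 = on_line x (-1) cd /\ n' 1 = on_line x (-1) cd.
  by rewrite !n'E ?n0 ?n1 //; lra.
exists (fun r => line_of (n' r)); split=> //.
- by rewrite e0 line_of_on_line.
- by rewrite e1 line_of_on_line.
apply: (functor_homotopic (K := fun rt : R * R => on_line
  (re1 (n' rt.1) + rt.2 * (x - re1 (n' rt.1)))
  (im1 (n' rt.1) + rt.2 * (-1 - im1 (n' rt.1))) (line_of (n' rt.1))) ptau).
- have cl1 : continuous (fun rt : R * R => line_of (n' rt.1)).
    by apply: (@cts_comp _ _ _ (fun rt : R * R => rt.1) _ cl); cts.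
  by rewrite /on_line /value; cts4.
- move=> r t r01 t01 /=; apply/model_on_line; last exact: lB.
  have [_ y] := Ln' r; rewrite lt_eqF //; apply: lerp_lt => //; lra.
- by move=> r _ /=; rewrite !mul0r !addr0 on_line_of.
- move=> r _ /=; rewrite /around flow0 !mul1r !(addrC _ (_ - _)) !subrK //.
- by move=> t _ /=; rewrite e0 e1 line_of_on_line // /on_line !mk4E !subrr !mulr0 !addr0.
Qed.

(* A loop around the line [z = a]: up along [kL], across [kT], and back down
   along [kR] and [kB], joined to the base point by [b]. *)
Record loop_around (a : R) := LoopAround {
  la_loop : R -> E; la_b : R -> E; la_L : R -> E; la_T : R -> E;
  la_R : R -> E; la_B : R -> E; la_l : R; la_r : R;
  la_in : loop_in u la_loop;
  la_sides : la_l < a < la_r;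
  la_alone : forall a', a' \in s -> la_l <= a' <= la_r -> a' = a;
  la_pb : path_in lower la_b; la_pT : path_in upper la_T; la_pB : path_in lower la_B;
  la_pL : path_in (above lam la_l la_l) la_L; la_pR : path_in (above lam la_r la_r) la_R;
  la_L0 : im1 (la_L 0) < 0; la_L1 : 0 < im1 (la_L 1);
  la_R0 : im1 (la_R 0) < 0; la_R1 : 0 < im1 (la_R 1);
  la_b0 : la_b 0 = set_val u; la_b1 : la_b 1 = la_L 0;
  la_T0 : la_T 0 = la_L 1; la_T1 : la_T 1 = la_R 1;
  la_B0 : la_B 0 = la_L 0; la_B1 : la_B 1 = la_R 0;
  la_functor : forall (H : groupType) (F : (R -> E) -> H), path_functor M F ->
    F la_loop = (F la_b * (F la_L * F la_T) * (F la_b * (F la_B * F la_R))^-1)%g;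
  la_trivial : forall (H : groupType) (F : (R -> E) -> H), path_functor (model [::] B) F ->
    F la_loop = 1%g;
  la_commute : forall v : G, lower_class v -> (v * tau la_loop = tau la_loop * v)%g }.

(* Near [a], a line of large slope is carried across [im1 = 0] by the flow
   while staying above the arrangement. *)
Lemma flow_window (a : R) : 0 < eta a -> exists (cd : R * R) (d T : R),
  [/\ 0 < d, 0 < T,
      forall a', a' \in s -> a - d <= a' <= a + d -> a' = a,
      forall x t, `|x - a| <= d -> 0 <= t <= T -> above lam x x (around cd x t) &
      forall x, `|x - a| <= d -> 0 < -1 + T * eta x].
Proof.
move=> ea; have [r1 r10 alone] := isolated a.
have n2 : \forall x \near a, eta a / 2 < eta x.
  have h : eta a / 2 < eta a by lra.
  exact: (@ceta a _ (lt_nbhsr h)).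
have n3 : \forall x \near a, eta x < 2 * eta a.
  have h : eta a < 2 * eta a by lra.
  exact: (@ceta a _ (lt_nbhsl h)).
have [r2 r20 eta2] := near_real (filterI n2 n3).
pose C := `|rho (a, 0)| + 1.
have cnr : continuous (fun xp => `|rho xp|) by cts.
have n4 : \forall xp \near (a, 0 : R), `|rho xp| < C.
  have h : `|rho (a, 0)| < C by rewrite /C; lra.
  exact: (cnr (a, 0) _ (lt_nbhsl h)).
have [r3 r30 rho3] := near_real2 n4.
(* The speed near [a] lies between [eta a / 2] and [2 * eta a], so in time [T] the value [im1] goes
   from -1 to a value between 1 and 7. *)
pose T := 4 / eta a.
have T0 : 0 < T by rewrite /T divr_gt0 //; lra.
have C0 : 0 < C by rewrite /C; have := normr_ge0 (rho (a, 0)); lra.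
have l0 := lam0; have TC : 0 < T * C by rewrite mulr_gt0.
(* The value [im2] starts at [K] and loses at most [T * C], while [lam * |im1|] is at most
   [7 * lam]. *)
pose K := T * C + 7 * lam + 1.
have K0 : 0 < K by rewrite /K; lra.
pose r := Num.min r1 (Num.min r2 r3).
have rr1 : r <= r1 by rewrite ge_min lexx.
have rr2 : r <= r2 by rewrite !ge_min lexx orbT.
have rr3 : r <= r3 by rewrite !ge_min lexx !orbT.
have r0 : 0 < r by rewrite !lt_min r10 r20.
(* Over [|x - a| <= d] the line has height at most [K d < r3], where the bound [C] on [rho]
   holds. *)
pose d := r / 2 / (K + 1).
have d0 : 0 < d by rewrite /d; apply: divr_gt0; lra.
have dE : d * K + d = r / 2 by rewrite /d; field; rewrite gt_eqF //; lra.
have dK : 0 < d * K by rewrite mulr_gt0.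
(* A line through [(a, 0)]. Its slope is negative because the flow starts at [im1 = -1], where [im2]
   is minus the slope. *)
pose cd : R * R := (- K, K * a).
have vE x : value cd x = - K * (x - a) by rewrite /value /cd /=; ring.
have eta_at x : `|x - a| <= d -> eta a / 2 < eta x < 2 * eta a.
  by move=> xa; have [|-> ->] := eta2 x _; lra.
have TE : T * eta a = 4 by rewrite /T mulfVK // gt_eqF.
have T2 x t : `|x - a| <= d -> 0 <= t <= T -> 0 <= t * eta x <= 8.
  by move=> /eta_at xa t01; nra.
have high x t : `|x - a| <= d -> 0 <= t <= T -> above lam x x (around cd x t).
  move=> xa t01; rewrite aroundE; split; rewrite !mk4E ?lexx //.
  have y1 : `|-1 + t * eta x| <= 7 by have := T2 x t xa t01; rewrite ler_norml; lra.
  have vb : `|value cd x - 0| < r3.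
    rewrite vE subr0 normrM normrN (gtr0_norm K0).
    have : K * `|x - a| <= K * d by rewrite ler_pM2l.
    by lra.
  have rb : `|rho (x, value cd x)| < C by apply: rho3 => //=; lra.
  have tr : t * `|rho (x, value cd x)| <= T * C.
    by have := normr_ge0 (rho (x, value cd x)); nra.
  have tr' : - (t * rho (x, value cd x)) <= t * `|rho (x, value cd x)|.
    by rewrite -mulrN ler_wpM2l //; [lra|rewrite -normrN; exact: ler_norm].
  have ly : lam * `|-1 + t * eta x| <= lam * 7 by rewrite ler_wpM2l.
  by rewrite /cd /= opprK /K; lra.
exists cd, d, T; split=> //.
- by move=> a' sa' h; apply: alone => //; rewrite ltr_norml; lra.
- by move=> x /eta_at xa; nra.
Qed.

Lemma loop_around_exists (a : R) : a \in s -> 0 < eta a -> exists l : loop_around a, True.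
Proof.
move=> sa ea; have [cd [d [T [d0 T0 alone' high above0]]]] := flow_window ea.
have l0 := lam0.
(* At time 0 the bound [high] says that the slope of [cd] exceeds [lam] in absolute value. *)
have cdB : cd \notin B.
  have [||_] := high a 0; [by rewrite subrr normr0 ltW|lra|].
  rewrite aroundE !mk4E !mul0r !addr0 normrN1 mulr1 => lK.
  apply/negP => /lamP; rewrite -normrN => cdl.
  by have := le_lt_trans (le_trans (ler_norm _) cdl) lK; rewrite ltxx.
have xl : `|a - d - a| <= d by rewrite ler_norml; lra.
have xr : `|a + d - a| <= d by rewrite ler_norml; lra.
have xm t : 0 <= t <= 1 -> `|a - d + t * (a + d - (a - d)) - a| <= d.
  by move=> t01; rewrite ler_norml; nra.
have im_low x : im1 (around cd x 0) = -1 by rewrite aroundE mk4E mul0r addr0.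
have im_high x : `|x - a| <= d -> 0 < im1 (around cd x T).
  by move=> /above0; rewrite aroundE mk4E.
have sideM x t : x = a - d \/ x = a + d -> M (around cd x t).
  move=> xE; apply: around_model => // a' sa' xa'.
  have aa : a' = a by apply: alone' => //; case: xE; lra.
  by case: xE; lra.
pose kL t := around cd (a - d) (t * T); pose kR t := around cd (a + d) (t * T).
pose kT t := around cd (a - d + t * (a + d - (a - d))) T.
pose kB t := around cd (a - d + t * (a + d - (a - d))) 0.
have tT t : 0 <= t <= 1 -> 0 <= t * T <= T by move=> t01; nra.
have pL : path_in (above lam (a - d) (a - d)) kL.
  by split; [apply: cts_around; cts|move=> t /tT; exact: high].
have pR : path_in (above lam (a + d) (a + d)) kR.
  by split; [apply: cts_around; cts|move=> t /tT; exact: high].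
have pT : path_in upper kT.
  split; [by apply: cts_around; cts|move=> t /xm xt; split; last exact: im_high].
  by apply: around_model => // a' sa' xa'; rewrite gt_eqF // -xa'; exact: above0.
have pB : path_in lower kB.
  split; [by apply: cts_around; cts|move=> t /xm xt; split; last by rewrite im_low; lra].
  by apply: around_model => // a' sa' xa'; rewrite mul0r addr0 oppr_eq0 oner_eq0.
have pLM : path_in M kL by split; [case: pL|move=> t _; apply: sideM; left].
have pRM : path_in M kR by split; [case: pR|move=> t _; apply: sideM; right].
have pTM := path_in_sub (@upper_sub _ _ _) pT; have pBM := path_in_sub (@lower_sub _ _ _) pB.
have T0E : kT 0 = kL 1 by rewrite /kT /kL mul0r mul1r addr0.
have T1E : kT 1 = kR 1 by rewrite /kT /kR !mul1r addrC subrK.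
have B0E : kB 0 = kL 0 by rewrite /kB /kL !mul0r addr0.
have B1E : kB 1 = kR 0 by rewrite /kB /kR mul1r mul0r addrC subrK.
have lo : lower (kL 0) by rewrite -B0E; apply: (pB.2); lra.
have [b [pb b0 b1]] := lower_connected (lower_base u_lower) lo.
have pbM := path_in_sub (@lower_sub _ _ _) pb.
have pLT := path_in_concat pLM pTM (esym T0E).
have pBR := path_in_concat pBM pRM B1E.
have bLT : b 1 = concat kL kT 0 by rewrite concat0.
have bBR : b 1 = concat kB kR 0 by rewrite concat0 B0E.
have pu := path_in_concat pbM pLT bLT; have pd := path_in_concat pbM pBR bBR.
pose dn t := concat b (concat kB kR) (1 - t).
have pdn : path_in M dn := path_in_rev pd.
have ud : concat b (concat kL kT) 1 = dn 0 by rewrite /dn subr0 !concat1.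
pose l := concat (concat b (concat kL kT)) dn.
have lF (A : set E) (H : groupType) (F : (R -> E) -> H) : M `<=` A -> path_functor A F ->
    F l = (F b * (F kL * F kT) * (F b * (F kB * F kR))^-1)%g.
  move=> MA pF; have sub := path_in_sub MA.
  rewrite (functor_concat pF (sub _ pu) (sub _ pdn) ud) (functor_rev pF (sub _ pd)).
  rewrite (functor_concat pF (sub _ pbM) (sub _ pLT) bLT).
  rewrite (functor_concat pF (sub _ pbM) (sub _ pBR) bBR).
  rewrite (functor_concat pF (sub _ pLM) (sub _ pTM) (esym T0E)).
  by rewrite (functor_concat pF (sub _ pBM) (sub _ pRM) B1E).
unshelve eexists (@LoopAround a l b kL kT kR kB (a - d) (a + d) _ _ _ pb pT pB pL pR
  _ _ _ _ b0 b1 T0E T1E B0E B1E _ _ _) => //.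
- split; [exact: path_in_concat|by rewrite /l !concat0|by rewrite /l /dn concat1 subrr !concat0].
- by lra.
- by rewrite /kL mul0r im_low; lra.
- by rewrite /kL mul1r; exact: im_high.
- by rewrite /kR mul0r im_low; lra.
- by rewrite /kR mul1r; exact: im_high.
- by move=> H F pF; exact: lF pF.
(* Once the lines [z = a] are filled in, the rectangle of the surface [around cd] bounded by the
   four sides lies in the complement. *)
- move=> H F pF; rewrite (lF _ _ _ (@model_sub _ _ _) pF).
  have -> : (F kL * F kT = F kB * F kR)%g; last by rewrite mulgV.
  apply/esym/(functor_square (K := fun st : R * R =>
    around cd (a - d + st.1 * (a + d - (a - d))) (st.2 * T)) pF).
  + by apply: cts_around; cts.
  + move=> t t' /xm xt /tT t'T /=.
    by apply: (@flow_model _ _ _ _ rhoE) => //; apply/model_on_line => //; rewrite oppr_eq0 oner_eq0.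
  + by move=> t _ /=; rewrite mul0r.
  + by move=> t _ /=; rewrite mul1r addrC subrK.
  + by move=> t _ /=; rewrite mul0r addr0.
  + by move=> t _ /=; rewrite mul1r.
(* Conjugated by [b], the loop [m] becomes a loop [n] of real lines over a corner of the rectangle.
   Carrying it along the four sides gives [c1] to [c4]; both ways around end with the same loop at
   the opposite corner, so [n] commutes with the boundary. *)
move=> v [m [im m0 m1 <-]].
have prb := path_in_rev pb.
have mb : m 1 = b 0 by rewrite m1 b0.
have pmb := path_in_concat im pb mb.
have rmb : b (1 - 1) = concat m b 0 by rewrite subrr concat0 m0.
pose n := concat (fun t => b (1 - t)) (concat m b).
have pn : path_in lower n := path_in_concat prb pmb rmb.
have kL0 : kL 0 = on_line (a - d) (-1) cd by rewrite /kL mul0r /around flow0.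
have n0 : n 0 = on_line (a - d) (-1) cd by rewrite /n concat0 subr0 b1.
have n1 : n 1 = on_line (a - d) (-1) cd by rewrite /n !concat1 b1.
have [f [cf f0 f1 fB nE]] := lower_fiber pn n0 n1.
have sub := path_in_sub (@lower_sub _ s B).
have nE' : tau n = ((tau b)^-1 * (tau m * tau b))%g.
  rewrite (functor_concat ptau (sub _ prb) (sub _ pmb) rmb) (functor_rev ptau (sub _ pb)).
  by rewrite (functor_concat ptau (sub _ im) (sub _ pb) mb).
have mE : tau m = (tau b * tau n * (tau b)^-1)%g by rewrite nE' mulVKg mulgK.
have fB' : forall r, 0 <= r <= 1 -> f r \notin B by [].
have f10 : f 1 = f 0 by rewrite f1.
have cc (x : R) : continuous (fun _ : R => x) by cts.
have ct : continuous (fun r : R => r * T) by cts.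
have cx : continuous (fun r : R => a - d + r * (a + d - (a - d))) by cts.
have side x : x = a - d \/ x = a + d -> forall r a', 0 <= r <= 1 -> a' \in s ->
    x = a' -> -1 + r * T * eta a' != 0.
  move=> xE r' a' _ sa' xa'.
  have aa : a' = a by apply: alone' => //; case: xE; lra.
  by case: xE; lra.
have top r' a' : 0 <= r' <= 1 -> a' \in s -> a - d + r' * (a + d - (a - d)) = a' ->
    -1 + T * eta a' != 0.
  by move=> /xm /above0 + _ xa'; rewrite xa' => h; rewrite gt_eqF.
have bot r' a' : 0 <= r' <= 1 -> a' \in s -> a - d + r' * (a + d - (a - d)) = a' ->
    -1 + 0 * eta a' != 0.
  by move=> _ _ _; rewrite mul0r addr0 oppr_eq0 oner_eq0.
have aw : a - d + (a + d - (a - d)) = a + d by ring.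
have c1 := around_commute (cc (a - d)) ct cf f10 fB' (side _ (or_introl erefl)).
have c2 := around_commute cx (cc T) cf f10 fB' top.
have c3 := around_commute cx (cc 0) cf f10 fB' bot.
have c4 := around_commute (cc (a + d)) ct cf f10 fB' (side _ (or_intror erefl)).
move: c1 c2 c3 c4; rewrite !mul0r !mul1r !addr0 !aw f0 -nE -/kL -/kT -/kB -/kR.
rewrite mE (lF _ _ _ (@subset_refl _ M) ptau).
move: (tau n) (tau (fun r => around (f r) (a - d) T)) (tau (fun r => around (f r) (a + d) T))
  (tau (fun r => around (f r) (a + d) 0)) (tau kL) (tau kT) (tau kB) (tau kR) (tau b).
move=> w w1 w2 w3 L P Q N b' c1 c2 c3 c4.
have h1 : (w * (L * P) = (L * P) * w2)%g by rewrite mulgA c1 -mulgA c2 mulgA.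
have h2 : (w * (Q * N) = (Q * N) * w2)%g by rewrite mulgA c3 -mulgA c4 mulgA.
move: (L * P)%g (Q * N)%g h1 h2 => U D h1 h2.
have h3 : (w2 * D^-1 = D^-1 * w)%g.
  by apply: (mulgI D); rewrite mulgA -h2 mulgK mulVKg.
by rewrite !invgM !mulgA !mulgVK -!(mulgA b') h1 -!mulgA; congr (_ * _)%g; rewrite !mulgA -(mulgA U) h3 !mulgA.
Qed.

End LoopsAroundLines.

(** * Free groups *)

Lemma seq_has_max (R : realType) (t : seq R) : t != [::] ->
  exists2 a, a \in t & forall b, b \in t -> b <= a.
Proof.
elim: t => // a t IH _; have [->|/IH[b bt bmax]] := eqVneq t [::].
  by exists a; rewrite ?mem_head // => b; rewrite inE => /eqP->.
have [ab|ba] := leP a b.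
  by exists b; rewrite ?inE ?bt ?orbT // => c; rewrite inE => /orP[/eqP->|/bmax].
exists a; rewrite ?mem_head // => c; rewrite inE => /orP[/eqP->//|/bmax cb].
exact: le_trans cb (ltW ba).
Qed.

Lemma count_lt_mono (R : realType) (t : seq R) x y a : y < a -> a < x -> a \in t ->
  (count (< y) t < count (< x) t)%N.
Proof.
move=> ya ax; have yx b : (b < y)%R -> (b < x)%R.
  by move=> bY; exact: lt_trans bY (lt_trans ya ax).
elim: t => // b t IH; rewrite inE => /orP[/eqP<-|/IH lt] /=.
  by rewrite ax (ltNge a y) (ltW ya) /= add0n add1n ltnS; apply: sub_count.
by rewrite -addnS leq_add //; case: (ltP b y) => [/yx->|].
Qed.

Section FreeGroupMorphisms.
Variables (T : choiceType) (H : groupType) (f : T -> H).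

Definition free_gen (x : T) : free_group T := word_class [:: (x, true)].

Definition word_eval (w : seq (T * bool)) : H :=
  foldr (fun xe v => (if xe.2 then f xe.1 else (f xe.1)^-1) * v)%g 1%g w.

Lemma word_eval_cat v w : word_eval (v ++ w) = (word_eval v * word_eval w)%g.
Proof. by elim: v => [|xe v IH] /=; rewrite ?mul1g // IH mulgA. Qed.

Lemma word_eval_cong v w : word_cong v w -> word_eval v = word_eval w.
Proof.
elim=> {v w} [v w x e|//|v w _ ->//|v w z _ -> _ ->//].
by rewrite !word_eval_cat /=; case: e => /=; rewrite ?mulVKg ?mulKg.
Qed.

Definition free_eval (v : free_group T) : H := word_eval (word_repr v).

Lemma free_evalE w : free_eval (word_class w) = word_eval w.
Proof. by apply: word_eval_cong; exact: word_repr_class. Qed.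

Lemma free_evalM v w : free_eval (v * w)%g = (free_eval v * free_eval w)%g.
Proof.
by rewrite -[v]word_reprK -[w]word_reprK [(_ * _)%g]free_mulE !free_evalE word_eval_cat.
Qed.

Lemma free_eval_gen x : free_eval (free_gen x) = f x.
Proof. by rewrite free_evalE /= mulg1. Qed.

End FreeGroupMorphisms.

Lemma free_gen_ind (T : choiceType) (P : free_group T -> Prop) :
  P 1%g -> (forall v w, P v -> P w -> P (v * w)%g) -> (forall v, P v -> P (v^-1)%g) ->
  (forall x, P (free_gen x)) -> forall v, P v.
Proof.
move=> P1 PM PV Pg v; rewrite -[v]word_reprK; elim: (word_repr v) => [|[x e] w IH]; first exact: P1.
have -> : word_class ((x, e) :: w) = (word_class [:: (x, e)] * word_class w)%g.
  by rewrite [(_ * _)%g]free_mulE.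
apply: PM => //; case: e; first exact: Pg.
have -> : word_class [:: (x, false)] = ((free_gen x)^-1)%g by rewrite [(_^-1)%g]free_invE.
by apply: PV; exact: Pg.
Qed.

Section GenerationByLoops.
Variables (R : realType) (s : seq R) (B : seq (R * R)) (u : model s B).
Hypothesis u_lower : im1 (set_val u) < 0.
Variables (eta : R -> R) (rho : R * R -> R).
Hypotheses (ceta : continuous eta) (crho : continuous rho).
Hypothesis rhoE : forall x cd, cd \in B -> rho (x, value cd x) = eta x * cd.1.
Variable x0 : R.
Hypotheses (eta_x0 : 0 < eta x0) (x0_min : forall a, a \in s -> x0 < a).
Local Notation E := (R4 R).
Local Notation M := (model s B).
Local Notation G := (pi1 R u).
Local Notation tau := (path_pi1 u).
Local Notation ptau := (path_pi1_functor R u).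
Local Notation lower := (lower s B).
Local Notation upper := (upper s B).
Local Notation lower_to := (lower_to u_lower).
Local Notation upper_to := (upper_to u_lower eta rho x0).
Implicit Types (e : E) (k : R -> E).
Variable S : G -> Prop.
Hypotheses (SM : forall v w, S v -> S w -> S (v * w)%g)
           (SV : forall v, S v -> S (v^-1)%g)
           (Slow : forall v, lower_class v -> S v).
Variable lam : R.
Hypothesis lamP : forall cd, cd \in B -> `|cd.1| <= lam.
Hypothesis lam0 : 0 <= lam.
Local Notation crosses_at x := (crosses u_lower eta rho x0 S (above lam x x)).

(** Up to paths in [lower] and [upper], the loop goes up on the left of [a] and comes down on the
    right; two of the three elements, left crossing, right crossing and loop, determine the
    third. *)
Lemma crosses_right a (l : loop_around u lam a) : a \in s -> S (tau (la_loop l)) ->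
  crosses_at (la_l l) -> crosses_at (la_r l).
Proof.
move=> sa Sl crl; have /andP[la ar] := la_sides l.
have sl : forall a', a' \in s -> ~ (la_l l <= a' <= la_l l).
  by move=> a' sa' h; have := @la_alone _ _ _ _ _ _ l a' sa'; lra.
have sr : forall a', a' \in s -> ~ (la_r l <= a' <= la_r l).
  by move=> a' sa' h; have := @la_alone _ _ _ _ _ _ l a' sa'; lra.
have lM := above_model lamP sl; have rM := above_model lamP sr.
have lC := @convex_above _ lam (la_l l) (la_l l) lam0.
have rC := @convex_above _ lam (la_r l) (la_r l) lam0.
have pL := la_pL l; have pR := la_pR l.
have L0 : above lam (la_l l) (la_l l) (la_L l 0) by apply: pL.2; lra.
have L1 : above lam (la_l l) (la_l l) (la_L l 1) by apply: pL.2; lra.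
have R0 : above lam (la_r l) (la_r l) (la_R l 0) by apply: pR.2; lra.
have R1 : above lam (la_r l) (la_r l) (la_R l 1) by apply: pR.2; lra.
have segL : tau (seg (la_L l 0) (la_L l 1)) = tau (la_L l).
  by apply: (functor_convex ptau lC lM); rewrite ?seg0 ?seg1 //; exact: path_in_seg.
have segR : tau (seg (la_R l 0) (la_R l 1)) = tau (la_R l).
  by apply: (functor_convex ptau rC rM); rewrite ?seg0 ?seg1 //; exact: path_in_seg.
exists (la_R l 0), (la_R l 1); split=> //; [exact: la_R0|exact: la_R1|].
have s1 := Slow (lower_path u_lower (la_pb l)).
have s4 := Slow (lower_path u_lower (la_pB l)).
have s3 := Slow (upper_path u_lower ceta crho rhoE eta_x0 x0_min (la_pT l)).
have s2 := crosses_all ceta crho rhoE eta_x0 x0_min SM Slow lC lM crl L0 L1 (la_L0 l) (la_L1 l).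
move: s1 s2 s3 s4 Sl.
rewrite (la_functor l ptau) segL segR (la_b0 l) (la_b1 l) (la_T0 l) (la_T1 l) (la_B0 l) (la_B1 l).
have lu : lower_class (lower_to (set_val u)).
  have [k [ik k0 k1 ->]] := lower_toP u_lower (lower_base u_lower).
  by exists k.
move: (Slow lu).
move: (lower_to (set_val u)) (lower_to (la_L l 0)) (upper_to (la_L l 1)) (upper_to (la_R l 1))
  (lower_to (la_R l 0)).
move: (tau (la_b l)) (tau (la_L l)) (tau (la_T l)) (tau (la_B l)) (tau (la_R l)).
move=> b kL kT kB kR be g0 h0 h1 g1 Sbe s1 s2 s3 s4 Sl.
have Sl' := SM (SM Sbe Sl) (SV Sbe).
have := SM (SV (SM s1 s4)) (SM (SV Sl') (SM s1 (SM s2 s3))).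
by rewrite !invgM !invgK !mulgA !(mulgVK, mulgK, mulVg, mulgV, mul1g).
Qed.

Hypothesis Sloops : forall a, a \in s -> exists2 l : loop_around u lam a, True & S (tau (la_loop l)).

(** Induction on the number of points of [s] below [x]: the largest of them, [a], is passed with its
    loop, and no point of [s] separates the right side of that loop from [x]. With none below, [x]
    is joined to [x0]. *)
Lemma crosses_everywhere x : x \notin s -> crosses_at x.
Proof.
have [n] := ubnP (count (< x) s); elim: n x => // n IH x /ltnSE-le_n xs.
have base := crosses_at_base u_lower ceta crho rhoE eta_x0 x0_min Slow lamP lam0.
have [t0|/seq_has_max[a]] := eqVneq [seq a <- s | a < x] [::].
  apply: (crosses_at_strip ceta crho rhoE eta_x0 x0_min SM Slow lamP lam0 _ base).
  move=> a sa; have x0a := x0_min sa => /andP[_]; rewrite le_max leNgt x0a /= => ax.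
  suff : a \in [seq a <- s | a < x] by rewrite t0.
  by rewrite mem_filter sa lt_neqAle ax !andbT; apply: contraNneq xs => <-.
rewrite mem_filter => /andP[ax sa] amax.
have [l _ Sl] := Sloops sa; have /andP[la ar] := la_sides l.
have alone := @la_alone _ _ _ _ _ _ l.
have xl : la_l l \notin s.
  by apply/negP => sl; have := alone _ sl; rewrite lexx (ltW (lt_trans la ar)) => /(_ isT) e; rewrite e ltxx in la.
have cl : crosses_at (la_l l).
  by apply: IH => //; apply: leq_trans le_n; exact: count_lt_mono la ax sa.
apply: (crosses_at_strip ceta crho rhoE eta_x0 x0_min SM Slow lamP lam0 _ (crosses_right sa Sl cl)).
move=> b sb /andP[b1 b2].
have ba : b != a.
  by apply: contraTneq b1 => ->; rewrite -ltNge lt_min ar ax.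
have [xb|bx] := ltP x b.
  have : b = a by apply: alone => //; move: b2; rewrite le_max => /orP[h|h]; lra.
  by move/eqP; rewrite (negbTE ba).
have bx' : b < x by rewrite lt_neqAle bx andbT; apply: contraNneq xs => <-.
have : b <= a by apply: amax; rewrite mem_filter bx' sb.
by move: b1; rewrite ge_min => /orP[h|h] h'; lra.
Qed.

Theorem generation_by_loops v : S v.
Proof.
apply: (generation ceta crho rhoE eta_x0 x0_min SM SV Slow lamP lam0).
exact: crosses_everywhere.
Qed.

End GenerationByLoops.

(** * Removing a pencil of parallel lines *)

Section GroupFacts.
Variables (G H : groupType) (f : G -> H).
Hypothesis fM : forall v w, f (v * w)%g = (f v * f w)%g.

Lemma morph_one : f 1%g = 1%g.
Proof. by apply: (mulgI (f 1%g)); rewrite -fM !mulg1. Qed.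

Lemma morph_inv v : f (v^-1)%g = ((f v)^-1)%g.
Proof. by apply: (mulgI (f v)); rewrite -fM !mulgV morph_one. Qed.

Lemma bijective_isomorphic : bijective f -> group_isomorphic G H.
Proof.
move=> bf; pose m := isMultiplicative.Build G H f fM.
by exists (HB.pack f m : {multiplicative G -> H}).
Qed.

End GroupFacts.

Lemma path_functor_sub (R : realType) (E : topologicalType) (A A' : set E) (H : groupType)
  (F : (R -> E) -> H) : A `<=` A' -> path_functor A' F -> path_functor A F.
Proof.
by move=> AA [sq cs lo]; split=> // [K cK AK|e /AA /cs //]; apply: sq => // *; apply: AA; exact: AK.
Qed.

Lemma path_functor_comp (R : realType) (E E' : topologicalType) (A : set E) (A' : set E')
  (H : groupType) (F : (R -> E') -> H) (g : E -> E') : continuous g ->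
  (forall e, A e -> A' (g e)) -> path_functor A' F ->
  path_functor A (fun k : R -> E => F (fun t => g (k t))).
Proof.
move=> cg gA [sq cs lo]; split=> [K cK AK|e /gA /cs //|k l kl].
- apply: (sq (fun st => g (K st))); first by cts.
  by move=> s t s01 t01; apply: gA; exact: AK.
- by apply: lo => s s01; rewrite kl.
Qed.

(** * The projection to the free group *)

Section Holonomy4.
Variables (R : realType) (s : seq R) (B : seq (R * R)).
Hypothesis s_sorted : sorted <%R s.
Local Notation E := (R4 R).
Local Notation M := (model s B).
Local Notation H := (free_group 'I_(size s)).
Implicit Types (e : E).

(** The jump on the piece of the hyperplane with [k] lines to its left. Adjacent pieces differ by
    one generator, which is then the winding of the loop between them; past [size s] the factor is
    1. *)
Fixpoint gen_prod (k : nat) : H :=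
  if k is k'.+1 then (gen_prod k' * (if insub k' is Some i then free_gen i else 1))%g
  else 1%g.

Definition crossing_word (x : R) : H := gen_prod (count (< x) s).

Definition side (i : bool) : set E :=
  [set e | (if i then 0 < im1 e else im1 e < 0) \/ re1 e \notin s].

(** The quotient of the two sections is [crossing_word (re1 e)] everywhere, and this is locally
    constant where the two sides overlap, since there [re1] avoids [s]. *)
Definition side_sec (i : bool) (e : E) : H :=
  if i then (if im1 e < 0 then crossing_word (re1 e) else 1)%g
  else (if im1 e < 0 then 1 else (crossing_word (re1 e))^-1)%g.

Lemma near_notin e : re1 e \notin s -> \forall e' \near e, forall a, a \in s ->
  (a < re1 e') = (a < re1 e) /\ re1 e' != a.
Proof.
move=> es; apply: near_all => a sa.
have cr : continuous (fun e => re1 e : R) by cts4.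
have ea : re1 e != a by apply: contraNneq es => ->.
have [lt|gt|eq] := ltgtP a (re1 e); last by rewrite eq eqxx in ea.
- have n : \forall e' \near e, a < re1 e' by exact: (cr e _ (lt_nbhsr lt)).
  by apply: filterS n => e' h; rewrite h gt_eqF.
- have n : \forall e' \near e, re1 e' < a by exact: (cr e _ (lt_nbhsl gt)).
  by apply: filterS n => e' h; rewrite lt_eqF // ltNge (ltW h).
Qed.

Lemma side_open i : open (side i).
Proof.
rewrite openE => e [ye|es]; last first.
  by apply: filterS (near_notin es) => e' h; right; apply/negP => /h[_]; rewrite eqxx.
have ci : continuous (fun e => im1 e : R) by cts4.
case: i ye => ye.
  have n : \forall e' \near e, 0 < im1 e' by exact: (ci e _ (lt_nbhsr ye)).
  by apply: filterS n => e' h; left.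
have n : \forall e' \near e, im1 e' < 0 by exact: (ci e _ (lt_nbhsl ye)).
by apply: filterS n => e' h; left.
Qed.

Lemma side_cover e : M e -> exists i, side i e.
Proof.
move=> [es _]; have [y|y|y] := ltgtP (im1 e) 0; [by exists false; left|by exists true; left|].
exists true; right; apply/negP => xs; exact: (es _ xs).
Qed.

Lemma side_trans e i j : side i e -> side j e -> \forall e' \near e,
  (side_sec i e' * (side_sec j e')^-1 = side_sec i e * (side_sec j e)^-1)%g.
Proof.
have [->|ij] := eqVneq i j; first by move=> _ _; near=> e'; rewrite !mulgV.
move=> si sj; have es : re1 e \notin s.
  by case: i j ij si sj => [] [] // _ [h|//] [h'|//]; have := lt_trans h h'; rewrite ltxx.
have w e' : (side_sec true e' * (side_sec false e')^-1 = crossing_word (re1 e'))%g.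
  by rewrite /side_sec; case: ifP => _; rewrite ?invg1 ?mulg1 // invgK mul1g.
have w' e' : (side_sec false e' * (side_sec true e')^-1 = (crossing_word (re1 e'))^-1)%g.
  by rewrite -w invgM invgK.
have n := near_notin es; apply: filterS n => e' h.
have cw : crossing_word (re1 e') = crossing_word (re1 e).
  by rewrite /crossing_word; congr gen_prod; apply: eq_in_count => a /h[].
by case: i j ij {si sj} => [] [] // _; rewrite ?w ?w' cw.
Unshelve. all: by end_near. Qed.

Definition winding : (R -> E) -> H := holonomy side side_sec.

Lemma winding_functor : path_functor M winding.
Proof. exact: (holonomy_functor R side_open side_cover side_trans). Qed.

Lemma winding_lower k : path_in (lower s B) k -> winding k = 1%g.
Proof.
move=> ik; have [ck Lk] := ik; have sub := path_in_sub (@lower_sub _ s B) ik.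
rewrite /winding (holonomy_sec (@side_cover) side_trans (i := false) sub).
  have [_ y0] : lower s B (k 0) by apply: Lk; lra.
  have [_ y1] : lower s B (k 1) by apply: Lk; lra.
  by rewrite /side_sec y0 y1 mulVg.
by move=> t /Lk[_ y]; left.
Qed.

Lemma winding_upper k : path_in (upper s B) k -> winding k = 1%g.
Proof.
move=> ik; have [ck Lk] := ik; have sub := path_in_sub (@upper_sub _ s B) ik.
rewrite /winding (holonomy_sec (@side_cover) side_trans (i := true) sub).
  have [_ y0] : upper s B (k 0) by apply: Lk; lra.
  have [_ y1] : upper s B (k 1) by apply: Lk; lra.
  by rewrite /side_sec !ltNge (ltW y0) (ltW y1) mulVg.
by move=> t /Lk[_ y]; left.
Qed.

Lemma winding_vertical k x : path_in M k -> (forall t, 0 <= t <= 1 -> re1 (k t) = x) ->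
  x \notin s -> im1 (k 0) < 0 -> 0 < im1 (k 1) -> winding k = ((crossing_word x)^-1)%g.
Proof.
move=> ik kx xs y0 y1.
rewrite /winding (holonomy_sec (@side_cover) side_trans (i := true) ik).
  by rewrite /side_sec y0 ltNge (ltW y1) /= mulg1 kx //; lra.
by move=> t /kx xE; right; rewrite xE.
Qed.

(** Going up on the left gives the inverse of the word with [i] letters, coming down on the right
    the word with [i + 1] letters; horizontal pieces give 1. *)
Lemma winding_loop (u : M) lam (lamP : forall cd, cd \in B -> `|cd.1| <= lam)
    (i : 'I_(size s)) (l : loop_around u lam (nth 0 s i)) :
  winding (la_loop l) = free_gen i.
Proof.
have si : nth 0 s i \in s by exact: mem_nth.
have /andP[la ar] := la_sides l; have alone := @la_alone _ _ _ _ _ _ l.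
have xl : la_l l \notin s.
  by apply/negP => sl; have := alone _ sl; rewrite lexx (ltW (lt_trans la ar)) => /(_ isT) e; rewrite e ltxx in la.
have xr : la_r l \notin s.
  by apply/negP => sl; have := alone _ sl; rewrite lexx (ltW (lt_trans la ar)) => /(_ isT) e; rewrite e ltxx in ar.
have vert x (k : R -> E) : x \notin s -> path_in (above lam x x) k -> im1 (k 0) < 0 ->
    0 < im1 (k 1) -> winding k = ((crossing_word x)^-1)%g.
  move=> xs pk y0 y1; have aM : above lam x x `<=` M.
    apply: (above_model lamP) => a sa xa; have ax : x = a by lra.
    by rewrite ax sa in xs.
  apply: winding_vertical => //; first exact: path_in_sub pk.
  by move=> t /pk.2 [h _]; lra.
rewrite (la_functor l winding_functor) (winding_lower (la_pb l)) (winding_lower (la_pB l)).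
rewrite (winding_upper (la_pT l)) !mul1g mulg1.
rewrite (vert _ _ xl (la_pL l) (la_L0 l) (la_L1 l)) (vert _ _ xr (la_pR l) (la_R0 l) (la_R1 l)).
have cl : count (< la_l l) s = i.
  transitivity (count (< nth 0 s i) s); last exact: count_lt_nth.
  apply: eq_in_count => b sb /=.
  apply/idP/idP => [bl|ba]; first exact: lt_trans bl la.
  rewrite ltNge; apply/negP => lb; have := alone b sb; rewrite lb (ltW (lt_trans ba ar)).
  by move=> /(_ isT) e; rewrite e ltxx in ba.
have cr : count (< la_r l) s = i.+1.
  transitivity (count (<= nth 0 s i) s); last exact: count_le_nth.
  apply: eq_in_count => b sb /=.
  apply/idP/idP => [bl|ba]; last exact: le_lt_trans ba ar.
  rewrite leNgt; apply/negP => lb; have := alone b sb.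
  rewrite (ltW bl) (ltW (lt_trans la lb)) => /(_ isT) e.
  by rewrite e ltxx in lb.
rewrite invgK /crossing_word cl cr /= mulKg.
by case: insubP => [j _ /val_inj ->//|]; rewrite ltn_ord.
Qed.

End Holonomy4.

(** * The splitting of the model *)

Section Split.
Variables (R : realType) (s : seq R) (B : seq (R * R)).
Local Notation E := (R4 R).
Implicit Types (e : E).

(** Two graphs of different slopes meet over a single abscissa, so it is enough to go to the left of
    finitely many numbers. *)
Lemma separated_far : exists x0, distinct_at B x0 /\ forall a, a \in s -> x0 < a.
Proof.
pose bad := [seq (cd'.2 - cd.2) / (cd.1 - cd'.1) | cd <- B, cd' <- B].
have [x0 x0P] := seq_lower_bound (s ++ bad); exists x0; split; last first.
  by move=> a sa; apply: x0P; rewrite mem_cat sa.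
move=> cd cd' Bcd Bcd' e; have [e1|ne] := eqVneq cd.1 cd'.1.
  move: e; rewrite /value e1 => /addrI e2.
  by rewrite [cd]surjective_pairing [cd']surjective_pairing e1 e2.
have : (cd'.2 - cd.2) / (cd.1 - cd'.1) \in bad by apply/allpairsP; exists (cd, cd').
have -> : (cd'.2 - cd.2) / (cd.1 - cd'.1) = x0.
  have d0 : cd.1 - cd'.1 != 0 by rewrite subr_eq0.
  by apply: (mulIf d0); rewrite mulfVK //; move: e; rewrite /value; lra.
by move=> xb; have := x0P x0; rewrite mem_cat xb orbT ltxx => /(_ isT).
Qed.

Lemma slopes_bounded : exists2 lam, 0 <= lam & forall cd, cd \in B -> `|cd.1| <= lam.
Proof.
have [t tP] := seq_upper_bound [seq `|cd.1| | cd <- B].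
exists (Num.max 0 t); first by rewrite le_max lexx.
by move=> cd /(map_f (fun cd => `|cd.1|))/tP/ltW h; rewrite le_max h orbT.
Qed.

Variables (eta : R -> R) (rho : R * R -> R).
Hypotheses (ceta : continuous eta) (crho : continuous rho).
Hypothesis rhoE : forall x cd, cd \in B -> rho (x, value cd x) = eta x * cd.1.

(* Pushes the lines [z = a] off downwards; far down nothing moves. *)
Definition push (c : R) e : E := flow eta rho (- (c * eta (re1 e) * Num.max 0 (im1 e + 1))) e.

Lemma cts_push c : continuous (push c).
Proof. by rewrite /push; apply: cts_flow => //; cts4. Qed.

(** Over [a] a value [y > -1] of [im1] becomes [y - c (eta a)^2 (y + 1) <= -1], and values at most
    -1 are not moved; none becomes 0. *)
Lemma push_model c e : (forall a, a \in s -> 1 <= c * (eta a * eta a)) ->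
  model [::] B e -> model s B (push c e).
Proof.
move=> c1 Me; apply: (@flow_model _ _ _ _ rhoE) => // a sa ea; rewrite ea.
have := c1 a sa; have [y|y] := leP 0 (im1 e + 1) => h.
  apply/eqP => e0; have : c * (eta a * eta a) * (im1 e + 1) >= im1 e + 1 by rewrite ler_peMl.
  by move: e0; nra.
by rewrite mulr0 oppr0 mul0r addr0 lt_eqF //; lra.
Qed.

End Split.

(** The bound -1 on the base point is the level below which the push is the identity, so the push
    keeps the base point. The projections are [wind] and [iota], with sections [sigma] and
    [kappa]. *)
Theorem model_split (R : realType) (s : seq R) (B : seq (R * R)) (u : model s B)
    (u' : model [::] B) : sorted <%R s -> im1 (set_val u) <= -1 ->
  set_val u' = set_val u -> (forall a, a \in s -> distinct_at B a) ->
  group_isomorphic (pi1 R u) (free_group 'I_(size s) * pi1 R u')%type.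
Proof.
move=> s_sorted u_low u'E sep.
have u_lower : im1 (set_val u) < 0 by lra.
have u'_lower : im1 (set_val u') < 0 by rewrite u'E.
have [eta [rho [ceta crho rhoE eta_ge0 eta_sep]]] := interpolation B.
have [x0 [/eta_sep eta_x0 x0_min]] := separated_far s B.
have [lam lam0 lamP] := slopes_bounded B.
pose M := model s B; pose G := pi1 R u; pose G' := pi1 R u'.
pose tau : (R -> R4 R) -> G := path_pi1 u; pose tau' : (R -> R4 R) -> G' := path_pi1 u'.
have ptau : path_functor M tau := path_pi1_functor R u.
have ptau' : path_functor (model [::] B) tau' := path_pi1_functor R u'.
have eta_s a : a \in s -> 0 < eta a by move=> /sep/eta_sep.
pose l (i : 'I_(size s)) : loop_around u lam (nth 0 s i) :=
  sval (cid (loop_around_exists u_lower ceta crho rhoE lamP lam0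
    (mem_nth 0 (ltn_ord i)) (eta_s _ (mem_nth 0 (ltn_ord i))))).
pose sigma := free_eval (fun i => tau (la_loop (l i))).
have sigmaM f f' : sigma (f * f')%g = (sigma f * sigma f')%g by exact: free_evalM.
have sigmaC v f : lower_class v -> (v * sigma f = sigma f * v)%g.
  move=> lv; move: f; apply: free_gen_ind.
  - by rewrite (morph_one sigmaM) mulg1 mul1g.
  - by move=> f f' h h'; rewrite sigmaM mulgA h -mulgA h' mulgA.
  - move=> f h; rewrite (morph_inv sigmaM); apply: (mulgI (sigma f)).
    by rewrite mulgA -h mulgK mulVKg.
  - by move=> i; rewrite /sigma free_eval_gen; exact: la_commute.
(* These products form a subgroup because lower classes commute with the image of [sigma]. *)
have gen v : exists n f, lower_class n /\ v = (n * sigma f)%g.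
  apply: (generation_by_loops u_lower ceta crho rhoE eta_x0 x0_min
    (S := fun v => exists n f, lower_class n /\ v = (n * sigma f)%g) _ _ _ lamP lam0).
  - move=> _ _ [n [f [ln ->]]] [n' [f' [ln' ->]]]; exists (n * n')%g, (f * f')%g.
    by split; [exact: lower_classM|rewrite sigmaM !mulgA -(mulgA n) -sigmaC // !mulgA].
  - move=> _ [n [f [ln ->]]]; exists (n^-1)%g, (f^-1)%g.
    split; first exact: lower_classV.
    by rewrite invgM (morph_inv sigmaM) -(morph_inv sigmaM) sigmaC //; exact: lower_classV.
  - by move=> w lw; exists w, 1%g; rewrite (morph_one sigmaM) mulg1.
  - move=> a sa; have ia : (index a s < size s)%N by rewrite index_mem.
    have li := l (Ordinal ia); move: (l (Ordinal ia)) (erefl (l (Ordinal ia))) => l1 l1E.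
    have l2 : exists2 l0 : loop_around u lam (nth 0 s (index a s)), True & tau (la_loop l0) = sigma (free_gen (Ordinal ia)).
      by exists (l (Ordinal ia)) => //; rewrite /sigma free_eval_gen.
    move: l2; rewrite nth_index // => -[l0 _ l0E]; exists l0 => //.
    by exists 1%g, (free_gen (Ordinal ia)); rewrite mul1g; split; first exact: lower_class1.
(* In the model without lines [z = a] there are no loops to add, so lower classes alone generate. *)
have gen' (w : G') : lower_class w.
  have [x1 [/eta_sep eta_x1 x1_min]] := separated_far [::] B.
  apply: (generation_by_loops u'_lower ceta crho rhoE eta_x1 x1_min _ _ _ lamP lam0) => //.
  - exact: lower_classM.
  - exact: lower_classV.
(* The lines [z = a] with real [a] touch the lower half only in adding a condition on [im1 = 0],
   which is void there. *)
have lower_in (k : R -> R4 R) : path_in (lower s B) k <-> path_in (lower [::] B) k.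
  split=> -[ck Lk]; split=> // t /Lk[[_ HB] y]; split=> //; split=> // a _ [_ y0].
  by rewrite y0 ltxx in y.
have [wind windM windE] := pi1_universal u (winding_functor s B).
have [iota iotaM iotaE] := pi1_universal u (path_functor_sub (@model_sub _ s B) ptau').
have [c cP] : exists c, forall a, a \in s -> 1 <= c * (eta a * eta a).
  have [c cP] := seq_upper_bound [seq (eta a * eta a)^-1 | a <- s].
  exists c => a sa; have e0 : 0 < eta a * eta a by rewrite mulr_gt0 // eta_s.
  have := cP _ (map_f (fun a => (eta a * eta a)^-1) sa).
  by rewrite -(ltr_pM2r e0) mulVf ?gt_eqF // => /ltW.
(* When [s] is empty the bound says nothing about the sign of [c]. *)
have c0 : 0 <= Num.max 0 c by rewrite le_max lexx.
pose kap := push eta rho (Num.max 0 c).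
have ckap : continuous kap by exact: cts_push.
have kapM e : model [::] B e -> M (kap e).
  apply: push_model => // a sa; apply: le_trans (cP a sa) _.
  have e0 : 0 <= eta a * eta a by rewrite mulr_ge0 // ltW // eta_s.
  by rewrite ler_wpM2r // le_max lexx orbT.
have [kappa kappaM kappaE] := pi1_universal u' (path_functor_comp ckap kapM ptau).
(* Applying the push gradually only lowers [im1] over the points of [s], so a lower loop never meets
   a line [z = a] on the way. *)
have kap_low n : path_in (lower s B) n -> n 0 = set_val u -> n 1 = set_val u ->
    kappa (tau' n) = tau n.
  move=> pn n0 n1; rewrite kappaE; last first.
    split; rewrite ?u'E //; apply: path_in_sub (@lower_sub _ [::] B) _; exact/lower_in.
  have [cn Ln] := pn.
  apply/esym/(functor_homotopic (K := fun st : R * R => flow eta rho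
    (st.2 * - (Num.max 0 c * eta (re1 (n st.1)) * Num.max 0 (im1 (n st.1) + 1))) (n st.1)) ptau).
  - by apply: cts_flow => //; cts4.
  - move=> t t' t01 t'01 /=; have [Mt yt] := Ln t t01.
    apply: (@flow_model _ _ _ _ rhoE); first exact: model_sub Mt.
    move=> a sa ea; rewrite lt_eqF //; have := eta_s a sa; rewrite ea => ea0.
    have m0 : 0 <= Num.max 0 (im1 (n t) + 1) by rewrite le_max lexx.
    have : 0 <= t' * (Num.max 0 c * eta a * Num.max 0 (im1 (n t) + 1)) * eta a.
      by rewrite !mulr_ge0 // ?(ltW ea0) //; lra.
    by rewrite mulrN mulNr; lra.
  - by move=> t _ /=; rewrite mul0r flow0.
  - by move=> t _ /=; rewrite mul1r.
  - have mx : Num.max 0 (im1 (set_val u) + 1) = 0 by apply/max_idPl; lra.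
    by move=> t _ /=; rewrite n0 n1 mx mulr0 oppr0 mulr0 flow0.
have wind_low n : lower_class n -> wind n = 1%g.
  move=> [k [pk k0 k1 <-]]; rewrite windE; first exact: winding_lower pk.
  by split=> //; exact: path_in_sub (@lower_sub _ s B) pk.
have wind_sigma f : wind (sigma f) = f.
  move: f; apply: free_gen_ind.
  - by rewrite (morph_one sigmaM) (morph_one windM).
  - by move=> f f' h h'; rewrite sigmaM windM h h'.
  - by move=> f h; rewrite (morph_inv sigmaM) (morph_inv windM) h.
  - move=> i; rewrite /sigma free_eval_gen windE; last exact: la_in.
    exact: winding_loop.
have iota_sigma f : iota (sigma f) = 1%g.
  move: f; apply: free_gen_ind.
  - by rewrite (morph_one sigmaM) (morph_one iotaM).
  - by move=> f f' h h'; rewrite sigmaM iotaM h h' mulg1.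
  - by move=> f h; rewrite (morph_inv sigmaM) (morph_inv iotaM) h invg1.
  - move=> i; rewrite /sigma free_eval_gen iotaE; last exact: la_in.
    exact: (la_trivial (l i) ptau').
have kappa_low w : lower_class (kappa w) /\ iota (kappa w) = w.
  have [k [pk' k0 k1 <-]] := gen' w.
  have pk : path_in (lower s B) k by exact/lower_in.
  have k0' : k 0 = set_val u by rewrite k0.
  have k1' : k 1 = set_val u by rewrite k1.
  have lk : loop_in u k by split=> //; exact: path_in_sub (@lower_sub _ s B) pk.
  rewrite (_ : path_pi1 u' k = tau' k) // kap_low //; split; first by exists k.
  by rewrite iotaE.
have kappa_iota n : lower_class n -> kappa (iota n) = n.
  move=> [k [pk k0 k1 <-]]; rewrite iotaE; first exact: kap_low.
  by split=> //; exact: path_in_sub (@lower_sub _ s B) pk.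
apply: (@bijective_isomorphic _ _ (fun v => (wind v, iota v))).
  by move=> v w; rewrite windM iotaM.
exists (fun fw => kappa fw.2 * sigma fw.1)%g.
  move=> v; have [n [f [ln ->]]] := gen v.
  by rewrite /= windM iotaM wind_low // wind_sigma iota_sigma mulg1 mul1g kappa_iota.
move=> [f w] /=; have [lw iw] := kappa_low w.
by rewrite windM iotaM wind_low // wind_sigma iota_sigma iw mulg1 mul1g.
Qed.

(** * Affine charts of the projective plane *)

Section CrossProduct.
Variable K : comNzRingType.
Implicit Types (a b v : 'rV[K]_3) (x y : K).

Definition dot a v : K := \sum_(i < 3) a 0 i * v 0 i.

Definition cross a b : 'rV[K]_3 := \row_i
  [:: a 0 (lift ord0 ord0) * b 0 (lift ord0 (lift ord0 ord0)) -
      a 0 (lift ord0 (lift ord0 ord0)) * b 0 (lift ord0 ord0);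
      a 0 (lift ord0 (lift ord0 ord0)) * b 0 ord0 -
      a 0 ord0 * b 0 (lift ord0 (lift ord0 ord0));
      a 0 ord0 * b 0 (lift ord0 ord0) - a 0 (lift ord0 ord0) * b 0 ord0]`_i.

Lemma dotE a v : dot a v = a 0 ord0 * v 0 ord0 + a 0 (lift ord0 ord0) * v 0 (lift ord0 ord0) +
  a 0 (lift ord0 (lift ord0 ord0)) * v 0 (lift ord0 (lift ord0 ord0)).
Proof. by rewrite /dot !big_ord_recl big_ord0 addr0 addrA. Qed.

Lemma dotDr a v w : dot a (v + w) = dot a v + dot a w.
Proof. by rewrite !dotE !mxE; ring. Qed.

Lemma dotZr a x v : dot a (x *: v) = x * dot a v.
Proof. by rewrite !dotE !mxE; ring. Qed.

Lemma dotC a v : dot a v = dot v a.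
Proof. by rewrite !dotE; ring. Qed.

Lemma ord3P (P : 'I_3 -> Prop) : P ord0 -> P (lift ord0 ord0) ->
  P (lift ord0 (lift ord0 ord0)) -> forall i, P i.
Proof.
move=> P0 P1 P2 [[|[|[|i]]] hi] //.
- by have -> : Ordinal hi = ord0 by exact: val_inj.
- by have -> : Ordinal hi = lift ord0 ord0 by exact: val_inj.
- by have -> : Ordinal hi = lift ord0 (lift ord0 ord0) by exact: val_inj.
Qed.

Lemma cross_dot0 a b : dot a (cross a b) = 0.
Proof. by rewrite dotE !mxE /=; ring. Qed.

Lemma cross_dot1 a b : dot b (cross a b) = 0.
Proof. by rewrite dotE !mxE /=; ring. Qed.

(* Expansion in the basis dual to [a], [b], [cross a b]. *)
Lemma cross_expand a b v : let c := cross a b in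
  dot c c *: v = dot a v *: cross b c + dot b v *: cross c a + dot c v *: c.
Proof.
move=> c; apply/rowP => i; move: i.
by apply: ord3P; rewrite !mxE !dotE !mxE /=; ring.
Qed.

(* The vector whose products with [a], [b], [c] are [n], [z * n], [w * n],
   for [c := cross a b] and [n := dot c c]. *)
Definition affine_vec a b z w : 'rV[K]_3 :=
  let c := cross a b in cross b c + z *: cross c a + w *: c.

Lemma dot_affine a b d z w : let c := cross a b in dot d (affine_vec a b z w) =
  dot d (cross b c) + z * dot d (cross c a) + w * dot d c.
Proof. by rewrite /affine_vec !dotDr !dotZr. Qed.

Lemma affine_vecE a b z w i : let c := cross a b in
  affine_vec a b z w 0 i = cross b c 0 i + z * cross c a 0 i + w * c 0 i.
Proof.
rewrite /affine_vec /=; move: (cross a b) => c.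
by move: (cross b c) (cross c a) => x y; rewrite !mxE.
Qed.

Lemma dot0_affine a b z w : let c := cross a b in dot a (affine_vec a b z w) = dot c c.
Proof. by rewrite /= dotE !dotE !mxE /=; ring. Qed.

Lemma dot1_affine a b z w : let c := cross a b in dot b (affine_vec a b z w) = z * dot c c.
Proof. by rewrite /= dotE !dotE !mxE /=; ring. Qed.

Lemma dot2_affine a b z w : let c := cross a b in dot c (affine_vec a b z w) = w * dot c c.
Proof. by rewrite /= dotE !dotE !mxE /=; ring. Qed.

Lemma dot_expand a b d v : let c := cross a b in
  dot c c * dot d v = dot d (cross b c) * dot a v + dot d (cross c a) * dot b v + dot d c * dot c v.
Proof. by move=> c; rewrite -dotZr cross_expand !dotDr !dotZr; ring. Qed.

End CrossProduct.

Section CrossProductField.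
Variable F : fieldType.
Implicit Types (a b v : 'rV[F]_3) (x : F).

Lemma dot_ratioZ a b v x : x != 0 -> dot a (x *: v) / dot b (x *: v) = dot a v / dot b v.
Proof. by move=> x0; rewrite !dotZr invfM mulrACA mulfV // mul1r. Qed.

Lemma affine_vec_ratio a b v : let c := cross a b in dot a v != 0 ->
  affine_vec a b (dot b v / dot a v) (dot c v / dot a v) = (dot c c / dot a v) *: v.
Proof.
move=> c v0; rewrite [dot c c / _]mulrC -scalerA cross_expand !scalerDr !scalerA mulVf // scale1r.
by rewrite /affine_vec -/c ![_^-1 * _]mulrC.
Qed.

Lemma cross_span0 a b v : let c := cross a b in dot c c != 0 ->
  dot a v = 0 -> dot b v = 0 -> dot c v = 0 -> v = 0.
Proof.
move=> c c0 v0 v1 v2; have := cross_expand a b v.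
rewrite /= -/c v0 v1 v2 !scale0r !addr0 => /eqP; rewrite scaler_eq0 (negbTE c0) /=.
by move/eqP.
Qed.

End CrossProductField.

Lemma map_cross (K K' : comNzRingType) (f : {rmorphism K -> K'}) (a b : 'rV[K]_3) :
  map_mx f (cross a b) = cross (map_mx f a) (map_mx f b).
Proof.
by apply/rowP; apply: ord3P; rewrite !mxE /= rmorphB !rmorphM.
Qed.

Lemma map_dot (K K' : comNzRingType) (f : {rmorphism K -> K'}) (a b : 'rV[K]_3) :
  dot (map_mx f a) (map_mx f b) = f (dot a b).
Proof. by rewrite !dotE !mxE !rmorphD !rmorphM. Qed.

Lemma dot_self_eq0 (R : realType) (a : 'rV[R]_3) : dot a a = 0 -> a = 0.
Proof.
rewrite dotE -!expr2 => /eqP; rewrite !paddr_eq0 ?addr_ge0 ?sqr_ge0 // !sqrf_eq0.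
move=> /andP[/andP[/eqP h0 /eqP h1] /eqP h2].
by apply/rowP; apply: ord3P; rewrite !mxE.
Qed.

Section ComplexTopology.
Variable R : realType.
Local Notation C := (Cplx R).

Definition cre (z : C) : R := complex.Re z.
Definition cim (z : C) : R := complex.Im z.
Definition cmk (x y : R) : C := Complex x y.

Lemma cmk_eta z : cmk (cre z) (cim z) = z. Proof. by case: z. Qed.

Lemma norm_cre (z : C) : `|cre z|%:C%C <= `|z|.
Proof. exact: normc_ge_Re. Qed.

Lemma norm_cim (z : C) : `|cim z|%:C%C <= `|z|.
Proof.
have -> : cim z = - cre (z * 'i%C) by case: z => x y; rewrite /cim /cre /=; ring.
rewrite normrN; apply: le_trans (norm_cre _) _.
by rewrite normrM [X in _ * X]normc_def /= expr0n /= add0r expr1n sqrtr1 mulr1.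
Qed.

Lemma cts_cre : continuous cre.
Proof.
move=> z P /nbhs_ballP[e /= e0 H]; apply/nbhs_ballP.
have e0' : 0 < e%:C%C :> C by rewrite ltcR.
exists e%:C%C => //= z' zz'; apply: H; rewrite /ball /= -ltcR.
apply: le_lt_trans zz'; rewrite -/(cre z) -/(cre z').
have -> : cre z - cre z' = cre (z - z') by case: z z' => [x y] [x' y'].
exact: norm_cre.
Qed.

Lemma cts_cim : continuous cim.
Proof.
move=> z P /nbhs_ballP[e /= e0 H]; apply/nbhs_ballP.
have e0' : 0 < e%:C%C :> C by rewrite ltcR.
exists e%:C%C => //= z' zz'; apply: H; rewrite /ball /= -ltcR.
apply: le_lt_trans zz'; rewrite -/(cim z) -/(cim z').
have -> : cim z - cim z' = cim (z - z') by case: z z' => [x y] [x' y'].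
exact: norm_cim.
Qed.

Lemma norm_cmk x y : `|cmk x y| <= (`|x| + `|y|)%:C%C.
Proof.
rewrite normc_def /= lecR -[leRHS]ger0_norm ?addr_ge0 // -sqrtr_sqr ler_wsqrtr //.
rewrite sqrrD !real_normK ?num_real // -addrA [_ *+ 2 + _]addrC addrA.
by rewrite lerDl mulrn_wge0 // mulr_ge0.
Qed.

Lemma cts_cmk (Z : topologicalType) (f g : Z -> R) : continuous f -> continuous g ->
  continuous (fun z => cmk (f z) (g z)).
Proof.
move=> cf cg z P /nbhs_ballP[e /= e0 H].
have [er eE] : 0 < cre e /\ e = (cre e)%:C%C.
  by move: e0; rewrite ltcE /= => /andP[/eqP i0 r0]; split=> //; rewrite -[LHS]cmk_eta /cim i0.
have e2 : 0 < cre e / 2 by rewrite divr_gt0.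
have nf : \forall z' \near z, `|f z - f z'| < cre e / 2.
  have b : nbhs (f z) [set y | `|f z - y| < cre e / 2] by apply/nbhs_ballP; exists (cre e / 2).
  exact: (cf z _ b).
have ng : \forall z' \near z, `|g z - g z'| < cre e / 2.
  have b : nbhs (g z) [set y | `|g z - y| < cre e / 2] by apply/nbhs_ballP; exists (cre e / 2).
  exact: (cg z _ b).
apply: filterS (filterI nf ng) => z' [h1 h2]; apply: H; rewrite /ball /=.
have -> : cmk (f z) (g z) - cmk (f z') (g z') = cmk (f z - f z') (g z - g z') by [].
apply: le_lt_trans (norm_cmk _ _) _; rewrite [ltRHS]eE ltcR; lra.
Qed.

End ComplexTopology.

Lemma cts_rowP (Z : topologicalType) (T : topologicalType) (f : Z -> 'rV[T]_3) :
  (forall i, continuous (fun z => f z 0 i)) -> continuous f.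
Proof.
move=> cf z A [P MP sPA].
have n i : \forall z' \near z, P 0 i (f z' 0 i) by exact: (cf i z _ (MP 0 i)).
have n' : \forall z' \near z, forall i, P 0 i (f z' 0 i) by exact: filter_forall.
by apply: filterS n' => z' H; apply: sPA => i j; rewrite ord1.
Qed.

Lemma cts_coord (T : topologicalType) i : continuous (fun v : 'rV[T]_3 => v 0 i).
Proof.
move=> v A nA; exists (fun _ j => if j == i then A else setT).
  by move=> i' j; case: eqP => [->|_]; [rewrite ord1|exact: filterT].
by move=> w /(_ 0 i); rewrite eqxx.
Qed.

Lemma near_mk4 (R : realType) (Z : topologicalType) (x y p q : Z -> R) (z : Z) (P : set (R4 R)) :
  {for z, continuous x} -> {for z, continuous y} -> {for z, continuous p} ->
  {for z, continuous q} -> nbhs (mk4 (x z) (y z) (p z) (q z)) P ->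
  \forall z' \near z, P (mk4 (x z') (y z') (p z') (q z')).
Proof.
move=> cx cy cp cq nP.
exact: (cvg_pair (cvg_pair (cvg_pair cx cy) cp) cq nP).
Qed.

Section Chart.
Variable R : realType.
Local Notation C := (Cplx R).
Variables a0 a1 : 'rV[R]_3.
Hypothesis a01 : cross a0 a1 != 0.
Local Notation cm a := (map_mx (real_complex R) a : 'rV[C]_3).
Local Notation A0 := (cm a0).
Local Notation A1 := (cm a1).
Local Notation A2 := (cross A0 A1).
Local Notation N := (dot A2 A2).

Lemma A2E : A2 = cm (cross a0 a1).
Proof. by rewrite (map_cross (real_complex R)). Qed.

(** The form [dot] is bilinear, so a complex vector can be isotropic; [A2] is not, because it is
    real and nonzero. *)
Lemma N_neq0 : N != 0 :> C.
Proof.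
rewrite A2E (map_dot (real_complex R)); apply/eqP => /eqP.
rewrite -[0](rmorph0 (real_complex R)) (inj_eq (@complexI R)) => /eqP/dot_self_eq0 e.
by move: a01; rewrite e eqxx.
Qed.

Lemma affine_neq0 (z w : C) : affine_vec A0 A1 z w \in [set v : 'rV[C]_3 | v != 0].
Proof.
apply/mem_set/eqP => e; have := dot0_affine A0 A1 z w; rewrite e dotE !mxE !mulr0 !addr0.
by move/eqP; rewrite eq_sym (negbTE N_neq0).
Qed.

(* The point with [dot A1 / dot A0 = z] and [dot A2 / dot A0 = w]. *)
Definition affine_nz (z w : C) : nonzero_vec R := SigSub (affine_neq0 z w).

Lemma coords_affine_nz z w : coords (affine_nz z w) = affine_vec A0 A1 z w.
Proof. by []. Qed.

Definition point_of (e : R4 R) : CP2 R :=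
  proj_point (affine_nz (cmk (re1 e) (im1 e)) (cmk (re2 e) (im2 e))).

Definition vec_chart (v : 'rV[C]_3) : R4 R :=
  mk4 (cre (dot A1 v / dot A0 v)) (cim (dot A1 v / dot A0 v))
      (cre (dot A2 v / dot A0 v)) (cim (dot A2 v / dot A0 v)).

Definition chart (q : CP2 R) : R4 R :=
  vec_chart (coords (repr (q : {eq_quot proportional_equiv R}))).

Lemma proj_pointP (v w : nonzero_vec R) : proj_point v = proj_point w <-> proportional v w.
Proof. by split=> [/eqmodP/asboolP //|vw]; apply/eqmodP/asboolP. Qed.

Lemma proj_point_surj (q : CP2 R) : exists v, q = proj_point v.
Proof. by exists (repr (q : {eq_quot proportional_equiv R})); rewrite /proj_point reprK. Qed.

Lemma chart_proj v : chart (proj_point v) = vec_chart (coords v).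
Proof.
rewrite /chart; set v' := repr _.
have : proj_point v' = proj_point v by rewrite /proj_point reprK.
move=> /proj_pointP[c c0 ->]; rewrite /vec_chart.
have e1 := dot_ratioZ A1 A0 (coords v) c0; have e2 := dot_ratioZ A2 A0 (coords v) c0.
by rewrite e1 e2.
Qed.

Lemma chart_point_of e : chart (point_of e) = e.
Proof.
rewrite /point_of chart_proj coords_affine_nz /vec_chart.
set z := cmk _ _; set w := cmk _ _.
have d0 : dot A0 (affine_vec A0 A1 z w) = N := dot0_affine A0 A1 z w.
have d1 : dot A1 (affine_vec A0 A1 z w) = z * N := dot1_affine A0 A1 z w.
have d2 : dot A2 (affine_vec A0 A1 z w) = w * N := dot2_affine A0 A1 z w.
by rewrite d0 d1 d2 !(mulfK N_neq0); exact: mk4_eta.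
Qed.

Lemma line_proj (b : 'rV[R]_3) v : proj_line (cm b) (proj_point v) <-> dot (cm b) (coords v) = 0.
Proof. exact: proj_lineE. Qed.

Lemma point_of_chart q : ~ proj_line A0 q -> point_of (chart q) = q.
Proof.
have [v ->] := proj_point_surj q => /line_proj/eqP v0.
rewrite chart_proj; apply/proj_pointP; exists (N / dot A0 (coords v)).
  by rewrite mulf_neq0 ?invr_eq0 ?N_neq0.
by rewrite coords_affine_nz /vec_chart !mk4E !cmk_eta; exact: affine_vec_ratio.
Qed.

Lemma point_of_infinity e : ~ proj_line A0 (point_of e).
Proof.
rewrite /point_of line_proj coords_affine_nz.
set z := cmk _ _; set w := cmk _ _.
have d0 : dot A0 (affine_vec A0 A1 z w) = N := dot0_affine A0 A1 z w.
by rewrite d0; apply/eqP/N_neq0.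
Qed.

(* Coefficients of a real linear form in the affine coordinates. *)
Definition chart_coef0 (b : 'rV[R]_3) : R := dot b (cross a1 (cross a0 a1)).
Definition chart_coef1 (b : 'rV[R]_3) : R := dot b (cross (cross a0 a1) a0).
Definition chart_coef2 (b : 'rV[R]_3) : R := dot b (cross a0 a1).

Lemma line_point_of b e : proj_line (cm b) (point_of e) <->
  chart_coef0 b + chart_coef1 b * re1 e + chart_coef2 b * re2 e = 0 /\ chart_coef1 b * im1 e + chart_coef2 b * im2 e = 0.
Proof.
rewrite /point_of line_proj coords_affine_nz.
set z := cmk _ _; set w := cmk _ _.
have d : dot (cm b) (affine_vec A0 A1 z w) = dot (cm b) (cross A1 A2) +
  z * dot (cm b) (cross A2 A0) + w * dot (cm b) A2 := dot_affine A0 A1 (cm b) z w.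
rewrite d -!(map_cross (real_complex R)) !(map_dot (real_complex R)) -/(chart_coef0 b) -/(chart_coef1 b) -/(chart_coef2 b).
rewrite /z /w.
have -> : (chart_coef0 b)%:C%C + cmk (re1 e) (im1 e) * (chart_coef1 b)%:C%C + cmk (re2 e) (im2 e) * (chart_coef2 b)%:C%C
  = cmk (chart_coef0 b + chart_coef1 b * re1 e + chart_coef2 b * re2 e) (chart_coef1 b * im1 e + chart_coef2 b * im2 e) :> C.
  by rewrite /cmk; apply/eqP; rewrite eq_complex /=; apply/andP; split; apply/eqP; ring.
by split=> [[-> ->]|[-> ->]].
Qed.

Lemma chart_coef_line b v : proj_line (cm b) (proj_point v) <->
  (chart_coef0 b)%:C%C * dot A0 (coords v) + (chart_coef1 b)%:C%C * dot A1 (coords v) +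
    (chart_coef2 b)%:C%C * dot A2 (coords v) = 0 :> C.
Proof.
rewrite line_proj; have e : N * dot (cm b) (coords v) =
    (chart_coef0 b)%:C%C * dot A0 (coords v) + (chart_coef1 b)%:C%C * dot A1 (coords v) +
    (chart_coef2 b)%:C%C * dot A2 (coords v) :> C.
  rewrite dot_expand -!(map_cross (real_complex R)) !(map_dot (real_complex R)).
  by [].
rewrite -e; split=> [->|/eqP]; first by rewrite mulr0.
by rewrite mulf_eq0 (negbTE N_neq0) => /eqP.
Qed.

(** At the common point of [A0] and [A1] the third coordinate alone is nonzero, so the third
    coefficient of the form decides. *)
Lemma center_line q b : proj_line A0 q -> proj_line A1 q ->
  proj_line (cm b) q <-> chart_coef2 b = 0.
Proof.
have [v ->] := proj_point_surj q => /line_proj v0 /line_proj v1.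
rewrite chart_coef_line v0 v1 !mulr0 !add0r.
have v2 : dot A2 (coords v) != 0.
  apply/eqP => v2; have vn0 : coords v != 0 := set_valP v.
  by rewrite (cross_span0 N_neq0 v0 v1 v2) eqxx in vn0.
split=> [/eqP|->]; last by rewrite mul0r.
rewrite mulf_eq0 (negbTE v2) orbF -[0](rmorph0 (real_complex R)).
by rewrite (inj_eq (@complexI R)) => /eqP.
Qed.

Lemma cts_point_of : continuous point_of.
Proof.
have cl : continuous (fun e : R4 R => affine_nz (cmk (re1 e) (im1 e)) (cmk (re2 e) (im2 e))).
  apply: continuous_comp_initial; apply: cts_rowP => i.
  have -> : (fun e : R4 R => (set_val \o (fun e : R4 R =>
      affine_nz (cmk (re1 e) (im1 e)) (cmk (re2 e) (im2 e)))) e 0 i) =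
    (fun e : R4 R => (cross A1 A2) 0 i + cmk (re1 e) (im1 e) * (cross A2 A0) 0 i +
       cmk (re2 e) (im2 e) * A2 0 i).
    by apply/funext => e; exact: affine_vecE.
  have c1 : continuous (fun e : R4 R => cmk (re1 e) (im1 e)).
    apply: cts_cmk; first by have h : continuous (fun e : R4 R => re1 e : R) by cts4.
    by have h : continuous (fun e : R4 R => im1 e : R) by cts4.
  have c2 : continuous (fun e : R4 R => cmk (re2 e) (im2 e)).
    apply: cts_cmk; first by have h : continuous (fun e : R4 R => re2 e : R) by cts4.
    by have h : continuous (fun e : R4 R => im2 e : R) by cts4.
  move=> e; apply: cvgD; [apply: cvgD; [exact: cvg_cst|]|].
    by apply: cvgM; [exact: c1|exact: cvg_cst].
  by apply: cvgM; [exact: c2|exact: cvg_cst].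
by move=> e; apply: (continuous_comp (cl e)); exact: pi_continuous.
Qed.

Lemma cts_dot (b : 'rV[C]_3) : continuous (fun w : nonzero_vec R => dot b (coords w)).
Proof.
have cc i : continuous (fun w : nonzero_vec R => coords w 0 i).
  have cv : continuous (@coords R) by exact: initial_continuous.
  exact: (cts_comp (@cts_coord C i) cv).
have -> : (fun w : nonzero_vec R => dot b (coords w)) = (fun w : nonzero_vec R =>
    b 0 ord0 * coords w 0 ord0 + b 0 (lift ord0 ord0) * coords w 0 (lift ord0 ord0) +
    b 0 (lift ord0 (lift ord0 ord0)) * coords w 0 (lift ord0 (lift ord0 ord0))).
  by apply/funext => w; rewrite dotE.
have t i : continuous (fun w : nonzero_vec R => b 0 i * coords w 0 i).
  by move=> w; exact: (cvgM (cvg_cst _) (cc i w)).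
by move=> w; exact: (cvgD (cvgD (t _ w) (t _ w)) (t _ w)).
Qed.

Lemma near_vec_chart (v : nonzero_vec R) (P : set (R4 R)) : dot A0 (coords v) != 0 ->
  nbhs (vec_chart (coords v)) P -> \forall w \near v, P (vec_chart (coords w)).
Proof.
move=> v0; pose f (b : 'rV[C]_3) (w : nonzero_vec R) := dot b (coords w) / dot A0 (coords w).
have cf b : {for v, continuous (f b)}.
  have h0 := @cts_dot A0 v; have h1 := @cts_dot b v.
  exact: (cvgM h1 (cvgV v0 h0)).
have cr b : {for v, continuous (fun w => cre (f b w))}.
  exact: (continuous_comp (cf b) (@cts_cre R _)).
have ci b : {for v, continuous (fun w => cim (f b w))}.
  exact: (continuous_comp (cf b) (@cts_cim R _)).
exact: (near_mk4 (cr A1) (ci A1) (cr A2) (ci A2)).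
Qed.

Lemma open_proj (U : set (CP2 R)) : open (@proj_point R @^-1` U) -> open U.
Proof. by []. Qed.

(** The quotient topology is given by its open sets. So an open [U] is produced from the interior of
    [P], and its preimage among nonzero vectors is shown to be open. *)
Lemma near_chart q (P : set (R4 R)) : ~ proj_line A0 q -> nbhs (chart q) P ->
  nbhs q (chart @^-1` P).
Proof.
move=> q0 nP; pose U : set (CP2 R) := [set q | ~ proj_line A0 q /\ P° (chart q)].
have oU : open U.
  apply: open_proj; rewrite openE => w [/line_proj/eqP w0]; rewrite chart_proj => Pw.
  have n1 := near_vec_chart w0 (nbhs_interior Pw).
  have n2 : \forall w' \near w, dot A0 (coords w') != 0.
    have nb : nbhs (dot A0 (coords w)) [set x : C | x != 0].
      apply/nbhs_ballP; exists `|dot A0 (coords w)|; first by rewrite /= normr_gt0.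
      by move=> x; rewrite /ball /= => h; apply/eqP => x0; move: h; rewrite x0 subr0 ltxx.
    exact: (@cts_dot A0 w _ nb).
  apply: filterS (filterI n1 n2) => w' [h1 h2].
  by split; [apply/line_proj/eqP|rewrite chart_proj].
have : nbhs q U.
  by apply: open_nbhs_nbhs; split=> //; split=> //; exact: nbhs_singleton (nbhs_interior nP).
by apply: filterS => q' [_ /interior_subset].
Qed.

End Chart.

(** * Isomorphisms and base points *)

Lemma inj_surj_bijective (T U : Type) (f : T -> U) : injective f ->
  (forall y, exists x, f x = y) -> bijective f.
Proof.
move=> fi fs; pose g y := sval (cid (fs y)).
have gK : cancel g f by move=> y; rewrite /g; case: cid.
by exists g => // x; apply: fi; rewrite gK.
Qed.

Section Homeomorphism.
Variables (R : realType) (X Y : topologicalType) (x : X) (phi : X -> Y) (psi : Y -> X).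
Hypotheses (cphi : continuous phi) (cpsi : continuous psi).
Hypotheses (phiK : cancel phi psi) (psiK : cancel psi phi).
Local Notation loop z := {path (unit_interval R) from z to z}.

Lemma map_loop_exists (f : loop x) : exists g : loop (phi x), forall s, g s = phi (f s).
Proof.
have cf : continuous (fun s => phi (f s)) by exact: (cts_comp cphi (@continuous_loop R X x f)).
have f0 : phi (f zero) = phi x by rewrite path_zero.
have f1 : phi (f one) = phi x by rewrite path_one.
by exists (mk_path cf f0 f1).
Qed.

Definition map_loop f := sval (cid (map_loop_exists f)).

Lemma map_loopE f s : map_loop f s = phi (f s).
Proof. by rewrite /map_loop; case: cid. Qed.

Lemma map_loop_homotopic f g : homotopic (map_loop f) (map_loop g) <-> homotopic f g.
Proof.
split=> -[H [cH H0 H1 Hx]].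
  exists (fun st => psi (H st)); split=> [|s|s|t].
  - exact: cts_comp.
  - by rewrite H0 map_loopE.
  - by rewrite H1 map_loopE.
  - by rewrite !(Hx t).1 (Hx t).2 !phiK.
exists (fun st => phi (H st)); split=> [|s|s|t].
- exact: cts_comp.
- by rewrite H0 map_loopE.
- by rewrite H1 map_loopE.
- by rewrite !(Hx t).1 (Hx t).2.
Qed.

Lemma map_loop_surj (g : loop (phi x)) : exists f, map_loop f = g.
Proof.
have cg : continuous (fun s => psi (g s)) by exact: (cts_comp cpsi (@continuous_loop R Y _ g)).
have g0 : psi (g zero) = x by rewrite path_zero.
have g1 : psi (g one) = x by rewrite path_one.
by exists (mk_path cg g0 g1); apply/path_eqP => s; rewrite map_loopE psiK.
Qed.

Lemma pi1_homeomorphic : group_isomorphic (pi1 R x) (pi1 R (phi x)).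
Proof.
pose f (a : pi1 R x) : pi1 R (phi x) := loop_class (map_loop (loop_repr a)).
have fE l : f (loop_class l) = loop_class (map_loop l).
  by apply/loop_classP/map_loop_homotopic/loop_repr_class.
apply: (@bijective_isomorphic _ _ f).
  move=> a b; rewrite -[a]loop_reprK -[b]loop_reprK.
  move: (loop_repr a) (loop_repr b) => k l.
  have e : (loop_class k * loop_class l)%g = loop_class (loop_mul k l) by exact: pi1_mulE.
  rewrite e !fE; transitivity (loop_class (loop_mul (map_loop k) (map_loop l))).
    congr loop_class; apply/path_eqP => s.
    by rewrite map_loopE !loop_mulE !map_loopE; case: ifP.
  by rewrite -pi1_mulE.
apply: inj_surj_bijective => [a b|c].
  rewrite -[a]loop_reprK -[b]loop_reprK !fE => /loop_classP/map_loop_homotopic h.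
  exact/loop_classP.
have [l lE] := map_loop_surj (loop_repr c).
by exists (loop_class l); rewrite fE lE loop_reprK.
Qed.

End Homeomorphism.

Section GroupIsomorphic.
Implicit Types G H K : groupType.

Lemma group_isomorphic_refl G : group_isomorphic G G.
Proof. by apply: (@bijective_isomorphic G G id) => //; exists id. Qed.

Lemma group_isomorphic_sym G H : group_isomorphic G H -> group_isomorphic H G.
Proof.
move=> [f [g fK gK]]; apply: (@bijective_isomorphic H G g); last by exists f.
by move=> x y; apply: (can_inj fK); rewrite gK gmulfM !gK.
Qed.

Lemma group_isomorphic_trans H G K : group_isomorphic G H -> group_isomorphic H K ->
  group_isomorphic G K.
Proof.
move=> [f bf] [g bg]; apply: (@bijective_isomorphic G K (g \o f)); last exact: bij_comp.
by move=> x y /=; rewrite !gmulfM.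
Qed.

Lemma group_isomorphic_prod G G' H H' : group_isomorphic G G' -> group_isomorphic H H' ->
  group_isomorphic (G * H)%type (G' * H')%type.
Proof.
move=> [f [f' fK fK']] [g [g' gK gK']].
apply: (@bijective_isomorphic _ _ (fun x : G * H => (f x.1, g x.2))).
  by move=> x y; rewrite !gmulfM.
by exists (fun x => (f' x.1, g' x.2)) => -[x y] /=; rewrite ?fK ?gK ?fK' ?gK'.
Qed.

Lemma group_isomorphic_prodA G H K :
  group_isomorphic (G * (H * K))%type (G * H * K)%type.
Proof.
apply: (@bijective_isomorphic _ _ (fun x : G * (H * K) => (x.1, x.2.1, x.2.2))) => //.
by exists (fun x => (x.1.1, (x.1.2, x.2))) => [[x []]|[[]]].
Qed.

End GroupIsomorphic.

Section BaseChange.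
Variables (R : realType) (E : topologicalType) (A : set E) (u v : A).

(** The functor [path_pi1 v] accepts all paths in [A], in particular loops at [u]; conjugation with
    the class of [k] makes its value the class of the loop carried along [k]. *)
Lemma pi1_base_change (k : R -> E) : path_in A k -> k 0 = set_val u -> k 1 = set_val v ->
  group_isomorphic (pi1 R u) (pi1 R v).
Proof.
move=> pk k0 k1; have pu := path_pi1_functor R u; have pv := path_pi1_functor R v.
have [f fM fE] := pi1_universal u pv; have [g gM gE] := pi1_universal v pu.
pose ku := path_pi1 u k; pose kv := path_pi1 v k; pose kr t := k (1 - t).
have kr0 : kr 0 = k 1 by rewrite /kr subr0.
have kr1 : kr 1 = k 0 by rewrite /kr subrr.
have pkr : path_in A kr.
  exact: path_in_rev.
have ends a b c : path_in A a -> path_in A b -> path_in A c -> a 1 = b 0 -> b 1 = c 0 ->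
   concat (concat a b) c 0 = a 0 /\ concat (concat a b) c 1 = c 1 /\
   path_in A (concat (concat a b) c) /\ forall (H : groupType) (F : (R -> E) -> H), path_functor A F ->
   F (concat (concat a b) c) = (F a * F b * F c)%g :> H.
  move=> pa pb pc ab bc; have pab : path_in A (concat a b) by exact: path_in_concat.
  have abc : concat a b 1 = c 0 by rewrite concat1.
  split; first by rewrite !concat0.
  split; first by rewrite !concat1.
  split=> [|H F pF]; first exact: path_in_concat.
  by rewrite (functor_concat pF pab pc abc) (functor_concat pF pa pb ab).
have ku_rev : path_pi1 u kr = (ku^-1)%g by rewrite /kr (functor_rev pu pk).
have kv_rev : path_pi1 v kr = (kv^-1)%g by rewrite /kr (functor_rev pv pk).
apply: (@bijective_isomorphic _ _ (fun x => kv^-1 * f x * kv)%g).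
  by move=> x y; rewrite fM !mulgA mulgK.
exists (fun y => ku * g y * ku^-1)%g.
  move=> x; have [l ll <-] := path_pi1_surj x; have [pl l0 l1] := ll.
  have e1 : kr 1 = l 0 by rewrite kr1 k0 l0.
  have e2 : l 1 = k 0 by rewrite l1 k0.
  have [m0 [m1 [pm mE]]] := ends _ _ _ pkr pl pk e1 e2.
  have lm : loop_in v (concat (concat kr l) k) by split=> //; rewrite ?m0 ?m1 ?kr0.
  rewrite fE // -kv_rev -(mE _ _ pv) gE // (mE _ _ pu) ku_rev.
  by rewrite !mulgA mulgV mul1g mulgK.
move=> y; have [m ll <-] := path_pi1_surj y; have [pm m0 m1] := ll.
have e1 : k 1 = m 0 by rewrite k1 m0.
have e2 : m 1 = kr 0 by rewrite m1 kr0 k1.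
have [l0 [l1 [pl lE]]] := ends _ _ _ pk pm pkr e1 e2.
have ln : loop_in u (concat (concat k m) kr) by split=> //; rewrite ?l0 ?l1 ?kr1.
rewrite gE // -ku_rev -(lE _ _ pu) fE // (lE _ _ pv) kv_rev.
by rewrite !mulgA mulVg mul1g mulgVK.
Qed.
End BaseChange.

Section Reach.
Variables (R : realType) (s : seq R) (B : seq (R * R)).
Local Notation E := (R4 R).
Local Notation M := (model s B).
Implicit Types e : E.

Definition reaches e e' := exists k : R -> E, [/\ path_in M k, k 0 = e & k 1 = e'].

Lemma reaches_trans e2 e1 e3 : reaches e1 e2 -> reaches e2 e3 -> reaches e1 e3.
Proof.
move=> [k [pk k0 k1]] [l [pl l0 l1]]; exists (concat k l).
by split; [apply: path_in_concat; rewrite ?k1|rewrite concat0|rewrite concat1].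
Qed.

Lemma lower_reaches e : lower s B e -> exists2 e', reaches e e' & im1 e' <= -1.
Proof.
move=> Le; have [lam _ lamP] := slopes_bounded B.
(* A slope above the bound gives a line outside [B], and with it a target in [lower] at
   [im1 = -1]. *)
have nB : (lam + 1, 0) \notin B.
  by apply/negP => /lamP /=; have := ler_norm (lam + 1); lra.
have y0 : (-1 : R) != 0 by rewrite oppr_eq0 oner_eq0.
have Me' := (model_on_line s B 0 (lam + 1, 0) y0).2 nB.
have Le' : lower s B (on_line 0 (-1) (lam + 1, 0)) by split=> //; rewrite mk4E; lra.
have [k [pk k0 k1]] := lower_connected Le Le'.
exists (on_line 0 (-1) (lam + 1, 0)); last by rewrite mk4E.
by exists k; split=> //; exact: path_in_sub (@lower_sub _ s B) pk.
Qed.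

Lemma upper_reaches e : upper s B e -> exists2 e', reaches e e' & lower s B e'.
Proof.
move=> Ue; have [Me ye] := Ue.
have [eta [rho [ceta crho rhoE eta_ge0 eta_sep]]] := interpolation B.
have [x0 [/eta_sep eta_x0 x0_min]] := separated_far s B.
exists (landing eta rho x0 e);
  last exact: (landing_lower rhoE eta_x0 x0_min Ue).
have y0 : im1 e != 0 by rewrite gt_eqF.
apply: (@reaches_trans (slide x0 e 1)).
  exists (slide x0 e); rewrite slide0 //; split=> //; split; first by apply: cts_slide; cts.
  by move=> t t01; apply: upper_sub; exact: slide_upper.
exists (fall eta rho x0 (slide x0 e 1)); rewrite fall0; split=> //; split.
  by rewrite /fall; apply: cts_flow => //; cts.
move=> t t01; apply: fall_model => //; last exact: re1_slide.
by apply: upper_sub; apply: slide_upper => //; lra.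
Qed.

Lemma model_reaches e : M e -> exists2 e', reaches e e' & im1 e' <= -1.
Proof.
move=> Me; have [y|y|y] := ltgtP (im1 e) 0; first exact: lower_reaches.
  have [e1 r1 /lower_reaches[e2 r2 y2]] : exists2 e', reaches e e' & lower s B e'.
    exact: upper_reaches.
  by exists e2 => //; exact: reaches_trans r1 r2.
have r0 := clear_radius_gt0 s B e; pose e1 := lowered e (clear_radius s B e / 2).
have b1 : box e (clear_radius s B e) e1 by apply: lowered_box; lra.
have b0 := box_center e r0.
have Le1 : lower s B e1 by split; [exact: (clear_radius_box Me b1)|rewrite /e1 mk4E; lra].
have [e2 r2 y2] := lower_reaches Le1; exists e2 => //.
apply: (@reaches_trans e1) => //; exists (seg e e1); rewrite seg0 seg1; split=> //.
by apply: path_in_sub (clear_radius_box Me) _; apply: path_in_seg => //; exact: convex_box.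
Qed.

End Reach.

(* Moving the base point removes the position hypothesis of [model_split]. *)
Theorem model_split_any (R : realType) (s : seq R) (B : seq (R * R)) (u : model s B)
    (u' : model [::] B) : sorted <%R s -> set_val u' = set_val u ->
  (forall a, a \in s -> distinct_at B a) ->
  group_isomorphic (pi1 R u) (free_group 'I_(size s) * pi1 R u')%type.
Proof.
move=> ss u'E sB; have [e [k [pk k0 k1]] ye] := model_reaches (set_valP u).
have Me : model s B e by rewrite -k1; apply: pk.2; lra.
have Me' : model [::] B e := model_sub Me.
pose v : model s B := SigSub (mem_set Me).
pose v' : model [::] B := SigSub (mem_set Me').
apply: (@group_isomorphic_trans (pi1 R v)).
  by apply: (pi1_base_change pk).
apply: group_isomorphic_trans (model_split (u := v) (u' := v') ss ye erefl sB) _.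
apply: group_isomorphic_prod; first exact: group_isomorphic_refl.
apply: group_isomorphic_sym; apply: (pi1_base_change (k := k)) => //.
  exact: path_in_sub (@model_sub _ s B) pk.
by rewrite u'E.
Qed.

Section ChartComplement.
Variables (R : realType) (a0 a1 : 'rV[R]_3).
Hypothesis a01 : cross a0 a1 != 0.
Local Notation cm a := (map_mx (real_complex R) a : 'rV[Cplx R]_3).
Local Notation chart := (chart a0 a1).
Local Notation point_of := (point_of a01).

Lemma complement_model (L : {fset set (CP2 R)}) s B (u : complement L) (v : model s B) :
  proj_line (cm a0) \in L -> (forall e, complement L (point_of e) <-> model s B e) ->
  set_val v = chart (set_val u) -> group_isomorphic (pi1 R u) (pi1 R v).
Proof.
move=> l0L LM vE; have off (q : complement L) : ~ proj_line (cm a0) (set_val q).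
  by have := set_valP q; apply.
have mchart (q : complement L) : chart (set_val q) \in model s B.
  by apply/mem_set/LM; rewrite (point_of_chart a01 (off q)); exact: set_valP.
have mpoint (e : model s B) : point_of (set_val e) \in complement L.
  by apply/mem_set/LM; exact: set_valP.
pose phi q : model s B := SigSub (mchart q); pose psi e : complement L := SigSub (mpoint e).
have cphi : continuous phi.
  apply: continuous_comp_initial => q P nP.
  by have := @initial_continuous _ _ set_val q _ (near_chart (off q) nP).
have cpsi : continuous psi.
  apply: continuous_comp_initial.
  have cv : continuous (fun e : model s B => set_val e : R4 R) by exact: initial_continuous.
  exact: (cts_comp (@cts_point_of _ _ _ a01) cv).
have phiK : cancel phi psi by move=> q; apply: val_inj; exact: (point_of_chart a01 (off q)).
have psiK : cancel psi phi by move=> e; apply: val_inj; exact: chart_point_of.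
have -> : v = phi u by exact: val_inj.
exact: pi1_homeomorphic phiK psiK.
Qed.

(** With two vanishing coefficients the form is a multiple of the form of the line at infinity. *)
Lemma chart_coef_neq0 b : b != 0 -> proj_line (cm b) != proj_line (cm a0) -> chart_coef2 a0 a1 b = 0 ->
  chart_coef1 a0 a1 b != 0.
Proof.
move=> b0 bl c2; apply/eqP => c1.
have e v : proj_line (cm b) (proj_point v) <-> (chart_coef0 a0 a1 b)%:C%C * dot (cm a0) (coords v) = 0.
  by rewrite (chart_coef_line a01) c1 c2 !mul0r !addr0.
(* If the third coefficient vanishes too, every point is on the line, among them the one with
   coordinates [b], so that [dot b b = 0]. *)
have [c0|c0] := eqVneq (chart_coef0 a0 a1 b) 0.
  have nz : cm b \in [set v : 'rV[Cplx R]_3 | v != 0] by apply/mem_set; rewrite /= map_mx_eq0.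
  have : proj_line (cm b) (proj_point (SigSub nz : nonzero_vec R)) by apply/e; rewrite c0 mul0r.
  move/line_proj; change (coords _) with (cm b).
  rewrite (map_dot (real_complex R)) => /eqP; rewrite fmorph_eq0 => /eqP/dot_self_eq0 bz.
  by rewrite bz eqxx in b0.
move/eqP: bl; apply; apply/seteqP; split=> q; have [v ->] := proj_point_surj q.
  move=> /e/eqP; rewrite mulf_eq0 fmorph_eq0 (negbTE c0) => /eqP h; exact/line_proj.
by move=> /line_proj h; apply/e; rewrite h mulr0.
Qed.

Definition vertical_at b : R := - chart_coef0 a0 a1 b / chart_coef1 a0 a1 b.
Definition graph_of b : R * R :=
  (- chart_coef1 a0 a1 b / chart_coef2 a0 a1 b, - chart_coef0 a0 a1 b / chart_coef2 a0 a1 b).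

Lemma vertical_line b v : chart_coef2 a0 a1 b = 0 -> chart_coef1 a0 a1 b != 0 ->
  proj_line (cm b) (proj_point v) <->
  dot (cm a1) (coords v) = (vertical_at b)%:C%C * dot (cm a0) (coords v).
Proof.
move=> c2 c1; rewrite (chart_coef_line a01) c2 mul0r addr0.
rewrite /vertical_at; move: (dot _ _) (dot _ _) => x y.
have c1' : (chart_coef1 a0 a1 b)%:C%C != 0 :> Cplx R by rewrite fmorph_eq0.
rewrite rmorphM rmorphN fmorphV; split=> [/eqP|->].
  by rewrite addrC addr_eq0 => /eqP h; apply: (mulfI c1'); rewrite h; field.
by field.
Qed.

Lemma vertical_point b e : chart_coef2 a0 a1 b = 0 -> chart_coef1 a0 a1 b != 0 ->
  proj_line (cm b) (point_of e) <-> re1 e = vertical_at b /\ im1 e = 0.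
Proof.
move=> c2 c1; rewrite line_point_of c2 !mul0r !addr0 /vertical_at; split=> -[h1 h2].
  split; first by apply: (mulfI c1); rewrite mulrC -[RHS]mulrC mulfVK // mulrC; lra.
  by apply/eqP; move/eqP: h2; rewrite mulf_eq0 (negbTE c1).
by rewrite h1 h2 mulr0; split=> //; field.
Qed.

Lemma graph_point b e : chart_coef2 a0 a1 b != 0 ->
  proj_line (cm b) (point_of e) <->
  re2 e = value (graph_of b) (re1 e) /\ im2 e = (graph_of b).1 * im1 e.
Proof.
move=> c2; rewrite line_point_of /value /graph_of /=; move: (chart_coef0 _ _ _) (chart_coef1 _ _ _) (chart_coef2 _ _ _) c2 => x y z z0.
split=> -[h1 h2].
  split; apply: (mulfI z0).
    transitivity (- x - y * re1 e); first by lra.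
    by field.
  transitivity (- (y * im1 e)); first by lra.
  by field.
by rewrite h1 h2; split; field.
Qed.

End ChartComplement.

(** * Removing a pencil of lines from an arrangement *)

Section Forms.
Variable R : realType.
Local Notation cm a := (map_mx (real_complex R) a : 'rV[Cplx R]_3).
Implicit Types (l : set (CP2 R)) (a b : 'rV[R]_3).

Definition line_form l : 'rV[R]_3 := xget 0 [set a | a != 0 /\ l = proj_line (cm a)].

Lemma line_formP l : real_line l -> line_form l != 0 /\ proj_line (cm (line_form l)) = l.
Proof.
move=> [a a0 lE]; have [|b0 bE] := @xgetPex _ 0 [set a | a != 0 /\ l = proj_line (cm a)].
  by exists a.
by split=> //; rewrite -bE.
Qed.

Lemma double_cross (K : comNzRingType) (a b : 'rV[K]_3) :
  cross b (cross a b) = dot b b *: a - dot a b *: b.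
Proof. by apply/rowP => i; move: i; apply: ord3P; rewrite !mxE !dotE /=; ring. Qed.

Lemma dot_mapZ (K K' : comNzRingType) (f : {rmorphism K -> K'}) (c : K) (b : 'rV[K]_3) v :
  dot (map_mx f (c *: b)) v = f c * dot (map_mx f b) v.
Proof. by rewrite map_mxZ dotC dotZr dotC. Qed.

(** Otherwise [double_cross] makes [a] a multiple of [b], and proportional forms have the same
    line. *)
Lemma cross_neq0 a b : a != 0 -> b != 0 -> proj_line (cm a) != proj_line (cm b) ->
  cross a b != 0.
Proof.
move=> a0 b0 /eqP ab; apply/eqP => c0; apply: ab.
have bb : dot b b != 0 by apply/eqP => /dot_self_eq0 h; rewrite h eqxx in b0.
have aE : a = (dot a b / dot b b) *: b.
  apply: (scalerI bb); rewrite scalerA mulrC mulfVK //; apply/eqP; rewrite -subr_eq0.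
  by rewrite -double_cross c0; apply/eqP/rowP => i; move: i; apply: ord3P; rewrite !mxE /= !mulr0 subrr.
have c1 : dot a b / dot b b != 0 by apply: contraNneq a0 => h; rewrite aE h scale0r.
move: (dot a b / dot b b) aE c1 => c -> c1.
apply/seteqP; split=> q; have [v ->] := proj_point_surj q => /line_proj h; apply/line_proj; move: h.
  rewrite (dot_mapZ (real_complex R)) => /eqP.
  by rewrite mulf_eq0 fmorph_eq0 (negbTE c1) => /eqP.
by rewrite (dot_mapZ (real_complex R)) => ->; rewrite mulr0.
Qed.

End Forms.

Section Peel.
Local Open Scope fset_scope.
Local Open Scope ring_scope.
Variables (R : realType) (L : {fset set (CP2 R)}).
Local Notation cm a := (map_mx (real_complex R) a : 'rV[Cplx R]_3).
Hypothesis L_real : forall l, l \in L -> real_line l.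
Implicit Types (l : set (CP2 R)) (p q : CP2 R).

Lemma multiplicity_gt2 l1 l2 l3 q : l1 \in L -> l2 \in L -> l3 \in L -> l1 q -> l2 q -> l3 q ->
  l1 != l2 -> l1 != l3 -> l2 != l3 -> multiple_point L q.
Proof.
move=> L1 L2 L3 q1 q2 q3 n12 n13 n23; rewrite /multiple_point /multiplicity.
have -> : 3%N = size [:: l1; l2; l3] by [].
apply: uniq_leq_size; first by rewrite /= !inE negb_or n12 n13 n23.
by move=> l; rewrite !inE /= => /or3P[] /eqP ->; apply/andP; split=> //; exact/asboolP.
Qed.

(* Lines through [p] other than [l0] become vertical once [l0] is at infinity. *)
Theorem pi1_peel l0 l1 p (u : complement L)
    (u' : complement [fset l in L | (l == l0) || ~~ `[< l p >]]) :
  l0 \in L -> l1 \in L -> l0 != l1 -> l0 p -> l1 p ->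
  (forall l q, l \in L -> l p -> l != l0 -> l q -> multiple_point L q -> q = p) ->
  set_val u' = set_val u ->
  group_isomorphic (pi1 R u) (free_group 'I_(multiplicity L p - 1) * pi1 R u')%type.
Proof.
move=> l0L l1L l01 l0p l1p alone u'E.
have [f0 f0E] := line_formP (L_real l0L); have [f1 f1E] := line_formP (L_real l1L).
pose a0 := line_form l0; pose a1 := line_form l1.
have a01 : cross a0 a1 != 0 by apply: cross_neq0; rewrite ?f0E ?f1E.
have thr l : l \in L -> l p <-> chart_coef2 a0 a1 (line_form l) = 0.
  move=> lL; have [_ lE] := line_formP (L_real lL).
  by rewrite -{1}lE; apply: (center_line a01); rewrite ?f0E ?f1E.
have coef1_neq0 l : l \in L -> l != l0 -> l p -> chart_coef1 a0 a1 (line_form l) != 0.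
  move=> lL ll0 lp; have [b0 lE] := line_formP (L_real lL).
  by apply: (chart_coef_neq0 a01) => //; rewrite ?lE ?f0E //; exact: (thr l lL).1.
pose V := [fset l in L | `[< l p >]] `\ l0.
have VP l : l \in V = [&& l != l0, l \in L & `[< l p >]] by rewrite !inE.
pose W := [fset l in L | ~~ `[< l p >]].
have WP l : l \in W = (l \in L) && ~~ `[< l p >] by rewrite !inE.
pose s := sort <=%R [seq vertical_at a0 a1 (line_form l) | l <- V].
pose B := [seq graph_of a0 a1 (line_form l) | l <- W].
have vertV l e : l \in V -> l (point_of a01 e) <-> re1 e = vertical_at a0 a1 (line_form l) /\ im1 e = 0.
  rewrite VP => /and3P[ll0 lL /asboolP lp]; have [b0 lE] := line_formP (L_real lL).
  rewrite -{1}lE; apply: vertical_point; [exact: (thr l lL).1|exact: coef1_neq0].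
have graphW l e : l \in W -> l (point_of a01 e) <-> re2 e = value (graph_of a0 a1 (line_form l)) (re1 e) /\
    im2 e = (graph_of a0 a1 (line_form l)).1 * im1 e.
  rewrite WP => /andP[lL /asboolP lp]; have [b0 lE] := line_formP (L_real lL).
  by rewrite -{1}lE; apply: graph_point; apply/eqP => h; apply: lp; exact: (thr l lL).2.
have infty e : ~ l0 (point_of a01 e) by rewrite -{1}f0E; exact: point_of_infinity.
have LM e : complement L (point_of a01 e) <-> model s B e.
  split=> [Le|[es eB] l lL].
    split=> [a|cd].
      rewrite mem_sort => /mapP[l lV ->] /(vertV l e lV); apply: Le.
      by move: lV; rewrite VP => /and3P[].
    move=> /mapP[l lW ->] /(graphW l e lW); apply: Le.
    by move: lW; rewrite WP => /andP[].
  have [->|ll0] := eqVneq l l0; first exact: infty.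
  have [lp|lp] := boolP `[< l p >].
    have lV : l \in V by rewrite VP ll0 lL lp.
    by move/(vertV l e lV); apply: es; rewrite mem_sort; apply: map_f.
  have lW : l \in W by rewrite WP lL lp.
  by move/(graphW l e lW); apply: eB; apply: map_f.
have LM' e : complement [fset l in L | (l == l0) || ~~ `[< l p >]] (point_of a01 e) <-> model [::] B e.
  split=> [Le|[_ eB] l].
    split=> // cd /mapP[l lW ->] /(graphW l e lW); apply: Le.
    by move: lW; rewrite WP !inE => /andP[-> ->]; rewrite orbT.
  rewrite !inE => /andP[lL /orP[/eqP->|lp]]; first exact: infty.
  have lW : l \in W by rewrite WP lL lp.
  by move/(graphW l e lW); apply: eB; apply: map_f.
(* Two graphs meeting on [z = a] would create a multiple point on a line through [p]; it is finite,
   whereas [p] is at infinity. *)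
have sB a : a \in s -> distinct_at B a.
  rewrite mem_sort => /mapP[l lV aE] _ _ /mapP[l2 W2 ->] /mapP[l3 W3 ->] e23.
  have [->//|n23] := eqVneq l2 l3; exfalso.
  pose q := point_of a01 (mk4 a 0 (value (graph_of a0 a1 (line_form l2)) a) 0).
  have lq : l q by apply/(vertV l _ lV); rewrite !mk4E.
  have q2 : l2 q by apply/(graphW l2 _ W2); rewrite !mk4E mulr0.
  have q3 : l3 q by apply/(graphW l3 _ W3); rewrite !mk4E mulr0.
  have [ll0 lL /asboolP lp] := and3P (etrans (esym (VP l)) lV).
  have [L2 p2] := andP (etrans (esym (WP l2)) W2).
  have [L3 p3] := andP (etrans (esym (WP l3)) W3).
  have lp' : `[< l p >] by apply/asboolP.
  have n2 : l != l2 by apply: contraNneq p2 => <-.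
  have n3 : l != l3 by apply: contraNneq p3 => <-.
  have qp := alone l q lL lp ll0 lq (multiplicity_gt2 lL L2 L3 lq q2 q3 n2 n3 n23).
  by apply: (infty (mk4 a 0 (value (graph_of a0 a1 (line_form l2)) a) 0)); rewrite -/q qp.
have s_sorted : sorted <%R s.
  rewrite sort_lt_sorted map_inj_in_uniq ?fset_uniq // => l l' lV lV' e.
  have [ll0 lL /asboolP lp] := and3P (etrans (esym (VP l)) lV).
  have [ll0' lL' /asboolP lp'] := and3P (etrans (esym (VP l')) lV').
  have [_ <-] := line_formP (L_real lL); have [_ <-] := line_formP (L_real lL').
  apply/seteqP; split=> q; have [w ->] := proj_point_surj q.
    move/(vertical_line a01 _ ((thr l lL).1 lp) (coef1_neq0 _ lL ll0 lp)).
    by rewrite e => h; apply/(vertical_line a01 _ ((thr l' lL').1 lp') (coef1_neq0 _ lL' ll0' lp')).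
  move/(vertical_line a01 _ ((thr l' lL').1 lp') (coef1_neq0 _ lL' ll0' lp')).
  by rewrite -e => h; apply/(vertical_line a01 _ ((thr l lL).1 lp) (coef1_neq0 _ lL ll0 lp)).
(* The line [l0] also passes through [p] but is at infinity, hence the subtracted 1. *)
have s_size : size s = (multiplicity L p - 1)%N.
  rewrite size_sort size_map /multiplicity (cardfsD1 l0 [fset l in L | `[< l p >]]).
  have -> : l0 \in [fset l in L | `[< l p >]] by rewrite !inE l0L; exact/asboolP.
  by rewrite add1n subn1.
have off : ~ proj_line (cm a0) (set_val u) by rewrite f0E; have := set_valP u; apply.
have uM : chart a0 a1 (set_val u) \in model s B.
  by apply/mem_set/LM; rewrite (point_of_chart a01 off); exact: set_valP.
have uM' : chart a0 a1 (set_val u) \in model [::] B.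
  by apply/mem_set; apply: model_sub; exact: set_mem uM.
have i1 : group_isomorphic (pi1 R u) (pi1 R (SigSub uM : model s B)).
  by apply: (complement_model _ LM) => //=; rewrite f0E.
have i2 : group_isomorphic (pi1 R u') (pi1 R (SigSub uM' : model [::] B)).
  apply: (complement_model _ LM'); first by rewrite f0E !inE l0L eqxx.
  by rewrite u'E.
rewrite -s_size; apply: group_isomorphic_trans i1 _.
apply: group_isomorphic_trans (model_split_any (u := SigSub uM : model s B)
  (u' := SigSub uM' : model [::] B) s_sorted erefl sB) _.
by apply: group_isomorphic_prod; [exact: group_isomorphic_refl|exact: group_isomorphic_sym].
Qed.
End Peel.

(** * Infinite cyclic groups and finite products *)

Section FreeGroupOnOne.
Local Notation F := (free_group 'I_1).
Local Notation Z := (GRing.to_multiplicative int).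
Local Notation x := (free_gen (ord0 : 'I_1)).

Lemma free_group1_power (a : F) : exists m n, a = (x ^+ m * (x ^+ n)^-1)%g.
Proof.
have cx m n : ((x ^+ n)^-1 * x ^+ m = x ^+ m * (x ^+ n)^-1)%g.
  by apply/commute_sym/commuteV/commuteX2/commute_refl.
move: a; apply: free_gen_ind.
- by exists 0%N, 0%N; rewrite expg0 invg1 mulg1.
- move=> _ _ [m [n ->]] [m' [n' ->]]; exists (m + m')%N, (n' + n)%N.
  by rewrite !expgnDr invgM !mulgA -(mulgA (x ^+ m)%g) cx !mulgA.
- move=> _ [m [n ->]]; exists n, m.
  by rewrite invgM invgK.
- by move=> i; exists 1%N, 0%N; rewrite expg1 expg0 invg1 mulg1 (ord1 i).
Qed.

Lemma free_group1 : group_isomorphic F Z.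
Proof.
pose f := free_eval (fun _ : 'I_1 => 1%R : Z).
have fM v w : f (v * w)%g = (f v * f w)%g by exact: free_evalM.
have fX n : f (x ^+ n)%g = n%:Z :> int.
  elim: n => [|n IH]; first by rewrite expg0 (morph_one fM).
  rewrite expgS fM IH /f free_eval_gen.
  by change (1 + n%:Z = n.+1%:Z); rewrite intS.
have fE m n : f (x ^+ m * (x ^+ n)^-1)%g = m%:Z - n%:Z :> int.
  rewrite fM (morph_inv fM).
  change ((f (x ^+ m)%g : int) - (f (x ^+ n)%g : int) = m%:Z - n%:Z).
  by rewrite (fX m) (fX n).
apply: (bijective_isomorphic fM); apply: inj_surj_bijective => [a b ab|z].
  apply: (mulIg (b^-1)%g); rewrite mulgV.
  have : f (a * b^-1)%g = 0 :> int by rewrite fM (morph_inv fM) ab mulgV.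
  have [m [n ->]] := free_group1_power (a * b^-1)%g.
  by rewrite fE => /eqP; rewrite subr_eq0 => /eqP[->]; rewrite mulgV.
case: z => n; first by exists (x ^+ n)%g; exact: fX.
exists (x ^+ 0 * (x ^+ n.+1)^-1)%g; rewrite fE sub0r.
by rewrite NegzE.
Qed.

End FreeGroupOnOne.

Lemma direct_prod_recl k (G : 'I_k.+1 -> groupType) :
  group_isomorphic (direct_prod G) (G ord0 * direct_prod (fun i => G (lift ord0 i)))%type.
Proof.
pose f (v : direct_prod G) : (G ord0 * direct_prod (fun i => G (lift ord0 i)))%type :=
  (v ord0, [ffun i => v (lift ord0 i)]).
apply: (@bijective_isomorphic _ _ f).
  move=> v w; congr pair; first by rewrite ffunE.
  by apply/ffunP => i; rewrite !ffunE.
apply: inj_surj_bijective => [v w [h0 /ffunP h]|[a b]].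
  by apply/ffunP => i; case: (unliftP ord0 i) => [j|] -> //; have := h j; rewrite !ffunE.
(* The family is dependent, so values are transported along the equation for [i]; over ordinals such
   a transport along a loop is trivial. *)
pose g i : G i := match unliftP ord0 i with
  | UnliftSome j e => ecast i (G i) (esym e) (b j)
  | UnliftNone e => ecast i (G i) (esym e) a end.
exists [ffun i => g i]; congr pair.
  rewrite ffunE /g; case: unliftP => [j e|e]; first by have /eqP := neq_lift ord0 j.
  by rewrite (eq_axiomK e).
apply/ffunP => i; rewrite !ffunE /g; case: unliftP => [j e|e].
  by move/lift_inj: (e) => ij; subst j; rewrite (eq_axiomK e).
by have /eqP h := neq_lift ord0 i; case: h; exact: esym.
Qed.

Lemma ffun_recl (G : groupType) r :
  group_isomorphic {ffun 'I_r.+1 -> G} (G * {ffun 'I_r -> G})%type.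
Proof.
pose f (v : {ffun 'I_r.+1 -> G}) : (G * {ffun 'I_r -> G})%type := (v ord0, [ffun i => v (lift ord0 i)]).
apply: (@bijective_isomorphic _ _ f).
  move=> v w; congr pair; first by rewrite ffunE.
  by apply/ffunP => i; rewrite !ffunE.
exists (fun ab : G * {ffun 'I_r -> G} =>
  [ffun i : 'I_r.+1 => if unlift ord0 i is Some j then ab.2 j else ab.1] : {ffun 'I_r.+1 -> G}).
  by move=> v; apply/ffunP => i; rewrite ffunE; case: unliftP => [j|] -> //=; rewrite ffunE.
move=> [a b]; congr pair; first by rewrite ffunE unlift_none.
by apply/ffunP => i; rewrite !ffunE liftK.
Qed.

(** * The complement of one line, and meeting points of lines *)

Section OneLine.
Local Open Scope fset_scope.
Local Open Scope ring_scope.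
Variable R : realType.
Local Notation cm a := (map_mx (real_complex R) a : 'rV[Cplx R]_3).

Lemma pi1_affine (u : model ([::] : seq R) [::]) (a : pi1 R u) : a = 1%g.
Proof.
have [k [pk k0 k1] <-] := path_pi1_surj a; have pu := path_pi1_functor R u.
have all_model e : model ([::] : seq R) [::] e by split.
have convex : convex_set (model ([::] : seq R) [::]) by move=> *; exact: all_model.
have pc : path_in (model ([::] : seq R) [::]) (cst (set_val u)) by split=> //; exact: cts_cst.
rewrite (functor_convex (l := cst (set_val u)) pu convex) //.
by apply: (functor_cst pu (e := set_val u)).
Qed.

(** If all products vanish, [a] is proportional to each basis vector, and a basis vector other than
    the [i]-th kills the [i]-th coordinate. *)
Lemma cross_neq0_exists (a : 'rV[R]_3) : a != 0 -> exists b, cross a b != 0.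
Proof.
move=> a0; apply: contrapT => h.
have c b : cross a b = 0 by apply/eqP/negPn/negP => cb; apply: h; exists b.
have aE b : dot b b *: a = dot a b *: b.
  apply/eqP; rewrite -subr_eq0 -double_cross c; apply/eqP/rowP => i; move: i.
  by apply: ord3P; rewrite !mxE /= !mulr0 subrr.
have az i : a 0 i = 0.
  have [j ij] : exists j : 'I_3, j != i.
    by exists (if i == ord0 then ord_max else ord0); case: (eqVneq i ord0) => [->|] //; rewrite eq_sym.
  have := congr1 (fun v : 'rV[R]_3 => v 0 i) (aE (delta_mx 0 j)).
  rewrite !mxE eq_sym (negbTE ij) mulr0 => /eqP; rewrite mulf_eq0 => /orP[/eqP d|/eqP //].
  by have := dot_self_eq0 d => /rowP/(_ j); rewrite !mxE !eqxx => /eqP; rewrite oner_eq0.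
by move/eqP: a0; apply; apply/rowP => i; rewrite az mxE.
Qed.

Lemma pi1_one_line (L : {fset set (CP2 R)}) l0 (u : complement L) (a : pi1 R u) :
  real_line l0 -> L = [fset l0] -> a = 1%g.
Proof.
move=> rl0 LE; have [f0 f0E] := line_formP rl0.
have [a1 a01] := cross_neq0_exists f0.
have l0L : proj_line (cm (line_form l0)) \in L by rewrite f0E LE !inE.
have LM e : complement L (point_of a01 e) <-> model [::] [::] e.
  split=> // _ l; rewrite LE => /fset1P ->.
  by rewrite -{1}f0E; exact: point_of_infinity.
have uM : chart (line_form l0) a1 (set_val u) \in model [::] [::] by exact/mem_set.
have [f [g fK gK]] := complement_model (v := SigSub uM : model [::] [::]) l0L LM erefl.
by apply: (can_inj fK); rewrite (pi1_affine (f a)) (pi1_affine (f 1%g)).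
Qed.

Lemma lines_meet l l' : real_line l -> real_line l' -> l != l' -> exists q : CP2 R, l q /\ l' q.
Proof.
move=> rl rl' ll'; have [f0 f0E] := line_formP rl; have [f1 f1E] := line_formP rl'.
have c0 : cross (line_form l) (line_form l') != 0 by apply: cross_neq0; rewrite ?f0E ?f1E.
have nz : cm (cross (line_form l) (line_form l')) \in [set v : 'rV[Cplx R]_3 | v != 0].
  by apply/mem_set; rewrite /= map_mx_eq0.
have [q qP] : exists q : CP2 R, forall b, dot b (cross (line_form l) (line_form l')) = 0 ->
    proj_line (cm b) q.
  exists (proj_point (SigSub nz : nonzero_vec R)) => b b0; apply/line_proj.
  change (coords _) with (cm (cross (line_form l) (line_form l'))).
  by rewrite (map_dot (real_complex R)) b0 rmorph0.
have := qP _ (cross_dot0 _ _); have := qP _ (cross_dot1 _ _).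
by rewrite f0E f1E; exists q.
Qed.

End OneLine.

(** * Induction on multiple points and on lines *)

Section Arrangements.
Local Open Scope fset_scope.
Local Open Scope ring_scope.
Variable R : realType.
Local Notation Z := (GRing.to_multiplicative int).
Implicit Types (L : {fset set (CP2 R)}) (l : set (CP2 R)) (p q : CP2 R).

Definition alone_on L l0 p := forall l q, l \in L -> l p -> l != l0 -> l q ->
  multiple_point L q -> q = p.

(** A local form of the collinearity hypothesis that passes directly to the arrangement with a
    pencil peeled off. *)
Definition starred L := forall q, multiple_point L q ->
  exists l0, [/\ l0 \in L, l0 q & alone_on L l0 q].

Definition peeled L l0 p := [fset l in L | (l == l0) || ~~ `[< l p >]].

Lemma multiplicity_sub L L' q : L' `<=` L -> (multiplicity L' q <= multiplicity L q)%N.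
Proof.
move=> /fsubsetP sub; apply/fsubset_leq_card/fsubsetP => l.
by rewrite !inE /= => /andP[/sub -> ->].
Qed.

Section Peeled.
Variables (L : {fset set (CP2 R)}) (l0 : set (CP2 R)) (p : CP2 R).
Hypotheses (l0L : l0 \in L) (l0p : l0 p) (l0_alone : alone_on L l0 p).
Local Notation L' := (peeled L l0 p).

Lemma peeled_sub : L' `<=` L.
Proof. by apply/fsubsetP => l; rewrite !inE /= => /andP[]. Qed.

Lemma mem_peeled : l0 \in L'.
Proof. by rewrite !inE l0L eqxx. Qed.

Lemma card_peeled : #|` L| = ((multiplicity L p - 1) + #|` L'|)%N.
Proof.
pose V := [fset l in L | `[< l p >]] `\ l0.
have VL : V `<=` L by apply/fsubsetP => l; rewrite !inE => /and3P[].
have -> : (multiplicity L p - 1)%N = #|` V|.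
  rewrite /multiplicity (cardfsD1 l0 [fset l in L | `[< l p >]]).
  have -> : l0 \in [fset l in L | `[< l p >]] by rewrite !inE l0L; exact/asboolP.
  by rewrite add1n subn1.
have -> : L' = L `\` V.
  apply/fsetP => l; rewrite !inE; case: (l \in L) => //=; last by rewrite !andbF.
  by rewrite negb_and negbK !andbT.
by rewrite cardfsDS // subnKC // fsubset_leq_card.
Qed.

(** A removed line goes through [p] and carries no other multiple point, so no line through [q] is
    lost. *)
Lemma multiplicity_peeled q : multiple_point L q -> q <> p -> multiplicity L' q = multiplicity L q.
Proof.
move=> mq qp; congr (#|` _|); apply/fsetP => l; rewrite !inE /=.
have [lL|] //= := boolP (l \in L); have [ll0|ll0] //= := eqVneq l l0.
have [/asboolP lq|] := boolP `[< l q >]; last by rewrite andbF.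
rewrite andbT; apply/negP => /asboolP lp; exact: qp (l0_alone lL lp ll0 lq mq).
Qed.

Lemma multiple_peeled q : multiple_point L' q <-> multiple_point L q /\ q <> p.
Proof.
split=> [mq|[mq qp]]; last by rewrite /multiple_point multiplicity_peeled.
split; first by apply: leq_trans mq _; exact: multiplicity_sub peeled_sub.
(* At [p] itself only [l0] is left. *)
move=> qp; move: mq; rewrite qp /multiple_point ltnNge => /negP; apply.
apply: (@leq_trans #|` [fset l0]|); last by rewrite cardfs1.
apply/fsubset_leq_card/fsubsetP => l lL; apply/fset1P; move: lL; rewrite !inE /=.
by case: eqVneq => //= _; case: (`[< l p >]); rewrite /= ?andbF.
Qed.

Lemma starred_peeled : starred L -> starred L'.
Proof.
move=> sL q mq'; have [mq qp] := (multiple_peeled q).1 mq'.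
have [l [lL lq la]] := sL q mq; exists l; split=> //.
  have : l \in [fset l in L | `[< l q >]] by rewrite !inE lL; exact/asboolP.
  rewrite (_ : [fset l in L | `[< l q >]] = [fset l in L' | `[< l q >]]).
    by rewrite !inE => /andP[].
  apply/fsetP => l2; rewrite !inE /=.
  have [l2L|] //= := boolP (l2 \in L); have [ll0|ll0] //= := eqVneq l2 l0.
  have [/asboolP l2q|] := boolP `[< l2 q >]; last by rewrite andbF.
  rewrite andbT; apply/esym/negP => /asboolP lp; exact: qp (l0_alone l2L lp ll0 l2q mq).
move=> l2 q2 l2L l2q l2l l2q2 mq2; apply: (la l2) => //.
  by move/fsubsetP: peeled_sub; apply.
by case: ((multiple_peeled q2).1 mq2).
Qed.

Lemma complement_peeled (u : complement L) : set_val u \in complement L'.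
Proof.
by apply/mem_set => l lL'; have := set_valP u; apply; move/fsubsetP: peeled_sub; apply.
Qed.

End Peeled.

Lemma trivial_isomorphic (G H : groupType) : (forall a : G, a = 1%g) -> (forall b : H, b = 1%g) ->
  group_isomorphic G H.
Proof.
move=> tG tH; apply: (@bijective_isomorphic G H (fun _ => 1%g)); first by move=> *; rewrite mulg1.
by exists (fun _ => 1%g) => [a|b]; rewrite ?tG ?tH.
Qed.

(** Any two lines meet in a double point, and peeling there removes exactly one line and splits off
    a free group of rank 1. The condition on other multiple points is void. *)
Lemma pi1_simple n L (u : complement L) : (forall l, l \in L -> real_line l) -> #|` L| = n.+1 ->
  (forall q, ~~ multiple_point L q) -> group_isomorphic (pi1 R u) {ffun 'I_n -> Z}.
Proof.
elim: n L u => [|n IH] L u rL cL sL.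
  have /cardfs1P[l0 LE] : #|` L| == 1%N by rewrite cL.
  apply: trivial_isomorphic => [a|b]; last by apply/ffunP => -[].
  by apply: (pi1_one_line (l0 := l0)) => //; apply: rL; rewrite LE !inE.
have /fset0Pn[l0 l0L] : L != fset0 by rewrite -cardfs_gt0 cL.
have /fset0Pn[l1] : L `\ l0 != fset0.
  by rewrite -cardfs_gt0; move: cL; rewrite (cardfsD1 l0) l0L add1n => -[->].
rewrite !inE eq_sym => /andP[l01 l1L].
have [p [l0p l1p]] := lines_meet (rL _ l0L) (rL _ l1L) l01.
have la : alone_on L l0 p by move=> l q _ _ _ _ mq; have := sL q; rewrite mq.
have m2 : multiplicity L p = 2%N.
  apply/eqP; rewrite eqn_leq leqNgt [(_ < _)%N](negbTE (sL p)) /=.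
  apply: (@uniq_leq_size _ [:: l0; l1]); first by rewrite /= inE l01.
  by move=> l; rewrite !inE /= => /orP[] /eqP ->; apply/andP; split=> //; exact/asboolP.
pose u' : complement (peeled L l0 p) := SigSub (complement_peeled l0 p u).
have [cL'] : (1 + #|` peeled L l0 p|)%N = n.+2 by rewrite -cL (card_peeled l0L l0p) m2.
have rL' l : l \in peeled L l0 p -> real_line l.
  by move=> lL'; apply: rL; move/fsubsetP: (peeled_sub L l0 p); apply.
have sL' q : ~~ multiple_point (peeled L l0 p) q.
  by apply: contra (sL q); case/(multiple_peeled la).
have iso := pi1_peel (u' := u') rL l0L l1L l01 l0p l1p la erefl.
rewrite m2 in iso; apply: group_isomorphic_trans iso _.
apply: group_isomorphic_trans (group_isomorphic_sym (ffun_recl _ _)).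
by apply: group_isomorphic_prod; [exact: free_group1|exact: IH].
Qed.

(** The rank [r] is produced by the induction together with an additive count of lines: each peeling
    removes [m i - 1] lines, and [r + 1] lines with only double points are left. *)
Theorem pi1_starred k L (p : 'I_k -> CP2 R) (m : 'I_k -> nat) (u : complement L) :
  (forall l, l \in L -> real_line l) -> (0 < #|` L|)%N -> starred L -> injective p ->
  (forall q, multiple_point L q <-> exists i, q = p i) ->
  (forall i, m i = multiplicity L (p i)) ->
  exists r, #|` L| = (1 + r + \sum_(i < k) (m i - 1))%N /\
    group_isomorphic (pi1 R u)
      (direct_prod (fun i : 'I_k => free_group 'I_(m i - 1)) * {ffun 'I_r -> Z})%type.
Proof.
elim: k L p m u => [|k IH] L p m u rL cL sL pinj pP mP.
  case cL1 : #|` L| cL => [//|n] _; exists n; split; first by rewrite big_ord0 addn0 add1n.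
  have : group_isomorphic (pi1 R u) {ffun 'I_n -> Z}.
    by apply: pi1_simple => // q; apply/negP => /pP[[]].
  move/group_isomorphic_trans; apply.
  apply: (@bijective_isomorphic _ _ (fun v : {ffun 'I_n -> Z} =>
    (1%g : direct_prod (fun i : 'I_0 => free_group 'I_(m i - 1)), v))).
    by move=> v w; congr pair; rewrite mulg1.
  by exists snd => // -[a v] /=; congr pair; apply/ffunP => -[].
have mp0 : multiple_point L (p ord0) by apply/pP; exists ord0.
have [l0 [l0L l0p la]] := sL _ mp0.
have [l1 l01 [l1L l1p]] : exists2 l1, l0 != l1 & l1 \in L /\ l1 (p ord0).
  have /fset0Pn[l1] : [fset l in L | `[< l (p ord0) >]] `\ l0 != fset0.
    have l0V : l0 \in [fset l in L | `[< l (p ord0) >]] by rewrite !inE l0L; exact/asboolP.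
    rewrite -cardfs_gt0; move: mp0; rewrite /multiple_point /multiplicity (cardfsD1 l0) l0V.
    by rewrite add1n ltnS => /ltnW.
  by rewrite !inE => /and3P[h1 h2 /asboolP h3]; exists l1 => //; rewrite eq_sym.
pose L' := peeled L l0 (p ord0).
pose u' : complement L' := SigSub (complement_peeled l0 (p ord0) u).
pose p' i := p (lift ord0 i); pose m' i := m (lift ord0 i).
have p'0 i : p' i <> p ord0 by move/pinj/eqP; rewrite eq_sym (negbTE (neq_lift _ _)).
have rL' l : l \in L' -> real_line l.
  by move=> lL'; apply: rL; move/fsubsetP: (peeled_sub L l0 (p ord0)); apply.
have cL' : (0 < #|` L'|)%N by rewrite cardfs_gt0; apply/fset0Pn; exists l0; exact: mem_peeled.
have p'inj : injective p' by move=> i j /pinj/lift_inj.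
have p'P q : multiple_point L' q <-> exists i, q = p' i.
  split=> [/(multiple_peeled la)[/pP[i ->] qp]|[i ->]].
    by case: (unliftP ord0 i) qp => [j|] -> // _; exists j.
  by apply/(multiple_peeled la); split=> //; apply/pP; exists (lift ord0 i).
have m'P i : m' i = multiplicity L' (p' i).
  rewrite /m' mP (multiplicity_peeled la) //.
  by apply/pP; exists (lift ord0 i).
have [r [cE iso]] := IH L' p' m' u' rL' cL' (starred_peeled la sL) p'inj p'P m'P.
exists r; split.
  by rewrite (card_peeled l0L l0p) -mP big_ord_recl /= -/L' cE addnCA.
have iso0 := pi1_peel (u' := u') rL l0L l1L l01 l0p l1p la erefl.
rewrite -mP in iso0; apply: group_isomorphic_trans iso0 _.
apply: group_isomorphic_trans (group_isomorphic_prod (group_isomorphic_refl _) iso) _.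
apply: group_isomorphic_trans (group_isomorphic_prodA _ _ _) _.
apply: group_isomorphic_prod (group_isomorphic_refl _).
exact: group_isomorphic_sym (direct_prod_recl (fun i => free_group 'I_(m i - 1))).
Qed.

End Arrangements.

(** * Counting lines *)

Lemma cross_kernel (F : fieldType) (a b v w : 'rV[F]_3) : let c := cross a b in dot c c != 0 ->
  dot a v = 0 -> dot b v = 0 -> v != 0 -> dot a w = 0 -> dot b w = 0 -> w != 0 ->
  exists2 x, x != 0 & v = x *: w.
Proof.
move=> c c0 v0 v1 vn0 w0 w1 wn0.
have cv : dot c v != 0 by apply: contraNneq vn0 => v2; rewrite (cross_span0 c0 v0 v1 v2).
have cw : dot c w != 0 by apply: contraNneq wn0 => w2; rewrite (cross_span0 c0 w0 w1 w2).
have ev := cross_expand a b v; have ew := cross_expand a b w; move: ev ew.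
rewrite /= -/c v0 v1 w0 w1 !scale0r !add0r => ev ew.
exists (dot c v / dot c w); first by rewrite mulf_neq0 ?invr_neq0.
by apply: (scalerI c0); rewrite scalerA mulrC -scalerA ew scalerA mulfVK.
Qed.

Lemma cardfs_count (T : choiceType) (A : {fset T}) (b : pred T) :
  #|` [fset x in A | b x]%fset| = (\sum_(x <- A) b x)%N.
Proof.
rewrite (eq_bigr (fun x => if b x then 1 else 0)%N) => [|x _]; last by case: (b x).
rewrite -big_mkcond sum1_count -size_filter; apply/perm_size/uniq_perm.
- exact: fset_uniq.
- by rewrite filter_uniq // fset_uniq.
- by move=> x; rewrite mem_filter !inE /= andbC.
Qed.

Section Count.
Variables (R : realType) (L : {fset set (CP2 R)}).
Hypothesis L_real : forall l, l \in L -> real_line l.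
Implicit Types (l : set (CP2 R)) (q : CP2 R).
Local Notation cm a := (map_mx (real_complex R) a : 'rV[Cplx R]_3).

Lemma lines_meet_once l l' q q' : l \in L -> l' \in L -> l != l' -> l q -> l' q -> l q' -> l' q' ->
  q = q'.
Proof.
move=> lL lL' ll'; have [f0 f0E] := line_formP (L_real lL); have [f1 f1E] := line_formP (L_real lL').
have c0 : cross (line_form l) (line_form l') != 0 by apply: cross_neq0; rewrite ?f0E ?f1E.
have N0 := N_neq0 c0.
rewrite -f0E -f1E; have [v ->] := proj_point_surj q; have [w ->] := proj_point_surj q'.
move=> /line_proj v0 /line_proj v1 /line_proj w0 /line_proj w1.
by apply/proj_pointP; apply: (cross_kernel N0 v0 v1 (set_valP v) w0 w1 (set_valP w)).
Qed.

Hypothesis classes_collinear : forall A, linked_classes L A -> exists2 l, l \in L & A `<=` l.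

Lemma center_exists q : exists l, multiple_point L q -> l \in L /\ linked L q `<=` l.
Proof.
have [mq|nq] := boolP (multiple_point L q); last by exists set0.
by have [|l lL ql] := classes_collinear (A := linked L q); [exists q|exists l].
Qed.

Lemma linked_through l q q' : l \in L -> multiple_point L q -> multiple_point L q' ->
  l q -> l q' -> linked L q q'.
Proof.
move=> lL mq mq' lq lq'; exists [:: q']; split=> //=; first by rewrite mq mq'.
by rewrite andbT; apply/asboolP; exists l.
Qed.

Lemma linked_eq q q' : linked L q q' -> linked L q = linked L q'.
Proof.
move=> qq'; apply/seteqP; split=> x; apply: linked_trans => //; exact: linked_sym.
Qed.

(** Another multiple point on [l] is linked to [q], hence lies on [l0]; but two distinct lines share
    one point only. *)
Lemma center_alone l0 q : multiple_point L q -> l0 \in L -> linked L q `<=` l0 ->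
  alone_on L l0 q.
Proof.
move=> mq l0L ql0 l q' lL lq ll0 lq' mq'; apply/esym.
apply: (lines_meet_once lL l0L ll0 lq _ lq').
  by apply: ql0; exact: linked_refl.
by apply: ql0; exact: (linked_through lL).
Qed.

Lemma collinear_starred : starred L.
Proof.
move=> q mq; have [l] := center_exists q => /(_ mq)[lL ql]; exists l; split=> //.
  by apply: ql; exact: linked_refl.
exact: center_alone.
Qed.

Variables (k : nat) (p : 'I_k -> CP2 R).
Hypothesis p_inj : injective p.
Hypothesis pP : forall q, multiple_point L q <-> exists i, q = p i.

(** Fix for each class a line that carries it. A line without multiple points is simple; any other
    line is either one of these fixed lines or passes through exactly one multiple point. *)
Lemma count_lines : exists c, (linked_classes L #= `I_c)%card /\
  #|` L| = (#|` simple_lines L| + c + \sum_(i < k) (multiplicity L (p i) - 1))%N.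
Proof.
have mp i : multiple_point L (p i) by apply/pP; exists i.
have [f fP] : exists f : set (CP2 R) -> set (CP2 R), forall A, linked_classes L A -> f A \in L /\ A `<=` f A.
  have ex A : exists l, linked_classes L A -> l \in L /\ A `<=` l.
    have [cA|nA] := pselect (linked_classes L A); last by exists set0.
    by have [l lL Al] := classes_collinear cA; exists l.
  by exists (fun A => sval (cid (ex A))) => A; case: cid.
have class_p i : linked_classes L (linked L (p i)) by exists (p i) => //; exact: mp.
pose cl i := f (linked L (p i)).
have clL i : cl i \in L by case: (fP _ (class_p i)).
have clp i : cl i (p i) by case: (fP _ (class_p i)) => _; apply; exact: linked_refl.
have alone i : alone_on L (cl i) (p i) by apply: center_alone => //; case: (fP _ (class_p i)).
pose C := [fset cl i | i : 'I_k]%fset.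
have CP l : reflect (exists i, l = cl i) (l \in C).
  apply: (iffP (imfsetP _ _ _ _)) => [[i _ ->]|[i ->]]; first by exists i.
  by exists i; rewrite ?inE.
exists #|` C|; split.
  have eC : ([set` C] #= `I_(#|` C|))%card by exact/card_eq_fsetP.
  apply: card_eq_trans eC.
  (* Multiple points on a common line are linked, so one line cannot carry two classes. *)
  have f_inj : {in linked_classes L &, injective f}.
    move=> A A' /set_mem[q mq <-] /set_mem[q' mq' <-] e; apply: linked_eq.
    have [l1 h1] := fP (linked L q) (ex_intro2 _ _ q mq erefl).
    have [l2 h2] := fP (linked L q') (ex_intro2 _ _ q' mq' erefl).
    apply: (linked_through l1) => //; first by apply: h1; exact: linked_refl.
    by rewrite e; apply: h2; exact: linked_refl.
  rewrite card_eq_sym; have -> : [set` C] = f @` linked_classes L; last exact: inj_card_eq.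
  apply/seteqP; split=> [l /= /CP[i ->]|_ [A [q /pP[i ->] <-] <-]]; first by exists (linked L (p i)).
  by apply/CP; exists i.
have Csub : (C `<=` L)%fset by apply/fsubsetP => l /CP[i ->].
have cardC : #|` C| = (\sum_(l <- L) (l \in C))%N.
  by rewrite -cardfs_count; congr (#|` _|); apply/fsetP => l; rewrite !inE /= andb_idl //; exact: (fsubsetP Csub).
have cardp i : (multiplicity L (p i) - 1)%N = (\sum_(l <- L) ((l != cl i) && `[< l (p i) >]))%N.
  rewrite -cardfs_count /multiplicity (cardfsD1 (cl i) [fset l in L | `[< l (p i) >]]%fset).
  have -> : cl i \in [fset l in L | `[< l (p i) >]]%fset by rewrite !inE clL; exact/asboolP.
  rewrite add1n subn1 /=; congr (#|` _|); apply/fsetP => l; rewrite !inE /=.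
  by rewrite andbCA.
(* After exchanging the sums it remains to see that each line counts once: as a simple line, as a
   fixed line of a class, or at its only multiple point. *)
rewrite (eq_bigr _ (fun i _ => cardp i)) exchange_big /= cardC /simple_lines cardfs_count -!big_split /=.
rewrite card_fset_sum1 [LHS]big_seq [RHS]big_seq; apply: eq_bigr => l lL.
set simple := `[< _ >].
have others i j : l != cl i -> l (p i) -> l (p j) -> j = i.
  by move=> li lp lpj; apply: p_inj; exact: (alone i l (p j) lL lp li lpj (mp j)).
have [ls|lns] := boolP simple.
  have none i : l (p i) -> False.
    move=> lp; have := (asboolW ls) (p i) lp; have := mp i.
    by rewrite /multiple_point /simple_point => m2 /(_ (ltnW m2)) /eqP e; rewrite e in m2.
  have -> : l \in C = false by apply/CP => -[i e]; apply: (none i); rewrite e.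
  by rewrite big1 // => i _; case: asboolP => [/none//|]; rewrite andbF.
have [i lpi] : exists i, l (p i).
  apply: contrapT => h; move/asboolP: lns; apply => q lq m1.
  rewrite /simple_point eqn_leq m1 andbT leqNgt; apply/negP => m2.
  by have /pP[i e] : multiple_point L q by []; apply: h; exists i; rewrite -e.
have [lC|lnC] := boolP (l \in C).
  have [j lj] := CP _ lC; rewrite big1 // => i' _.
  case: eqVneq => //= li'; case: asboolP => //= lpi'.
  have e : j = i' by apply: (others i' j) => //; rewrite lj.
  by rewrite lj e eqxx in li'.
have li : l != cl i by apply: contraNneq lnC => e; apply/CP; exists i.
rewrite (bigD1 i) //= li (asboolT lpi) /= big1 // => j ji.
by case: asboolP => [lpj|]; rewrite ?andbF //; rewrite (others i j) ?eqxx in ji.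
Qed.

End Count.

Theorem theorem5p3p1 (R : realType) (n : nat) (L : {fset set (CP2 R)})
    (hn : (1 <= n)%N)
    (hLn : #|` L| = n)
    (hLreal : forall l, l \in L -> real_line l)
    (linf : set (CP2 R))
    (hlinf : complex_line linf)
    (hlinfL : linf \notin L)
    (hfinite : forall l l' q, l \in L -> l' \in L -> l != l' ->
       l q -> l' q -> ~ linf q)
    (k : nat) (p : 'I_k -> CP2 R) (m : 'I_k -> nat)
    (hpinj : injective p)
    (hp : range p = [set q | multiple_point L q])
    (hm : forall i, m i = multiplicity L (p i))
    (hcol : forall A, linked_classes L A -> exists2 l, l \in L & A `<=` l)
    (u0 : complement L) :
  exists r c : nat,
    [/\ r%:Z = n%:Z - 1 - \sum_(i < k) ((m i)%:Z - 1),
        group_isomorphic (pi1 R u0)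
          (direct_prod (fun i : 'I_k => free_group 'I_(m i - 1)) *
           {ffun 'I_r -> GRing.to_multiplicative int})%type,
        (linked_classes L #= `I_c)%card &
        n%:Z - 1 - \sum_(i < k) ((m i)%:Z - 1) =
          (c%:Z - 1) + (#|` simple_lines L|)%:Z].
Proof.
have pP q : multiple_point L q <-> exists i, q = p i.
  have -> : multiple_point L q = [set q | multiple_point L q] q :> Prop by [].
  by rewrite -hp; split=> [[i _ <-]|[i ->]]; exists i.
have L0 : (0 < #|` L|)%N by rewrite hLn.
have [r [rE iso]] := pi1_starred u0 hLreal L0 (collinear_starred hLreal hcol) hpinj pP hm.
have [c [cE nE]] := count_lines hLreal hcol hpinj pP.
(* At a multiple point [m i] exceeds 2, so truncated subtraction agrees with subtraction of
   integers. *)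
have sumE : \sum_(i < k) ((m i)%:Z - 1) = (\sum_(i < k) (m i - 1)%N)%N%:Z.
  rewrite (big_morph Posz PoszD (erefl _)); apply: eq_bigr => i _.
  have : multiple_point L (p i) by apply/pP; exists i.
  by rewrite /multiple_point -hm => m2; rewrite -subzn // ltnW // ltnW.
exists r, c; rewrite sumE; split=> //; first by rewrite -hLn rE !PoszD; ring.
rewrite -hLn nE (eq_bigr (fun i => m i - 1)%N) => [|i _]; last by rewrite hm.
by rewrite !PoszD; ring.
Qed.
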